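(* Let $m\ge 1$, $k=\lfloor m/2\rfloor$, and let $\Omega\subset\mathbb{R}^2$ be a bounded convex domain with $C^\infty$ boundary, approximated by polygonal domains $\Omega_h\subseteq\Omega$, $0<h\le 1$, with tessellations $\mathcal{T}_h$ as described in the context. Let $\gamma>0$. For all $\phi,\psi\in\mathcal{H}(\Omega_h)$ it holds that $$|\mathcal{A}_{h,\gamma}(\phi,\psi)|\lesssim\vert\!\vert\!\vert\phi\vert\!\vert\!\vert_{\Omega_h}\,\vert\!\vert\!\vert\psi\vert\!\vert\!\vert_{\Omega_h}.$$ Moreover, there exists $\gamma_0>0$ such that for all $\gamma>\gamma_0$ the bilinear form $\mathcal{A}_{h,\gamma}$ verifies, for all $\phi\in V_h$, $$\mathcal{A}_{h,\gamma}(\phi,\phi)\gtrsim\vert\!\vert\!\vert\phi\vert\!\vert\!\vert_{\Omega_h}^2 ,$$ provided $h<h_0$ with $h_0=h_0(\gamma)>0$.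
   Context: Notation $A\lesssim B$ (resp. $A\gtrsim B$): $A\le CB$ (resp. $A\ge CB$) with $C>0$ independent of the mesh size $h$, of the element diameters and of the specific shape of the elements, but possibly depending on $m$, on the shape regularity constants $\alpha_0,\alpha_1$ below, and on $\gamma$. $\|\cdot\|_{s,D}$, $|\cdot|_{s,D}$ are the norm and seminorm of $H^s(D)$. $\mathbb{P}_m$ is the space of polynomials of degree $\le m$, with $\mathbb{P}_{-1}=\{0\}$. Domains and meshes. For $0<h\le1$, $\Omega_h$ is a polygonal domain with a quasi-uniform tessellation $\mathcal{T}_h$ into polygons $K$ of diameter $h_K\simeq h$. All vertices of $\mathcal{T}_h$ lying on $\partial\Omega_h$ also lie on $\partial\Omega$ (so $\Omega_h\subseteq\Omega$ by convexity). There are constants $\alpha_0,\alpha_1>0$ such that each $K\in\mathcal{T}_h$ is star-shaped with respect to a ball of radius $\ge\alpha_0h_K$ and the distance between any two vertices of $K$ is $\ge\alpha_1h_K$. $\mathcal{E}^K$ is the set of edges of $K$; $\mathcal{E}^\partial$ is the set of edges of $\mathcal{T}_h$ lying on $\partial\Omega_h$. $\nu_h$ is the outer unit normal to $\Omega_h$, and $\partial_{\nu_h}^j$ is the $j$-th derivative in direction $\nu_h$. For $x\in\partial\Omega_h$, $\delta(x)\ge0$ is the non-negative scalar with $x+\delta(x)\nu_h(x)\in\partial\Omega$, and $\delta_h=\sup_{x\in\partial\Omega_h}\delta(x)$; since $\Omega$ is smooth and convex, $\delta_h=O(h^2)$. Virtual element space. $\mathbb{B}_m(\partial K)=\{v\in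 C^0(\partial K): v|_e\in\mathbb{P}_m\ \forall e\in\mathcal{E}^K\}$, $V^{K,m}=\{v\in H^1(K): v|_{\partial K}\in\mathbb{B}_m(\partial K),\ \Delta v\in\mathbb{P}_{m-2}\}$, $V_h=\{v\in H^1(\Omega_h): v|_K\in V^{K,m}\ \forall K\in\mathcal{T}_h\}$. Projector. $a^K(\phi,\psi)=\int_K\nabla\phi\cdot\nabla\psi$; $\Pi^\nabla_K:H^1(K)\to\mathbb{P}_m$ is defined by $a^K(\Pi^\nabla_K\phi,p)=a^K(\phi,p)$ for all $p\in\mathbb{P}_m$ and $\int_K\Pi^\nabla_K\phi=\int_K\phi$; $\Pi^\nabla$ is defined elementwise by $(\Pi^\nabla\phi)|_K=\Pi^\nabla_K(\phi|_K)$. On a boundary edge $e$, traces of derivatives of $\Pi^\nabla\phi$ are taken from the unique element $K_e$ having $e$ as an edge. Discrete forms. $a_h(\phi,\psi)=\sum_{K}a_h^K(\phi,\psi)$ with $a_h^K(\phi,\psi)=a^K(\Pi^\nabla_K\phi,\Pi^\nabla_K\psi)+S_a^K(\phi-\Pi^\nabla_K\phi,\psi-\Pi^\nabla_K\psi)$, where $S_a^K$ is a bilinear form satisfying $a^K(\phi,\phi)\lesssim S_a^K(\phi,\phi)\lesssim a^K(\phi,\phi)$ for all $\phi\in V^{K,m}$ with $\Pi^\nabla_K\phi=0$. For $\gamma>0$, $$\mathcal{B}_{h,\gamma}(\phi,\psi)=a_h(\phi,\psi)-\sum_{e\in\mathcal{E}^\partial}\int_e\partial_{\nu_h}\Pi^\nabla(\phi)\,\psi-\sum_{e\in\mathcal{E}^\partial}\int_e\partial_{\nu_h}\Pi^\nabla(\psi)\,\phi+\gamma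 h^{-1}\int_{\partial\Omega_h}\phi\psi,$$ $$\mathcal{A}_{h,\gamma}(\phi,\psi)=\mathcal{B}_{h,\gamma}(\phi,\psi)-\sum_{e\in\mathcal{E}^\partial}\int_e\Big(\sum_{j=1}^k\frac{\delta^j}{j!}\partial_{\nu_h}^j\Pi^\nabla(\phi)\Big)\big(\partial_{\nu_h}\Pi^\nabla(\psi)-\gamma h^{-1}\psi\big).$$ Norm and space. $\vert\!\vert\!\vert\phi\vert\!\vert\!\vert_{\Omega_h}^2=|\phi|_{1,\Omega_h}^2+h^{-1}\|\phi\|_{0,\partial\Omega_h}^2$, and $\mathcal{H}(\Omega_h)$ is the closure of $C^\infty(\overline{\Omega_h})$ with respect to this norm.
   Formalization: For the continuity bound only, S_a^K is additionally assumed continuous on the kernel of Π^∇_K in H^1(K), |S(f,g)| ≤ s2|f|_{1,K}|g|_{1,K}, uniformly in h and K; without it the bound fails, e.g. after adding a large skew form to S. Coercivity does not use it. *)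

(* Defs.v *)
From HB Require Import structures.
From mathcomp Require Import all_boot all_order all_algebra.
From mathcomp Require Import all_classical all_reals all_analysis.
Import Order.TTheory GRing.Theory Num.Theory numFieldNormedType.Exports.

Set Implicit Arguments.
Unset Strict Implicit.
Unset Printing Implicit Defensive.

Local Open Scope classical_set_scope.
Local Open Scope ring_scope.

Notation plane R := (R * R)%type.

Section Plane.
Context {R : realType}.
Local Notation pt := (plane R).
Implicit Types (x y n : pt) (e : pt * pt) (D K : set pt) (f g : pt -> R).

(* The norm of the product type [R * R] is the maximum norm; lengths, balls
   and diameters below are Euclidean. *)
Definition dot x y : R := x.1 * y.1 + x.2 * y.2.
Definition enorm x : R := Num.sqrt (dot x x).

Definition boundary D : set pt := closure D `\` D°.

Definition diam D : R :=
  sup [set r | exists x y, [/\ D x, D y & r = enorm (x - y)]].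

(* An edge is the pair of its end points. *)
Definition on_edge e (s : R) : pt := e.1 + s *: (e.2 - e.1).
Definition segment e : set pt := on_edge e @` `[0, 1].
Definition edges (vs : seq pt) : seq (pt * pt) := zip vs (rot 1 vs).

(* [vs] lists the vertices of a simple closed polygonal curve (flat angles are
   allowed), and the curve is the boundary of the bounded open set [D]; [D] is
   then the interior domain of that curve. *)
Definition polygon D (vs : seq pt) : Prop :=
  [/\ open D, D !=set0, bounded_set D,
      [/\ (2 < size vs)%N, uniq vs &
        forall e e', e \in edges vs -> e' \in edges vs -> e != e' ->
          forall x, segment e x -> segment e' x ->
            (x = e.1 \/ x = e.2) /\ (x = e'.1 \/ x = e'.2)] &
      boundary D = [set x | exists2 e, e \in edges vs & segment e x]].

Definition star_shaped D (r : R) : Prop :=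
  exists x0, (forall x, enorm (x - x0) < r -> D x) /\
    forall x y t, enorm (x - x0) < r -> D y -> 0 <= t <= 1 ->
      D (x + t *: (y - x)).

Definition basis_vec (b : bool) : pt := if b then (0, 1) else (1, 0).
Definition pd (b : bool) f : pt -> R := fun x => 'D_(basis_vec b) f x.
Definition laplacian f : pt -> R :=
  fun x => pd false (pd false f) x + pd true (pd true f) x.

Definition dnormal n (j : nat) f : pt -> R :=
  iter j (fun g x => 'D_n g x) f.

(* All iterated partial derivatives of [f] are differentiable everywhere. *)
Definition Cinfty f : Prop :=
  forall (w : seq bool) x, differentiable (foldr pd f w) x.

Definition test_function D f : Prop :=
  Cinfty f /\ exists A : set pt, [/\ compact A, A `<=` D &
    forall x, ~ A x -> f x = 0].

Definition smooth_convex_domain D : Prop :=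
  [/\ open D, D !=set0, bounded_set D,
      convex_set D &
      forall x, boundary D x ->
        exists U : set pt, exists rho : pt -> R,
          [/\ open_nbhs x U, Cinfty rho,
              (pd false rho x, pd true rho x) <> 0,
              D `&` U = [set y | U y /\ rho y < 0] &
              boundary D `&` U = [set y | U y /\ rho y = 0]]].

Definition plane_measure :
  {measure set (measurableTypeR R * measurableTypeR R) -> \bar R} :=
  (@lebesgue_measure R \x @lebesgue_measure R)%E.

Definition area_int D f : R := Rintegral plane_measure D f.

Definition edge_int e f : R :=
  enorm (e.2 - e.1) * Rintegral lebesgue_measure `[0, 1] (f \o on_edge e).

Definition L2 D f : Prop :=
  measurable_fun D f /\ plane_measure.-integrable D (EFin \o (fun x => f x ^+ 2)).

Definition L2_edge e f : Prop :=
  measurable_fun (`[0, 1] : set R) (f \o on_edge e) /\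
  lebesgue_measure.-integrable `[0, 1] (EFin \o (fun s => f (on_edge e s) ^+ 2)).

Definition is_weak_grad D f (G : bool -> pt -> R) : Prop :=
  forall b, L2 D (G b) /\
    forall eta, test_function D eta ->
      area_int D (fun x => f x * pd b eta x) =
      - area_int D (fun x => G b x * eta x).

Definition H1 D f : Prop := L2 D f /\ exists G, is_weak_grad D f G.

(* Unique up to a null set; only its integrals are used. *)
Definition weak_grad D f : bool -> pt -> R :=
  xget (fun _ _ => 0) [set G | is_weak_grad D f G].

(* The form a^D, and the squared seminorm and norm of H^1(D). *)
Definition dirichlet D f g : R :=
  area_int D (fun x => weak_grad D f false x * weak_grad D g false x
                     + weak_grad D f true x * weak_grad D g true x).
Definition H1semi2 D f : R := dirichlet D f f.
Definition H1norm2 D f : R := area_int D (fun x => f x ^+ 2) + H1semi2 D f.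

(* [es] lists the edges that make up the boundary of [D]. *)
Definition is_trace D (es : seq (pt * pt)) f (t : pt -> R) : Prop :=
  (forall e, e \in es -> L2_edge e t) /\
  exists u : nat -> pt -> R,
    [/\ forall j, Cinfty (u j),
        H1norm2 D (fun x => u j x - f x) @[j --> \oo] --> (0 : R) &
        forall e, e \in es ->
          edge_int e (fun x => (u j x - t x) ^+ 2) @[j --> \oo] --> (0 : R)].

Definition trace D (es : seq (pt * pt)) f : pt -> R :=
  xget (fun=> 0) [set t | is_trace D es f t].

(* Polynomials of total degree at most [d]; only 0 when [d < 0]. *)
Definition Pol (d : int) f : Prop :=
  exists c : nat -> nat -> R, forall x,
    f x = \sum_(i < `|d|.+1) \sum_(j < `|d|.+1 | ((i + j)%N%:Z <= d)%R)
            c i j * x.1 ^+ i * x.2 ^+ j.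

Definition Bspace K (vs : seq pt) (m : nat) f : Prop :=
  {within boundary K, continuous f} /\
  forall e, e \in edges vs ->
    exists2 p, Pol m%:Z p & forall x, segment e x -> f x = p x.

Definition Vloc K (vs : seq pt) (m : nat) f : Prop :=
  [/\ H1 K f,
      exists2 b, Bspace K vs m b & is_trace K (edges vs) f b &
      exists2 q, Pol (m%:Z - 2) q & forall eta, test_function K eta ->
        area_int K (fun x => f x * laplacian eta x) =
        area_int K (fun x => q x * eta x)].

Definition Pi_nabla K (m : nat) f : pt -> R :=
  xget (fun=> 0) [set p | [/\ Pol m%:Z p,
    forall q, Pol m%:Z q -> dirichlet K p q = dirichlet K f q &
    area_int K p = area_int K f]].

Definition outer_normal D e : pt :=
  xget 0 [set n | [/\ enorm n = 1, dot n (e.2 - e.1) = 0 &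
    forall s, 0 < s < 1 -> \forall t \near 0^'+,
      ~ D (on_edge e s + t *: n) /\ D (on_edge e s - t *: n)]].

(* Unique for [x] in the relative interior of an edge of [Omega_h]. *)
Definition gap (Omega : set pt) n x : R :=
  xget 0 [set d | 0 <= d /\ boundary Omega (x + d *: n)].

Definition bilinear_on_H1 K (S : (pt -> R) -> (pt -> R) -> R) : Prop :=
  [/\ forall f f' g g', H1 K f -> H1 K f' -> H1 K g -> H1 K g' ->
        {ae plane_measure, forall x, K x -> f x = f' x} ->
        {ae plane_measure, forall x, K x -> g x = g' x} -> S f g = S f' g',
      forall a f f' g, H1 K f -> H1 K f' -> H1 K g ->
        S (fun x => a * f x + f' x) g = a * S f g + S f' g &
      forall a f g g', H1 K f -> H1 K g -> H1 K g' ->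
        S f (fun x => a * g x + g' x) = a * S f g + S f g'].

Definition stabilizing K (vs : seq pt) (m : nat) (s0 s1 : R)
    (S : (pt -> R) -> (pt -> R) -> R) : Prop :=
  bilinear_on_H1 K S /\
  forall f, Vloc K vs m f -> (forall x, Pi_nabla K m f x = 0) ->
    s0 * dirichlet K f f <= S f f <= s1 * dirichlet K f f.

(* The continuity of the stabilization on the kernel of the projector in all
   of H^1(K), which the two-sided bound above does not provide. *)
Definition stab_continuous K (m : nat) (s2 : R)
    (S : (pt -> R) -> (pt -> R) -> R) : Prop :=
  forall f g, H1 K f -> H1 K g ->
    (forall x, Pi_nabla K m f x = 0) -> (forall x, Pi_nabla K m g x = 0) ->
    `|S f g| <= s2 * Num.sqrt (H1semi2 K f) * Num.sqrt (H1semi2 K g).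

End Plane.

(* [dom] is the domain Omega_h; [elt i] and [vtx i] are the i-th (open) element
   and its list of vertices. *)
Record mesh (R : realType) := Mesh {
  dom : set (plane R);
  nelt : nat;
  elt : 'I_nelt -> set (plane R);
  vtx : 'I_nelt -> seq (plane R) }.

Section Mesh.
Context {R : realType}.
Local Notation pt := (plane R).
Implicit Types (Omega : set pt) (T : mesh R) (phi psi : pt -> R).

Definition admissible Omega (alpha0 alpha1 q0 q1 h : R) T : Prop :=
  [/\ (exists vs, polygon (dom T) vs) /\ dom T `<=` Omega,
      [/\ forall i, polygon (elt i) (@vtx _ T i),
          forall i j, i != j -> @elt _ T i `&` elt j = set0 &
          closure (dom T) = \bigcup_(i in [set: 'I_(nelt T)]) closure (elt i)],
      forall i, q0 * h <= diam (@elt _ T i) <= q1 * h,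
      forall i x, x \in @vtx _ T i -> boundary (dom T) x -> boundary Omega x &
      forall i,
        (exists2 r, alpha0 * diam (@elt _ T i) <= r & star_shaped (elt i) r) /\
        forall x y, x \in @vtx _ T i -> y \in vtx i -> x != y ->
          alpha1 * diam (elt i) <= enorm (x - y)].

(* The edges on the boundary of Omega_h, each with the element it belongs to. *)
Definition boundary_edges T : seq ('I_(nelt T) * (pt * pt)) :=
  [seq ie <- [seq (i, e) | i <- enum 'I_(nelt T), e <- edges (vtx i)]
     | `[< segment ie.2 `<=` boundary (dom T) >]].

Definition bsum T (F : 'I_(nelt T) -> pt * pt -> R) : R :=
  \sum_(ie <- boundary_edges T) F ie.1 ie.2.

Definition btrace T phi : pt -> R :=
  trace (dom T) [seq ie.2 | ie <- boundary_edges T] phi.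

Definition Vh T (m : nat) phi : Prop :=
  H1 (dom T) phi /\ forall i, Vloc (elt i) (@vtx _ T i) m phi.

Definition stab_form T := 'I_(nelt T) -> (pt -> R) -> (pt -> R) -> R.

Definition a_h T (m : nat) (S : stab_form T) phi psi : R :=
  let P (i : 'I_(nelt T)) f := Pi_nabla (elt i) m f in
  \sum_(i < nelt T) (dirichlet (elt i) (P i phi) (P i psi)
    + S i (fun x => phi x - P i phi x) (fun x => psi x - P i psi x)).

Definition B_form T (m : nat) (S : stab_form T) (h gamma : R) phi psi : R :=
  let P (i : 'I_(nelt T)) f := Pi_nabla (elt i) m f in
  let nu e := outer_normal (dom T) e in
  a_h m S phi psi
  - bsum (fun i e => edge_int e (fun x =>
      dnormal (nu e) 1 (P i phi) x * btrace T psi x))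
  - bsum (fun i e => edge_int e (fun x =>
      dnormal (nu e) 1 (P i psi) x * btrace T phi x))
  + gamma * h^-1 * bsum (fun (i : 'I_(nelt T)) e => edge_int e (fun x =>
      btrace T phi x * btrace T psi x)).

Definition A_form Omega T (m k : nat) (S : stab_form T) (h gamma : R)
    phi psi : R :=
  let P (i : 'I_(nelt T)) f := Pi_nabla (elt i) m f in
  let nu e := outer_normal (dom T) e in
  B_form m S h gamma phi psi
  - bsum (fun i e => edge_int e (fun x =>
      (\sum_(1 <= j < k.+1) gap Omega (nu e) x ^+ j / (j`!)%:R
         * dnormal (nu e) j (P i phi) x)
      * (dnormal (nu e) 1 (P i psi) x - gamma * h^-1 * btrace T psi x))).

Definition triple_norm T (h : R) phi : R :=
  Num.sqrt (H1semi2 (dom T) phi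
    + h^-1 * bsum (fun (i : 'I_(nelt T)) e =>
               edge_int e (fun x => btrace T phi x ^+ 2))).

(* The closure of the smooth functions, taken in H^1(Omega_h), where the weak
   gradient and the trace that enter the norm exist. *)
Definition Hspace T (h : R) phi : Prop :=
  H1 (dom T) phi /\
  exists u : nat -> pt -> R, (forall j, Cinfty (u j)) /\
    triple_norm T h (fun x => u j x - phi x) @[j --> \oo] --> (0 : R).

End Mesh.

(* Main.v *)
(* Let d_K(phi)^2 be the Dirichlet energy of phi on K and t_e(phi)^2 = h^-1 int_e phi^2, so that
   the squared norm is the sum of all d_K^2 and of all t_e^2 over boundary edges. An inverse
   estimate on the ball contained in K, obtained by testing the weak gradient of the projection
   against smooth functions dual to monomials, gives |d_n^j Pi phi| <= C h^-j d_K(phi) on the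
   closure of K; by Cauchy-Schwarz every boundary term is then at most C (d_K + t_e)(phi) (d_K + t_e)(psi),
   the terms with delta carrying a factor sup delta / h. This gives continuity, because delta = O(h)
   and the number of edges of K is bounded. For coercivity the consistency terms are absorbed by
   Young's inequality and a large gamma, and the terms with delta by delta = o(h). The latter comes
   from the strict differentiability of the functions defining the boundary of Omega: a convex set
   with differentiable boundary rises by o(h) above a chord of length O(h) below which it contains
   a ball of radius of order h; compactness of the boundary makes this uniform. *)
Require Import Defs.
From mathcomp Require Import all_boot all_order all_algebra.
From mathcomp Require Import all_classical all_reals all_analysis.
From mathcomp Require Import measurable_realfun ring lra.
Import Order.TTheory GRing.Theory Num.Theory numFieldNormedType.Exports.
Local Open Scope classical_set_scope.
Local Open Scope ring_scope.

Set Implicit Arguments.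
Unset Strict Implicit.

(** * Smooth functions and integration in the plane *)

Section SmoothFunctions.
Context {R : realType}.
Local Notation pt := (plane R).

(** Constants must not see the shape of an element. The inverse estimates use of it only an
    inscribed square of half-side c h and the inclusion of the closure in a concentric square of
    half-side Lam c h; polynomials are therefore written in monomials centred at and scaled to the
    inscribed square. The weak gradient is fixed only up to null sets, so the Dirichlet form is
    bilinear only once the fundamental lemma of the calculus of variations gives uniqueness almost
    everywhere. The projection, trace, normal and gap are picked by [xget]: each is either what it
    should be or a default value, and every estimate is proved for both. An admissible mesh relates
    elements and domain only through closures; to place the elements inside the domain one must know
    that a polygon fills the interior of its closure, which is an argument about the sides of a
    closed curve near each of its points. The gap enters through one number eta with delta <= eta h:
    continuity takes a fixed eta, coercivity a small one that depends on gamma, whence the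
    dependence of h_0 on gamma. *)

Lemma Cinfty_pd b (f : pt -> R) : Cinfty f -> Cinfty (pd b f).
Proof. by move=> Cf w x; have := Cf (rcons w b) x; rewrite foldr_rcons. Qed.

Lemma Cinfty_diff (f : pt -> R) x : Cinfty f -> differentiable f x.
Proof. by move/(_ [::] x). Qed.

(** Coinduction in disguise: to prove smoothness it suffices to exhibit a class of differentiable
    functions stable under [pd], without any formula for higher derivatives. *)
Lemma Cinfty_ind (P : (pt -> R) -> Prop) :
  (forall f, P f -> (forall x, differentiable f x) /\ forall b, P (pd b f)) ->
  forall f, P f -> Cinfty f.
Proof.
move=> HP f Pf w; elim/last_ind: w f Pf => [|w b IH] f Pf x /=.
  by have [] := HP f Pf.
by rewrite foldr_rcons; apply: IH; have [_ H] := HP f Pf; apply: H.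
Qed.

Lemma pd_false_slice (f : pt -> R) (x : pt) :
  pd false f x = derive1 (fun t => f (t, x.2)) x.1.
Proof.
rewrite /pd /derive /derive1.
rewrite (_ : (fun h => _) = fun h => h^-1 *: ((fun t => f (t, x.2)) (h + x.1) - (fun t => f (t, x.2)) x.1)) //.
apply/funext => h; congr (_ *: (f _ - f _)); last by case: x.
case: x => x y; apply: (@pair_equal_spec _ _ _ _ _ _).2.
by rewrite /basis_vec /= /GRing.scale /= ?mulr1 ?mulr0 ?add0r.
Qed.

Lemma pd_true_slice (f : pt -> R) (x : pt) :
  pd true f x = derive1 (fun t => f (x.1, t)) x.2.
Proof.
rewrite /pd /derive /derive1.
rewrite (_ : (fun h => _) = fun h => h^-1 *: ((fun t => f (x.1, t)) (h + x.2) - (fun t => f (x.1, t)) x.2)) //.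
apply/funext => h; congr (_ *: (f _ - f _)); last by case: x.
case: x => x y; apply: (@pair_equal_spec _ _ _ _ _ _).2.
by rewrite /basis_vec /= /GRing.scale /= ?mulr1 ?mulr0 ?add0r.
Qed.

Lemma differentiable_fst (x : pt) : differentiable (fst : pt -> R) x.
Proof. by apply: (@linear_differentiable _ _ _ (fst : {linear pt -> R})) => y; exact: cvg_fst. Qed.

Lemma differentiable_snd (x : pt) : differentiable (snd : pt -> R) x.
Proof. by apply: (@linear_differentiable _ _ _ (snd : {linear pt -> R})) => y; exact: cvg_snd. Qed.

Definition smooth1 (u : R -> R) := forall n x, derivable (derive1n n u) x 1.

Lemma smooth1_ind (P : (R -> R) -> Prop) :
  (forall f, P f -> (forall x, derivable f x 1) /\ P (derive1 f)) ->
  forall f, P f -> smooth1 f.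
Proof.
move=> HP f Pf n; elim: n f Pf => [|n IH] f Pf x.
  by have [] := HP f Pf.
by rewrite derive1Sn; apply: IH; have [_ H] := HP f Pf; apply: H.
Qed.

Lemma smooth1_derive u : smooth1 u -> smooth1 (derive1 u).
Proof. by move=> su n x; rewrite -derive1Sn; apply: su. Qed.

Lemma smooth1_derivable u x : smooth1 u -> derivable u x 1.
Proof. by move/(_ 0%N x). Qed.

Definition tensor (u v : R -> R) : pt -> R := fun x => u x.1 * v x.2.

Lemma pd_tensor b u v : smooth1 u -> smooth1 v ->
  pd b (tensor u v) = if b then tensor u (derive1 v) else tensor (derive1 u) v.
Proof.
move=> su sv; apply/funext => x; case: b.
  rewrite pd_true_slice /tensor /=.
  by rewrite derive1Ml //; apply: smooth1_derivable.
rewrite pd_false_slice /tensor /=.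
by rewrite derive1Mr //; apply: smooth1_derivable.
Qed.

Lemma Cinfty_tensor u v : smooth1 u -> smooth1 v -> Cinfty (tensor u v).
Proof.
move=> su sv.
apply: (@Cinfty_ind [set f | exists u v, [/\ smooth1 u, smooth1 v & f = tensor u v]]); last first.
  by exists u, v.
move=> f [{su sv}u' [v' [su sv ->]]]; split=> [x|b].
  apply: differentiableM.
    apply: (@differentiable_comp _ _ _ _ fst u'); first exact: differentiable_fst.
    by apply/derivable1_diffP; apply: smooth1_derivable.
  apply: (@differentiable_comp _ _ _ _ snd v'); first exact: differentiable_snd.
  by apply/derivable1_diffP; apply: smooth1_derivable.
rewrite pd_tensor //; case: b.
  by exists u', (derive1 v'); split; [exact: su|exact: smooth1_derive|].
by exists (derive1 u'), v'; split; [exact: smooth1_derive|exact: sv|].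
Qed.

Lemma pdD b (f g : pt -> R) : (forall x, differentiable f x) ->
  (forall x, differentiable g x) ->
  pd b (fun x => f x + g x) = fun x => pd b f x + pd b g x.
Proof.
move=> df dg; apply/funext => x; rewrite /pd.
by rewrite (@deriveD _ _ _ f g) //; apply: diff_derivable.
Qed.

Lemma pdM b (f g : pt -> R) : (forall x, differentiable f x) ->
  (forall x, differentiable g x) ->
  pd b (fun x => f x * g x) = fun x => pd b f x * g x + f x * pd b g x.
Proof.
move=> df dg; apply/funext => x; rewrite /pd.
rewrite (@deriveM _ _ f g); try exact: diff_derivable.
by rewrite addrC /GRing.scale /=; congr (_ + _); rewrite mulrC.
Qed.

Lemma pdZ b (a : R) (f : pt -> R) : (forall x, differentiable f x) ->
  pd b (fun x => a * f x) = fun x => a * pd b f x.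
Proof.
move=> df; apply/funext => x; rewrite /pd.
by rewrite (@deriveZ _ _ _ f) //; apply: diff_derivable.
Qed.

Lemma CinftyD (f g : pt -> R) : Cinfty f -> Cinfty g -> Cinfty (fun x => f x + g x).
Proof.
move=> Cf Cg.
apply: (@Cinfty_ind [set h | exists f g, [/\ Cinfty f, Cinfty g & h = fun x => f x + g x]]); last first.
  by exists f, g.
move=> h [{Cf Cg}f' [g' [Cf Cg ->]]]; split=> [x|b].
  by apply: differentiableD; apply: Cinfty_diff.
rewrite pdD; try by move=> x; apply: Cinfty_diff.
by exists (pd b f'), (pd b g'); split => //; apply: Cinfty_pd.
Qed.

Lemma CinftyZ (a : R) (f : pt -> R) : Cinfty f -> Cinfty (fun x => a * f x).
Proof.
move=> Cf.
apply: (@Cinfty_ind [set h | exists2 f, Cinfty f & h = fun x => a * f x]); last first.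
  by exists f.
move=> h [{Cf}f' Cf ->]; split=> [x|b].
  by apply: differentiableZ; apply: Cinfty_diff.
rewrite pdZ; try by move=> x; apply: Cinfty_diff.
by exists (pd b f') => //; apply: Cinfty_pd.
Qed.

Lemma smooth1_cst (c : R) : smooth1 (fun=> c).
Proof.
apply: (@smooth1_ind [set h | exists c, h = fun=> c]); last by exists c.
move=> f [{}c ->]; split=> [x|]; first exact: derivable_cst.
by exists 0; apply/funext => x; rewrite (derive1_cst c).
Qed.

Lemma Cinfty_cst (c : R) : Cinfty (fun=> c).
Proof.
have := Cinfty_tensor (@smooth1_cst c) (@smooth1_cst 1).
by rewrite /tensor; under eq_fun do rewrite mulr1.
Qed.

Lemma Cinfty_sum (I : Type) (s : seq I) (P : pred I) (f : I -> pt -> R) :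
  (forall i, P i -> Cinfty (f i)) -> Cinfty (fun x => \sum_(i <- s | P i) f i x).
Proof.
move=> Cf; elim: s => [|i s IH].
  rewrite (_ : (fun x => _) = fun=> 0); first exact: Cinfty_cst.
  by apply/funext => x; rewrite big_nil.
case Pi : (P i).
  rewrite (_ : (fun x => _) = fun x => f i x + \sum_(j <- s | P j) f j x).
    by apply: CinftyD => //; apply: Cf.
  by apply/funext => x; rewrite big_cons Pi.
rewrite (_ : (fun x => _) = fun x => \sum_(j <- s | P j) f j x) //.
by apply/funext => x; rewrite big_cons Pi.
Qed.

Lemma smooth1D u v : smooth1 u -> smooth1 v -> smooth1 (fun x => u x + v x).
Proof.
move=> su sv.
apply: (@smooth1_ind [set h | exists f g, [/\ smooth1 f, smooth1 g & h = fun x => f x + g x]]); last first.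
  by exists u, v.
move=> h [{su sv}f' [g' [Cf Cg ->]]]; split=> [x|].
  by apply: derivableD; apply: smooth1_derivable.
exists (derive1 f'), (derive1 g'); split; try exact: smooth1_derive.
apply/funext => x; rewrite !derive1E (@deriveD _ _ _ f' g') //; exact: smooth1_derivable.
Qed.

Lemma smooth1Z a u : smooth1 u -> smooth1 (fun x => a * u x).
Proof.
move=> su.
apply: (@smooth1_ind [set h | exists2 f, smooth1 f & h = fun x => a * f x]); last first.
  by exists u.
move=> h [{su}f' Cf ->]; split=> [x|].
  by apply: derivableZ; apply: smooth1_derivable.
exists (derive1 f'); first exact: smooth1_derive.
apply/funext => x; rewrite !derive1E (@deriveZ _ _ _ f') //; exact: smooth1_derivable.
Qed.

(** Leibniz's rule turns one product into a sum of two, so products alone are not stable under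
    [derive1]; their finite sums are. *)
Inductive product_sum : (R -> R) -> Prop :=
  | product_sum_mul u v of smooth1 u & smooth1 v : product_sum (fun x => u x * v x)
  | product_sum_add f g of product_sum f & product_sum g :
      product_sum (fun x => f x + g x).

Lemma smooth1M u v : smooth1 u -> smooth1 v -> smooth1 (fun x => u x * v x).
Proof.
move=> su sv; apply: (@smooth1_ind product_sum); last exact: product_sum_mul.
move=> f; elim=> {u v su sv f} [u v su sv|f g _ [df pf] _ [dg pg]]; split.
- by move=> x; apply: derivableM; apply: smooth1_derivable.
- have -> : derive1 (fun x => u x * v x) = fun x => derive1 u x * v x + u x * derive1 v x.
    apply/funext => y; rewrite !derive1E (@deriveM _ _ u v); try exact: smooth1_derivable.
    by rewrite /GRing.scale /= addrC; congr (_ + _); rewrite mulrC.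
  by apply: product_sum_add; apply: product_sum_mul;
    [exact: smooth1_derive|assumption|assumption|exact: smooth1_derive].
- by move=> x; apply: derivableD.
- have -> : derive1 (fun x => f x + g x) = fun x => derive1 f x + derive1 g x.
    by apply/funext => y; rewrite !derive1E (@deriveD _ _ _ f g).
  exact: product_sum_add.
Qed.

Lemma smooth1_affine (c d : R) u : smooth1 u -> smooth1 (fun x => u (c * x + d)).
Proof.
move=> su.
apply: (@smooth1_ind [set h | exists2 f, smooth1 f & exists a, h = fun x => a * f (c * x + d)]); last first.
  by exists u => //; exists 1; under [RHS]eq_fun do rewrite mul1r.
have daff (x : R) : is_derive x 1 (fun x : R => c * x + d) c.
  have := is_deriveD (@is_deriveZ _ _ _ (id : R -> R) c x 1 1 (is_derive_id x 1)) (is_derive_cst d x 1).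
  by rewrite addr0 /GRing.scale /= mulr1.
move=> _ [f sf [a ->]]; have dcomp (x : R) : is_derive x (1 : R) (fun x => a * f (c * x + d)) (a * (derive1 f (c * x + d) * c)).
  have df : is_derive (c * x + d) 1 f (derive1 f (c * x + d)).
    by rewrite derive1E; apply: derivableP; exact: smooth1_derivable.
  have := @is_deriveZ _ _ _ (fun x => f (c * x + d)) a x 1 _ (@is_derive1_comp _ f (fun x => c * x + d) x _ _ df (daff x)).
  by [].
split=> [x|]; first by have [] := dcomp x.
exists (derive1 f); first exact: smooth1_derive.
exists (a * c); apply/funext => x.
by rewrite derive1E; have [_ ->] := dcomp x; rewrite mulrCA mulrC -mulrA mulrCA.
Qed.

Lemma smooth1_horner (p : {poly R}) : smooth1 (horner p).
Proof.
apply: (@smooth1_ind [set h | exists p : {poly R}, h = horner p]); last by exists p.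
move=> _ [q ->]; split=> [x|]; first exact: derivable_horner.
by exists (deriv q); rewrite derivE.
Qed.

(** The functions p(1/t) exp(-1/t), flat at 0. Carrying the polynomial p makes the class stable
    under differentiation, which replaces p by X^2 (p - p'). *)
Definition exp_inv (p : {poly R}) : R -> R :=
  fun t => if 0 < t then p.[t^-1] * expR (- t^-1) else 0.

(** The power of s is kept free because the induction step for p X + c moves one factor s from the
    polynomial into it; the constant c is handled by exp(s) >= s^k / k!. *)
Lemma horner_expR_bound (p : {poly R}) (k : nat) :
  exists M : R, forall s : R, 0 <= s -> `|s ^+ k * p.[s] * expR (- s)| <= M.
Proof.
elim/poly_ind: p k => [|p c IH] k.
  by exists 0 => s _; rewrite horner0 mulr0 mul0r normr0.
have [M HM] := IH k.+1.
exists (M + `|c| * (k`!)%:R) => s s0.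
have -> : s ^+ k * (p * 'X + c%:P).[s] * expR (- s) =
    s ^+ k.+1 * p.[s] * expR (- s) + c * (s ^+ k * expR (- s)).
  by rewrite hornerD hornerM hornerX hornerC exprS; ring.
apply: le_trans (ler_normD _ _) _; apply: lerD; first exact: HM.
rewrite normrM ler_wpM2l // ger0_norm ?mulr_ge0 ?exprn_ge0 ?expR_ge0 //.
rewrite expRN ler_pdivrMr ?expR_gt0 //.
case: k {IH M HM} => [|k].
  by rewrite expr0 fact0 mul1r; apply: le_trans (expR_ge1Dx s); rewrite lerDl.
have kf : 0 < (k.+1`!)%:R :> R by rewrite ltr0n fact_gt0.
by rewrite mulrC -ler_pdivrMr //; apply: le_trans (expR_ge1Dxn k s0); rewrite lerDr.
Qed.

Lemma is_derive_exp_inv (p : {poly R}) (t : R) :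
  is_derive t (1 : R) (exp_inv p) (exp_inv ('X^2 * (p - deriv p)) t).
Proof.
have [t0|t0|->] := ltgtP t 0.
- have -> : exp_inv ('X^2 * (p - deriv p)) t = 0 by rewrite /exp_inv ltNge (ltW t0).
  apply: (@near_eq_is_derive _ _ _ (cst 0)).
  near=> y; rewrite /exp_inv ltNge.
  by have -> : y <= 0 by apply: ltW; near: y; apply: lt_nbhsl.
- have t0' : t != 0 by rewrite gt_eqF.
  have dV := @is_deriveV _ (id : R -> R) t 1 1 t0' (is_derive_id t 1).
  have dp := @is_derive1_comp _ (horner p) _ t _ _ (is_derive_poly p t^-1) dV.
  have de := @is_derive1_comp _ expR _ t _ _ (is_derive_expR (- t^-1)) (is_deriveN dV).
  have dpe := is_deriveM dp de.
  have ne : \near t, (fun x : R => p.[x^-1] * expR (- x^-1)) t = exp_inv p t.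
    near=> y; rewrite /exp_inv.
    by have -> : 0 < y by near: y; apply: lt_nbhsr.
  have := near_eq_is_derive ne dpe.
  rewrite /exp_inv t0 !hornerE /GRing.scale /= mulr1.
  rewrite (_ : _ + _ = t^-1 ^+ 2 * (p.[t^-1] - (deriv p).[t^-1]) * expR (- t^-1)) //.
  by field.
- rewrite /exp_inv ltxx.
  (* With s = 1/h the difference quotient at 0 is s p(s) exp(-s) = h s^2 p(s) exp(-s), so a bound
     with the power 2 leaves a factor h that tends to 0. *)
  have [M HM] := horner_expR_bound p 2.
  have M1 : 0 < `|M| + 1 by rewrite ltr_wpDl.
  have H : (fun h : R => h^-1 *: ((exp_inv p \o shift 0) (h *: (1 : R)) - exp_inv p 0))
      @ 0^' --> (0 : R).
    apply/cvgrPdist_le => /= e e0; near=> h.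
    have h0 : h != 0 by near: h; exact: nbhs_dnbhs_neq.
    rewrite sub0r normrN /exp_inv ltxx subr0 addr0 /GRing.scale /= mulr1.
    case: ifP => hp; last by rewrite mulr0 normr0 ltW.
    have h1 : 0 <= h^-1 by rewrite invr_ge0 ltW.
    have := HM _ h1.
    have -> : h^-1 ^+ 2 * p.[h^-1] * expR (- h^-1) =
        h^-1 * (h^-1 * (p.[h^-1] * expR (- h^-1))) by ring.
    rewrite normrM ger0_norm // ler_pdivrMl // => /le_trans; apply.
    have : `|h| <= e / (`|M| + 1).
      near: h; apply: (@dnbhs0_le R R); exact: divr_gt0.
    rewrite ler_pdivlMr // gtr0_norm // => H; apply: le_trans H.
    by rewrite ler_wpM2l ?(ltW hp) // (le_trans (ler_norm M)) // lerDl.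
  by split; [apply/cvg_ex; exists 0 | exact/cvg_lim].
Unshelve. all: by end_near.
Qed.

Lemma smooth1_exp_inv p : smooth1 (exp_inv p).
Proof.
apply: (@smooth1_ind [set h | exists p, h = exp_inv p]); last by exists p.
move=> _ [q ->]; split=> [x|]; first by have [] := is_derive_exp_inv q x.
exists ('X^2 * (q - deriv q)); apply/funext => x; rewrite derive1E.
by have [_ ->] := is_derive_exp_inv q x.
Qed.

End SmoothFunctions.

(** * Smooth bump functions *)

Section Bumps.
Context {R : realType}.
Local Notation pt := (plane R).

Definition theta : R -> R := exp_inv 1.

Lemma theta_le0 t : t <= 0 -> theta t = 0.
Proof. by move=> t0; rewrite /theta /exp_inv ltNge t0. Qed.

Lemma theta_gt0E t : 0 < t -> theta t = expR (- t^-1).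
Proof. by move=> t0; rewrite /theta /exp_inv t0 hornerC mul1r. Qed.

Lemma theta_gt0 t : 0 < t -> 0 < theta t.
Proof. by move=> t0; rewrite theta_gt0E // expR_gt0. Qed.

Lemma theta_ge0 t : 0 <= theta t.
Proof.
have [t0|t0] := leP t 0; first by rewrite theta_le0.
exact: ltW (theta_gt0 t0).
Qed.

Lemma theta_le1 t : theta t <= 1.
Proof.
have [t0|t0] := leP t 0; first by rewrite theta_le0 // ler01.
by rewrite theta_gt0E // expR_le1 oppr_le0 invr_ge0 ltW.
Qed.

Lemma smooth1_theta : smooth1 theta.
Proof. exact: smooth1_exp_inv. Qed.

Lemma theta_cvg (s : R) : 0 < s -> theta (n%:R * s) @[n --> \oo] --> (1 : R).
Proof.
move=> s0.
have H : (- (n.+1%:R * s)^-1)%R @[n --> \oo] --> (- 0 : R).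
  apply: cvgN.
  have -> : (fun n : nat => (n.+1%:R * s)^-1) = (fun n => n.+1%:R^-1 * s^-1).
    by apply/funext => n; rewrite invfM.
  rewrite -(mul0r s^-1); apply: cvgMl; exact: cvg_harmonic.
have : theta (n.+1%:R * s) @[n --> \oo] --> (1 : R).
  have -> : (fun n : nat => theta (n.+1%:R * s)) = (fun n : nat => expR (- (n.+1%:R * s)^-1)).
    by apply/funext => n; rewrite theta_gt0E // mulr_gt0.
  rewrite -[X in _ --> X](expR0 R) -[X in _ --> expR X]oppr0.
  apply: (@cvg_comp _ _ _ _ (@expR R) _ _ _ H).
  exact: (@continuous_expR R (- 0)).
by move=> H1; rewrite -(cvg_shiftS (fun n : nat => theta (n%:R * s))).
Qed.

(** The parameter c is a steepness: as it grows, these bumps tend to the indicator of the open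
    interval while staying between 0 and 1, so that test functions can imitate boxes. *)
Definition sbump (c a b : R) : R -> R := fun t => theta (c * (t - a)) * theta (c * (b - t)).

Lemma smooth1_sbump c a b : smooth1 (sbump c a b).
Proof.
have -> : sbump c a b = fun t => theta (c * t + - (c * a)) * theta (- c * t + c * b).
  by apply/funext => t; rewrite /sbump mulrBr mulrBr mulNr [- _ + _]addrC.
by apply: smooth1M; apply: smooth1_affine; exact: smooth1_theta.
Qed.

Lemma sbump_ge0 c a b t : 0 <= sbump c a b t.
Proof. by rewrite mulr_ge0 ?theta_ge0. Qed.

Lemma sbump_le1 c a b t : sbump c a b t <= 1.
Proof. by rewrite /sbump mulr_ile1 ?theta_ge0 ?theta_le1. Qed.

Lemma sbump_out (c a b t : R) : 0 <= c -> ~ (a < t < b) -> sbump c a b t = 0.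
Proof.
move=> c0; rewrite /sbump => /negP; rewrite negb_and -!leNgt => /orP[h|h].
  by rewrite [X in X * _]theta_le0 ?mul0r // mulr_ge0_le0 // subr_le0.
by rewrite [X in _ * X]theta_le0 ?mulr0 // mulr_ge0_le0 // subr_le0.
Qed.

Lemma sbump_cvg (a b t : R) :
  sbump n%:R a b t @[n --> \oo] --> (\1_(`]a, b[%classic) t : R).
Proof.
rewrite indicE; have [/set_mem /=|h] := boolP (t \in _).
  rewrite in_itv /= => /andP[at_ tb].
  have at0 : 0 < t - a by rewrite subr_gt0.
  have tb0 : 0 < b - t by rewrite subr_gt0.
  by have H := cvgM (theta_cvg at0) (theta_cvg tb0); rewrite mulr1 in H; exact: H.
have -> : (fun n : nat => sbump n%:R a b t) = (fun=> 0).
  by apply/funext => n; rewrite sbump_out // => h'; move/negP: h; apply; apply: mem_set; rewrite /= in_itv.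
exact: cvg_cst.
Qed.

Lemma test_function_tensor (K : set pt) (a b c d : R) (u v : R -> R) :
  smooth1 u -> smooth1 v ->
  (forall t, ~ (a <= t <= b) -> u t = 0) ->
  (forall t, ~ (c <= t <= d) -> v t = 0) ->
  `[a, b] `*` `[c, d] `<=` K -> test_function K (tensor u v).
Proof.
move=> su sv u0 v0 subK; split; first exact: Cinfty_tensor.
exists (`[a, b] `*` `[c, d]); split => //.
  by apply: compact_setX; exact: segment_compact.
move=> x /not_andP[h|h]; rewrite /tensor; first by rewrite u0 ?mul0r // => h'; apply: h; rewrite /= in_itv.
by rewrite v0 ?mulr0 // => h'; apply: h; rewrite /= in_itv.
Qed.

End Bumps.

(** * Rational boxes and measurability in the plane *)

Section PlaneMeasurability.
Context {R : realType}.
Local Notation pt := (plane R).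
Local Notation mpt := (measurableTypeR R * measurableTypeR R)%type.

(** A countable base of the plane; it makes open sets measurable and lets null sets found box by box
    be united. *)
Definition rat_box (q : (rat * rat) * (rat * rat)) : set pt :=
  `]ratr q.1.1, ratr q.1.2[ `*` `]ratr q.2.1, ratr q.2.2[.

Lemma open_rat_box (U : set pt) x : open U -> U x ->
  exists2 q, rat_box q x &
    `[ratr q.1.1, ratr q.1.2] `*` `[ratr q.2.1, ratr q.2.2] `<=` U.
Proof.
move=> oU Ux.
have /nbhs_ballP[e /= e0 He] : nbhs x U by apply: open_nbhs_nbhs; split.
have rr (t : R) : exists p : rat * rat,
    [/\ t - e < ratr p.1, ratr p.1 < t, t < ratr p.2 & ratr p.2 < t + e].
  have [q1] : exists q, ratr q \in `]t - e, t[ by apply: rat_in_itvoo; rewrite ltrBlDr ltrDl.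
  rewrite in_itv /= => /andP[q1a q1b].
  have [q2] : exists q, ratr q \in `]t, t + e[ by apply: rat_in_itvoo; rewrite ltrDl.
  by rewrite in_itv /= => /andP[q2a q2b]; exists (q1, q2).
have [p [p1 p2 p3 p4]] := rr x.1; have [q [q1 q2 q3 q4]] := rr x.2.
exists (p, q); first by split; rewrite /= in_itv /=; apply/andP.
move=> y [/=]; rewrite !in_itv /= => /andP[y1 y2] /andP[y3 y4]; apply: He; split.
  by rewrite /ball /= ltr_distlC (lt_le_trans p1 y1) (le_lt_trans y2 p4).
by rewrite /ball /= ltr_distlC (lt_le_trans q1 y3) (le_lt_trans y4 q4).
Qed.

Lemma open_measurable_plane (U : set pt) : open U -> measurable (U : set mpt).
Proof.
move=> oU.
have -> : U = \bigcup_q (if asbool (rat_box q `<=` U) then rat_box q else set0).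
  apply/seteqP; split => x.
    move=> Ux; have [q qx qU] := open_rat_box oU Ux.
    exists q => //; case: asboolP => // -[] y [y1 y2]; apply: qU.
    by split; [move: y1|move: y2]; apply: subset_itv_oo_cc.
  by move=> [q _]; case: asboolP => // qU; apply: qU.
apply: countable_bigcupT_measurable => [|q]; first exact: countableP.
by case: asboolP => // _; apply: measurableX.
Qed.

Lemma continuous_measurable_plane (f : pt -> R) (D : set mpt) :
  measurable D -> continuous f -> measurable_fun D (f : mpt -> measurableTypeR R).
Proof.
move=> mD cf; apply: (measurable_funS measurableT) => //.
apply: (measurability _ (RGenOpens.measurableE R)).
move=> _ [_ [a [b ->] <-]]; rewrite setTI; apply: open_measurable_plane.
by move/continuousP: cf; apply; exact: interval_open.
Qed.

End PlaneMeasurability.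

(** * The fundamental lemma of the calculus of variations *)

Section FundamentalLemma.
Context {R : realType}.
Local Notation pt := (plane R).
Local Notation mpt := (measurableTypeR R * measurableTypeR R)%type.
Local Notation mu := (@plane_measure R).

(** Dynkin's theorem: the sets whose preimage carries integral zero are stable under complements,
    because the total integral is zero, and under countable disjoint unions. *)
Lemma integral_preimage_eq0 d d' (X : measurableType d) (T : measurableType d')
    (m : {measure set X -> \bar R}) (f : X -> T) (G : set (set T)) (Z : set X)
    (g : X -> \bar R) :
  measurable_fun setT f -> @measurable _ T = <<s G >> -> setI_closed G ->
  measurable Z -> m.-integrable Z g -> (\int[m]_(x in Z) g x = 0)%E ->
  (forall A, G A -> (\int[m]_(x in Z `&` f @^-1` A) g x = 0)%E) ->
  forall A, measurable A -> (\int[m]_(x in Z `&` f @^-1` A) g x = 0)%E.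
Proof.
move=> mf GE GI mZ gi Z0 G0 A mA.
have mfA B : measurable B -> measurable (Z `&` f @^-1` B).
  by move=> mB; apply: measurableI => //; rewrite -[_ @^-1` _]setTI; apply: mf.
have mg := measurable_int _ gi.
apply: (dynkin_induction (P := fun A => (\int[m]_(x in Z `&` f @^-1` A) g x = 0)%E) GE GI) => //.
- by rewrite preimage_setT setIT.
- move=> S mS S0.
  have E : Z = (Z `&` f @^-1` S) `|` (Z `&` f @^-1` (~` S)).
    by rewrite -setIUr preimage_setC setUCr setIT.
  move: Z0; rewrite {1}E integral_setU //; first by rewrite S0 add0e.
  + exact: mfA.
  + by apply: mfA; exact: measurableC.
  + by rewrite -E.
  + by rewrite disj_set2E; apply/eqP; rewrite -subset0 => x [[_ Sx] [_]]; apply.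
- move=> F mF tF F0; rewrite preimage_bigcup setI_bigcupr.
  rewrite integral_bigcup //; first by rewrite eseries0.
  + apply/trivIsetP => i j _ _ ij; rewrite setIACA setIid.
    move/trivIsetP: tF => /(_ i j I I ij) F'.
    by rewrite -preimage_setI F' preimage_set0 setI0.
  + by move=> k; apply: mfA.
  + apply: (integrableS mZ) => //; first by apply: bigcupT_measurable => k; apply: mfA.
    by move=> x [k _ []].
- by rewrite -GE.
Qed.

Lemma L2_integrable (D : set pt) (g : pt -> R) (E : set pt) :
  measurable (D : set mpt) -> measurable (E : set mpt) -> E `<=` D ->
  (mu E < +oo)%E -> L2 D g -> mu.-integrable E (EFin \o g).
Proof.
move=> mD mE ED fE [mg ig].
have i1 : mu.-integrable E (EFin \o (fun x => 1 + g x ^+ 2)).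
  apply: (@integrableD _ _ _ mu E mE (EFin \o cst 1) (EFin \o (fun x => g x ^+ 2))).
    by apply: measurable_bounded_integrable => //; exact: bounded_cst.
  exact: integrableS ig.
apply: le_integrable i1 => //.
  by apply/measurable_EFinP; exact: measurable_funS mg.
move=> x _ /=; rewrite lee_fin [X in _ <= X]ger0_norm; last by rewrite addr_ge0 ?sqr_ge0.
rewrite ler_norml; apply/andP; split; nra.
Qed.

Lemma ae_planeS (P Q : pt -> Prop) : (forall x, P x -> Q x) ->
  {ae mu, forall x, P x} -> {ae mu, forall x, Q x}.
Proof. exact: (@filterS _ _ (ae_filter_ringOfSetsType mu)). Qed.

Lemma ae_planeS2 (P Q W : pt -> Prop) : (forall x, P x -> Q x -> W x) ->
  {ae mu, forall x, P x} -> {ae mu, forall x, Q x} -> {ae mu, forall x, W x}.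
Proof. exact: (@filterS2 _ _ (ae_filter_ringOfSetsType mu)). Qed.

Lemma box_measurable (i j : interval R) : measurable ([set` i] `*` [set` j] : set mpt).
Proof. by apply: measurableX. Qed.

Lemma box_measure_fin (a b c d : R) : (mu (`[a, b] `*` `[c, d]) < +oo)%E.
Proof.
rewrite /plane_measure /= product_measure1E //=.
by rewrite !lebesgue_measure_itv /=; case: ifP => _; case: ifP => _;
   rewrite ?mule0 ?mul0e -?EFinB -?EFinM ?ltry.
Qed.

(** Products of two bumps converge to the indicator of the open box and are bounded by 1, so
    dominated convergence with majorant |g| passes to the limit in the orthogonality. *)
Lemma test_orthogonal_box (K : set pt) (g : pt -> R) (a b c d : R) :
  open K -> L2 K g ->
  (forall eta, test_function K eta -> area_int K (fun x => g x * eta x) = 0) ->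
  `[a, b] `*` `[c, d] `<=` K ->
  (\int[mu]_(x in `]a, b[ `*` `]c, d[) (g x)%:E = 0)%E.
Proof.
move=> oK Lg Hg QK.
set Q : set mpt := `[a, b] `*` `[c, d] in QK *.
have mK : measurable (K : set mpt) by exact: open_measurable_plane.
have mQ : measurable Q by exact: box_measurable.
have Qfin : (mu Q < +oo)%E by exact: box_measure_fin.
have gQ : mu.-integrable Q (EFin \o g) by exact: L2_integrable Lg.
have mgQ : measurable_fun Q g by move: (measurable_int _ gQ) => /measurable_EFinP.
pose eta n := tensor (sbump n%:R a b) (sbump n%:R c d).
pose f_ n x := (g x * eta n x)%:E.
pose W : set mpt := `]a, b[ `*` `]c, d[.
have mW : measurable W by exact: box_measurable.
have WQ : W `<=` Q by move=> x [x1 x2]; split; [move: x1|move: x2]; apply: subset_itv_oo_cc.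
have tst n : test_function K (eta n).
  apply: test_function_tensor QK; try exact: smooth1_sbump.
    by move=> t H; apply: sbump_out => // /andP[h1 h2]; apply: H; rewrite !ltW.
  by move=> t H; apply: sbump_out => // /andP[h1 h2]; apply: H; rewrite !ltW.
have meta n D : measurable D -> measurable_fun D (eta n : mpt -> measurableTypeR R).
  move=> mD; apply: continuous_measurable_plane => // x.
  by apply: differentiable_continuous; apply: Cinfty_diff; case: (tst n).
have etaQ n x : ~ Q x -> eta n x = 0.
  move=> /not_andP nQ; rewrite /eta /tensor; case: nQ => nQ.
    rewrite [X in X * _]sbump_out ?mul0r // => /andP[h1 h2]; apply: nQ.
    by rewrite /= in_itv /= !ltW.
  rewrite [X in _ * X]sbump_out ?mulr0 // => /andP[h1 h2]; apply: nQ.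
  by rewrite /= in_itv /= !ltW.
have eta1 n x : `|eta n x| <= 1.
  rewrite normrM mulr_ile1 // ger0_norm ?sbump_ge0 ?sbump_le1 //.
have f_0 n : (\int[mu]_(x in Q) f_ n x = 0)%E.
  have H := Hg _ (tst n).
  have E : (\int[mu]_(x in K) f_ n x = \int[mu]_(x in Q) f_ n x)%E.
    rewrite [LHS]integral_mkcond [RHS]integral_mkcond; apply: eq_integral => x _.
    rewrite !patchE; have [xQ|xQ] := boolP (x \in Q).
      by rewrite mem_set //; apply: QK; apply: set_mem.
    case: ifP => // _; rewrite /f_ etaQ ?mulr0 // => Qx.
    by move/negP: xQ; apply; apply: mem_set.
  have fi : mu.-integrable Q (f_ n).
    apply: le_integrable gQ => //.
      by apply/measurable_EFinP; apply: measurable_funM => //; exact: meta.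
    by move=> x Qx /=; rewrite lee_fin normrM ler_piMr.
  have ff : (\int[mu]_(x in Q) f_ n x)%E \is a fin_num by exact: integrable_fin_num.
  by rewrite -(fineK ff) -E; congr (_%:E).
pose f x := (g x * \1_W x)%:E.
have cvf x : Q x -> f_ ^~ x @ \oo --> f x.
  move=> Qx; apply: cvg_EFin; first by near=> n.
  rewrite /= /f -[X in _ --> X]/(g x * \1_W x).
  apply: cvgMr.
  have -> : \1_W x = \1_(`]a, b[%classic) x.1 * \1_(`]c, d[%classic) x.2 :> R.
    by rewrite !indicE /W in_setX -natrM mulnb.
  have H := cvgM (@sbump_cvg R a b x.1) (@sbump_cvg R c d x.2); exact: H.
have mf_ n : measurable_fun Q (f_ n).
  by apply/measurable_EFinP; apply: measurable_funM => //; exact: meta.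
have mf : measurable_fun Q f.
  apply/measurable_EFinP; apply: measurable_funM => //.
have f_f : {ae mu, forall x, Q x -> f_ ^~ x @ \oo --> f x}.
  by apply: aeW => x; exact: cvf.
have ig : mu.-integrable Q (fun x => `|(g x)%:E|%E) by exact: integrable_abse gQ.
have f_g : {ae mu, forall x n, Q x -> (`|f_ n x| <= `|(g x)%:E|)%E}.
  by apply: aeW => x n Qx; rewrite lee_fin normrM ler_piMr.
have [_ _] := @dominated_convergence _ _ _ mu Q mQ f_ f _ mf_ mf f_f ig f_g.
have -> : (fun n => (\int[mu]_(x in Q) f_ n x)%E) = (fun=> 0%E) by apply/funext => n.
move=> /(cvg_unique (@ereal_hausdorff R)) H.
have f0 : (\int[mu]_(x in Q) f x = 0)%E by apply: H; exact: cvg_cst.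
move: f0.
rewrite (_ : f = (EFin \o g) \_ W); last first.
  apply/funext => x; rewrite /f patchE indicE; case: ifP => _; first by rewrite mulr1.
  by rewrite mulr0.
by rewrite -integral_mkcondr (setIidr WQ).
Unshelve. all: by end_near.
Qed.

Lemma open_intervals_setI_closed : setI_closed (@RGenOpens.G R).
Proof.
move=> _ _ [a [b ->]] [c [d ->]]; exists (Num.max a c), (Num.min b d).
by apply/seteqP; split => x /=; rewrite !in_itv /= gt_max lt_min;
  [move=> [/andP[-> ->] /andP[-> ->]]|move=> /andP[/andP[-> ->] /andP[-> ->]]].
Qed.

Lemma rectangles_setI_closed : setI_closed
  [set A `*` B | A in (@measurable _ (measurableTypeR R)) & B in (@measurable _ (measurableTypeR R))].
Proof.
move=> _ _ [A mA [B mB <-]] [A' mA' [B' mB' <-]].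
exists (A `&` A'); first exact: measurableI.
by exists (B `&` B'); [exact: measurableI|rewrite setXI].
Qed.

(** An integrable function with integral zero over every measurable subset vanishes almost
    everywhere. Dynkin's theorem is used three times: intervals to Borel sets in the second
    coordinate ([step2]), then in the first ([step3]), then rectangles to measurable sets of the
    plane ([step4]). *)
Lemma test_orthogonal_ae_box (K : set pt) (g : pt -> R) (a b c d : R) :
  open K -> L2 K g ->
  (forall eta, test_function K eta -> area_int K (fun x => g x * eta x) = 0) ->
  `[a, b] `*` `[c, d] `<=` K ->
  {ae mu, forall x, (`]a, b[ `*` `]c, d[) x -> g x = 0}.
Proof.
move=> oK Lg Hg QK.
pose W : set mpt := `]a, b[ `*` `]c, d[.
have mK : measurable (K : set mpt) by exact: open_measurable_plane.
have mW : measurable W by exact: box_measurable.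
have WQ : W `<=` `[a, b] `*` `[c, d].
  by move=> x [x1 x2]; split; [move: x1|move: x2]; apply: subset_itv_oo_cc.
have Wfin : (mu W < +oo)%E.
  apply: le_lt_trans (box_measure_fin a b c d); apply: le_measure; rewrite ?inE //.
  exact: box_measurable.
have gW : mu.-integrable W (EFin \o g).
  by apply: L2_integrable Lg => // x /WQ; exact: QK.
have mgW : measurable_fun W g by move: (measurable_int _ gW) => /measurable_EFinP.
have sub (Z : set mpt) : measurable Z -> Z `<=` W -> mu.-integrable Z (EFin \o g).
  by move=> mZ ZW; apply: integrableS gW.
have W0 : (\int[mu]_(x in W) (EFin \o g) x = 0)%E by exact: test_orthogonal_box QK.
have fstI B : measurable B -> measurable (W `&` fst @^-1` B).
  by move=> mB; apply: measurableI => //; rewrite -[_ @^-1` _]setTI; exact: measurable_fst.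
have sndI B : measurable B -> measurable (W `&` snd @^-1` B).
  by move=> mB; apply: measurableI => //; rewrite -[_ @^-1` _]setTI; exact: measurable_snd.
have step2 x y B : measurable B ->
    (\int[mu]_(z in (W `&` fst @^-1` `]x, y[) `&` snd @^-1` B) (EFin \o g) z = 0)%E.
  apply: (@integral_preimage_eq0 _ _ _ _ mu snd (@RGenOpens.G R)) => //.
  - exact: RGenOpens.measurableE.
  - exact: open_intervals_setI_closed.
  - by apply: fstI; exact: measurable_itv.
  - by apply: sub; [apply: fstI; exact: measurable_itv|move=> z []].
  - have -> : W `&` fst @^-1` `]x, y[ = `]Num.max a x, Num.min b y[ `*` `]c, d[.
      rewrite /W; apply/seteqP; split => z /=; rewrite !in_itv /= gt_max lt_min.
        by move=> [[/andP[-> ->] ?] /andP[-> ->]].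
      by move=> [/andP[/andP[-> ->] /andP[-> ->]] ?].
    apply: test_orthogonal_box Hg _ => //; apply: subset_trans QK.
    move=> z [] /=; rewrite !in_itv /= ge_max le_min.
    by move=> /andP[/andP[-> _] /andP[-> _]].
  - move=> _ [z [w ->]].
    have -> : W `&` fst @^-1` `]x, y[ `&` snd @^-1` `]z, w[ =
        `]Num.max a x, Num.min b y[ `*` `]Num.max c z, Num.min d w[.
      rewrite /W; apply/seteqP; split => t /=; rewrite !in_itv /= !gt_max !lt_min.
        by move=> [[[/andP[-> ->] /andP[-> ->]] /andP[-> ->]] /andP[-> ->]].
      by move=> [/andP[/andP[-> ->] /andP[-> ->]] /andP[/andP[-> ->] /andP[-> ->]]].
    apply: test_orthogonal_box Hg _ => //; apply: subset_trans QK.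
    move=> t [] /=; rewrite !in_itv /= !ge_max !le_min.
    by move=> /andP[/andP[-> _] /andP[-> _]] /andP[/andP[-> _] /andP[-> _]].
have step3 A B : measurable A -> measurable B ->
    (\int[mu]_(z in (W `&` snd @^-1` B) `&` fst @^-1` A) (EFin \o g) z = 0)%E.
  move=> mA mB; move: A mA.
  apply: (@integral_preimage_eq0 _ _ _ _ mu fst (@RGenOpens.G R)) => //.
  - exact: RGenOpens.measurableE.
  - exact: open_intervals_setI_closed.
  - exact: sndI.
  - by apply: sub; [exact: sndI|move=> z []].
  - rewrite -[RHS](step2 a b B mB); congr (integral _ _ _).
    by apply/seteqP; split => z /=; [move=> [[? ?] ?]|move=> [[[? ?] ?] ?]].
  - by move=> _ [x [y ->]]; rewrite setIAC; exact: step2.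
have step4 (E : set mpt) : measurable E -> (\int[mu]_(z in W `&` E) (EFin \o g) z = 0)%E.
  move=> mE; have := @integral_preimage_eq0 _ _ _ _ mu (id : mpt -> mpt)
    [set A `*` B | A in (@measurable _ (measurableTypeR R)) & B in (@measurable _ (measurableTypeR R))]
    W (EFin \o g) (@measurable_id _ _ _) (measurable_prod_measurableType _ _)
    rectangles_setI_closed mW gW W0.
  apply => // _ [A mA [B mB <-]].
  have -> : W `&` id @^-1` (A `*` B) = (W `&` snd @^-1` B) `&` fst @^-1` A.
    by apply/seteqP; split => z /=; [move=> [? [? ?]]|move=> [[? ?] ?]].
  exact: step3.
have H : ae_eq mu W (EFin \o g) (cst 0%E).
  apply: integral_ae_eq => // E EW mE; rewrite integral_cst // mul0e.
  by rewrite -(setIidr EW); exact: step4.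
by apply: filterS H => x Hx Wx; have [] := Hx Wx.
Qed.

(** K is the union of the countably many rational boxes whose closures it contains, and each
    contributes a null set; [unpickle] enumerates them by natural numbers. *)
Theorem fundamental_lemma_L2 (K : set pt) (g : pt -> R) :
  open K -> L2 K g ->
  (forall eta, test_function K eta -> area_int K (fun x => g x * eta x) = 0) ->
  {ae mu, forall x, K x -> g x = 0}.
Proof.
move=> oK Lg Hg.
pose P (n : nat) (x : pt) := forall q : (rat * rat) * (rat * rat), unpickle n = Some q ->
  `[ratr q.1.1, ratr q.1.2] `*` `[ratr q.2.1, ratr q.2.2] `<=` K -> rat_box q x -> g x = 0.
have H : {ae mu, forall x, forall n, P n x}.
  apply: ae_foralln => n; case E : (unpickle n : option ((rat * rat) * (rat * rat))) => [q|].
    have [qK|qK] := pselect (`[ratr q.1.1, ratr q.1.2] `*` `[ratr q.2.1, ratr q.2.2] `<=` K).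
      apply: ae_planeS (test_orthogonal_ae_box oK Lg Hg qK) => x Hx q'.
      by rewrite E => -[<-] _; exact: Hx.
    by apply: aeW => x q'; rewrite E => -[<-] /qK.
  by apply: aeW => x q'; rewrite E.
apply: ae_planeS H => x Hx Kx; have [q qx qK] := open_rat_box oK Kx.
by apply: (Hx (pickle q) q) => //; exact: pickleK.
Qed.

End FundamentalLemma.

(** * Integration by parts against test functions *)

Section IntegrationByParts.
Context {R : realType}.
Local Notation pt := (plane R).
Local Notation mpt := (measurableTypeR R * measurableTypeR R)%type.
Local Notation mu := (@plane_measure R).
Local Notation leb := (@lebesgue_measure R).

Lemma integral_derive_compact (u : R -> R) (M : R) : 0 < M ->
  (forall t, derivable u t 1) -> continuous (derive1 u) ->
  (forall t, M <= `|t| -> u t = 0) -> (forall t, M < `|t| -> derive1 u t = 0) ->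
  (\int[leb]_t (derive1 u t)%:E = 0)%E.
Proof.
move=> M0 du cu u0 u'0.
have MM : - M < M by rewrite gtrN.
have -> : (\int[leb]_t (derive1 u t)%:E = \int[leb]_(t in `[(- M)%R, M]) (derive1 u t)%:E)%E.
  rewrite [RHS]integral_mkcond; apply: eq_integral => t _; rewrite patchE.
  case: ifPn => // nt; rewrite u'0 // ltNge; apply/negP => tM; move/negP: nt; apply.
  by apply: mem_set; rewrite /= in_itv /= -ler_norml.
rewrite (@continuous_FTC2 _ (derive1 u) u).
- by rewrite !u0 ?normrN ?gtr0_norm // sube0.
- by [].
- exact: continuous_subspaceT.
- split; first by move=> t _; exact: du.
  + apply: cvg_at_right_filter.
    by apply: differentiable_continuous; apply/derivable1_diffP.
  + apply: cvg_at_left_filter.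
    by apply: differentiable_continuous; apply/derivable1_diffP.
- by [].
Qed.

Definition square (M : R) : set mpt := `[(- M)%R, M] `*` `[(- M)%R, M].

Lemma squareE M (x : pt) : square M x <-> `|x.1| <= M /\ `|x.2| <= M.
Proof. by rewrite /square /= !in_itv /= -!ler_norml. Qed.

Lemma square_measurable M : measurable (square M).
Proof. exact: box_measurable. Qed.

Lemma square_fin M : (mu (square M) < +oo)%E.
Proof. exact: box_measure_fin. Qed.

Lemma square_compact M : compact (square M : set pt).
Proof. by apply: compact_setX; exact: segment_compact. Qed.

Lemma continuous_bounded_square (f : pt -> R) M : continuous f ->
  exists B, forall x, square M x -> `|f x| <= B.
Proof.
move=> cf.
have /compact_bounded : compact (f @` (square M : set pt)).
  by apply: continuous_compact; [exact: continuous_subspaceT|exact: square_compact].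
move=> [B [_ HB]]; exists (B + 1) => x Mx; apply: (HB (B + 1)).
  by rewrite ltrDl.
by exists x.
Qed.

Lemma integrable_continuous (f : pt -> R) (D : set mpt) M : continuous f ->
  measurable D -> D `<=` square M -> mu.-integrable D (EFin \o f).
Proof.
move=> cf mD DM; have [B HB] := continuous_bounded_square M cf.
apply: (integrableS (square_measurable M)) => //.
apply: measurable_bounded_integrable; first exact: square_measurable.
- exact: square_fin.
- by apply: continuous_measurable_plane; [exact: square_measurable|].
- by exists B; split; [exact: num_real|move=> C BC x Mx; apply: le_trans (HB x Mx) (ltW BC)].
Qed.

Lemma integrable_compact_supp (f : pt -> R) (D : set mpt) M : continuous f ->
  measurable D -> (forall x, ~ square M x -> f x = 0) -> mu.-integrable D (EFin \o f).
Proof.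
move=> cf mD f0.
have fE : EFin \o f = (EFin \o f) \_ (square M).
  apply/funext => x; rewrite patchE; case: ifPn => // /negP xM.
  by rewrite /= f0 // => Mx; apply: xM; exact: mem_set.
apply: (integrableS measurableT) => //; rewrite fE.
apply: (iffLR (integrable_mkcond _ (square_measurable M))).
by apply: (@integrable_continuous f _ M) => //; exact: square_measurable.
Qed.

Lemma pd_continuous_slice b (f : pt -> R) : continuous (pd b f) ->
  forall y, continuous (fun t => pd b f (if b then (y, t) else (t, y))).
Proof.
move=> cf y t; apply: (@continuous_comp _ _ _ (fun t => if b then (y, t) else (t, y)) (pd b f)).
  case: b {f cf}.
    exact: (@cvg_pair _ _ _ (nbhs t) (nbhs y) (nbhs t) _ _ _ (fun=> y) id (cvg_cst y) cvg_id).
  exact: (@cvg_pair _ _ _ (nbhs t) (nbhs t) (nbhs y) _ _ _ id (fun=> y) cvg_id (cvg_cst y)).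
exact: cf.
Qed.

Lemma differentiable_slice b (f : pt -> R) y t :
  (forall x, differentiable f x) ->
  derivable (fun t => f (if b then (y, t) else (t, y))) t 1.
Proof.
move=> df; apply/derivable1_diffP; apply: (@differentiable_comp _ _ _ _ (fun t => if b then (y, t) else (t, y)) f).
  by case: b; apply: differentiable_pair => //; exact: ex_diff.
exact: df.
Qed.

(** Fubini's theorem with the inner integral along the direction of differentiation, where a
    compactly supported derivative integrates to zero. *)
Lemma integral_pd_compact b (F : pt -> R) (M : R) : 0 < M ->
  (forall x, differentiable F x) -> continuous (pd b F) ->
  (forall x, ~ (`|x.1| < M /\ `|x.2| < M) -> F x = 0) ->
  (forall x, ~ square M x -> pd b F x = 0) ->
  (\int[mu]_x (pd b F x)%:E = 0)%E.
Proof.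
move=> M0 dF cF F0 dF0.
have iF : mu.-integrable setT (EFin \o pd b F).
  exact: integrable_compact_supp dF0.
have key (y : R) : (\int[leb]_t (pd b F (if b then (y, t) else (t, y)))%:E = 0)%E.
  have E (t : R) : pd b F (if b then (y, t) else (t, y)) =
     derive1 (fun t => F (if b then (y, t) else (t, y))) t.
    by case: (b); [rewrite pd_true_slice|rewrite pd_false_slice].
  under eq_integral do rewrite E.
  apply: (@integral_derive_compact _ M) => //.
  - by move=> t; apply: differentiable_slice.
  - by have := @pd_continuous_slice b F cF y; under eq_fun do rewrite E.
  - by move=> t tM; rewrite F0 //; case: (b) => /= -[h1 h2]; [move: h2|move: h1]; rewrite ltNge tM.
  - move=> t tM; rewrite -E dF0 // squareE; case: (b) => /= -[h1 h2]; [move: h2|move: h1]; by rewrite leNgt tM.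
rewrite /plane_measure.
case: b {cF dF0} iF key => iF key.
  rewrite -(integral12_prod_meas1 iF) /fubini_F.
  by under eq_integral do rewrite /= key; rewrite integral0.
rewrite -(integral21_prod_meas1 iF) /fubini_G.
by under eq_integral do rewrite /= key; rewrite integral0.
Qed.

(** Two forms of one bound: vanishing on the border of the square kills the end-point values in the
    fundamental theorem of calculus, while vanishing outside the closed square gives
    integrability. *)
Lemma test_function_supp (K : set pt) (eta : pt -> R) : test_function K eta ->
  exists M : R, [/\ 0 < M, forall x, ~ (`|x.1| < M /\ `|x.2| < M) -> eta x = 0 &
    forall x, ~ square M x -> eta x = 0].
Proof.
move=> [Ce [A [cA AK e0]]].
have [B [_ HB]] := compact_bounded cA.
have H x : A x -> `|x.1| <= `|B| + 1 /\ `|x.2| <= `|B| + 1.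
  move=> Ax; have := HB (`|B| + 1) _ x Ax.
  rewrite (le_lt_trans (ler_norm B)) ?ltrDl // => /(_ isT) /=.
  by rewrite /Num.norm /= ge_max => /andP.
exists (`|B| + 2); split; first by rewrite ltr_wpDl.
- move=> x nx; apply: e0 => /H [h1 h2]; apply: nx.
  by split; [apply: le_lt_trans h1 _|apply: le_lt_trans h2 _]; rewrite ltrD2l ltr1n.
- move=> x nx; apply: e0 => /H [h1 h2]; apply: nx; apply/squareE.
  by split; [apply: le_trans h1 _|apply: le_trans h2 _]; rewrite lerD2l ler1n.
Qed.

Lemma test_function_pd b (K : set pt) (eta : pt -> R) : test_function K eta ->
  test_function K (pd b eta).
Proof.
move=> [Ce [A [cA AK e0]]]; split; first exact: Cinfty_pd.
exists A; split => // x nAx; rewrite /pd.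
have : \near x, (cst 0 : pt -> R) x = eta x.
  have : open_nbhs x (~` A).
    by split=> //; apply: closed_openC; apply: compact_closed => //; exact: norm_hausdorff.
  move/open_nbhs_nbhs; apply: filterS => y nAy.
  by rewrite e0.
by move/near_eq_derive => <-; rewrite derive_cst.
Qed.

Lemma test_function_continuous (K : set pt) (eta : pt -> R) :
  test_function K eta -> continuous eta.
Proof. by move=> [Ce _] x; apply: differentiable_continuous; exact: Cinfty_diff. Qed.

Lemma Cinfty_continuous (f : pt -> R) : Cinfty f -> continuous f.
Proof. by move=> Ce x; apply: differentiable_continuous; exact: Cinfty_diff. Qed.

Lemma area_int_supp (K : set pt) (f : pt -> R) :
  (forall x, ~ K x -> f x = 0) -> area_int K f = Rintegral mu setT f.
Proof.
move=> f0; rewrite /area_int Rintegral_mkcond; congr (Rintegral _ _ _).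
apply/funext => x; rewrite patchE; case: ifPn => // /negP xK.
by rewrite f0 // => Kx; apply: xK; exact: mem_set.
Qed.

Lemma test_function_out (K : set pt) (eta : pt -> R) x :
  test_function K eta -> ~ K x -> eta x = 0.
Proof. by move=> [_ [A [_ AK e0]]] nK; apply: e0 => /AK. Qed.

(** All integrands vanish outside K, hence may be integrated over the whole plane, where the
    derivative of the compactly supported product f eta has integral zero. *)
Lemma integration_by_parts_test b (K : set pt) (f eta : pt -> R) :
  Cinfty f -> test_function K eta ->
  area_int K (fun x => f x * pd b eta x) = - area_int K (fun x => pd b f x * eta x).
Proof.
move=> Cf te; have tpe := test_function_pd b te.
have Ce := te.1.
rewrite !area_int_supp; last 2 first.
- by move=> x nK; rewrite (test_function_out te nK) mulr0.
- by move=> x nK; rewrite (test_function_out tpe nK) mulr0.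
have [M [M0 e0 e0']] := test_function_supp te.
have [M' [_ _ pe0]] := test_function_supp tpe.
have i1 : mu.-integrable setT (EFin \o (fun x => f x * pd b eta x)).
  apply: (@integrable_compact_supp _ _ M') => //.
    by move=> x; apply: continuousM; apply: Cinfty_continuous => //; exact: Cinfty_pd.
  by move=> x nx; rewrite pe0 ?mulr0.
have i2 : mu.-integrable setT (EFin \o (fun x => pd b f x * eta x)).
  apply: (@integrable_compact_supp _ _ M) => //.
    by move=> x; apply: continuousM; apply: Cinfty_continuous => //; exact: Cinfty_pd.
  by move=> x nx; rewrite e0' ?mulr0.
apply/eqP; rewrite -addr_eq0 addrC -RintegralD //; apply/eqP.
pose N := Num.max M M'.
have dfe : pd b (fun x => f x * eta x) = fun x => pd b f x * eta x + f x * pd b eta x.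
  by rewrite pdM // => x; apply: Cinfty_diff.
have : (\int[mu]_x (pd b (fun x => f x * eta x) x)%:E = 0)%E.
  apply: (@integral_pd_compact b _ N).
  - by rewrite lt_max M0.
  - by move=> x; apply: differentiableM; apply: Cinfty_diff.
  - have c1 : continuous (fun x => pd b f x * eta x).
      by move=> x; apply: continuousM; apply: Cinfty_continuous => //; exact: Cinfty_pd.
    have c2 : continuous (fun x => f x * pd b eta x).
      by move=> x; apply: continuousM; apply: Cinfty_continuous => //; exact: Cinfty_pd.
    by rewrite dfe => x; exact: (@cvgD _ _ _ _ _ _ _ _ _ (c1 x) (c2 x)).
  - move=> x nx; rewrite e0 ?mulr0 // => -[x1 x2]; apply: nx.
    by rewrite !lt_max x1 x2.
  - move=> x /squareE nx; rewrite dfe e0' ?pe0 ?mulr0 ?addr0 //.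
      by move=> /squareE [x1 x2]; apply: nx; rewrite !le_max x1 x2 !orbT.
    by move=> /squareE [x1 x2]; apply: nx; rewrite !le_max x1 x2.
by rewrite dfe /Rintegral => ->.
Qed.

End IntegrationByParts.

(** * Weak gradients *)

Section Sobolev.
Context {R : realType}.
Local Notation pt := (plane R).
Local Notation mpt := (measurableTypeR R * measurableTypeR R)%type.
Local Notation mu := (@plane_measure R).

(** The discriminant argument, isolated because the Cauchy-Schwarz inequality is needed for several
    forms: Dirichlet, L2 in the plane, L2 on an edge, and finite sums. *)
Lemma sqrt_mul_bound (a b c : R) : (forall t, 0 <= a + 2 * t * b + t ^+ 2 * c) ->
  `|b| <= Num.sqrt a * Num.sqrt c.
Proof.
move=> H.
have a0 : 0 <= a by have := H 0; rewrite mulr0 mul0r expr0n /= mul0r !addr0.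
have bac : b ^+ 2 <= a * c.
  have [c0|c0|c0] := ltgtP c 0.
  (* Adding the inequalities for t and -t cancels b and leaves a + t^2 c >= 0, which fails since t
     >= 1 and t c < -a. *)
  - exfalso; pose t := (a + 1) / - c + 1.
    have tc : t * c = - (a + 1) + c by rewrite /t; field; rewrite lt_eqF.
    have t1 : 1 <= t by rewrite /t lerDr divr_ge0 ?oppr_ge0 ?(ltW c0) // addr_ge0.
    have := H t; have := H (- t); rewrite sqrrN expr2 -!mulrA tc.
    by nra.
  - have := H (- b / c).
    have -> : a + 2 * (- b / c) * b + (- b / c) ^+ 2 * c = (a * c - b ^+ 2) / c.
      by field; rewrite gt_eqF.
    by rewrite pmulr_lge0 ?invr_gt0 // subr_ge0.
  - rewrite c0 mulr0; have [->|b0] := eqVneq b 0; first by rewrite expr0n.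
    have := H (- (a + 1) / (2 * b)); rewrite c0 mulr0 addr0.
    have -> : a + 2 * (- (a + 1) / (2 * b)) * b = -1 by field.
    by lra.
rewrite -sqrtrM // -sqrtr_sqr; exact: ler_wsqrtr.
Qed.

Lemma L2_mul_integrable (D : set pt) (f g : pt -> R) : measurable (D : set mpt) ->
  L2 D f -> L2 D g -> mu.-integrable D (EFin \o (fun x => f x * g x)).
Proof.
move=> mD [mf f2] [mg g2].
have i1 : mu.-integrable D (EFin \o (fun x => f x ^+ 2 + g x ^+ 2)).
  exact: (@integrableD _ _ _ mu D mD (EFin \o (fun x => f x ^+ 2)) (EFin \o (fun x => g x ^+ 2))).
apply: le_integrable i1 => //.
  by apply/measurable_EFinP; apply: measurable_funM.
move=> x _ /=; rewrite lee_fin [X in _ <= X]ger0_norm; last by rewrite addr_ge0 ?sqr_ge0.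
rewrite ler_norml; apply/andP; split; nra.
Qed.

Lemma L2_lin (a : R) (D : set pt) (f g : pt -> R) : measurable (D : set mpt) ->
  L2 D f -> L2 D g -> L2 D (fun x => a * f x + g x).
Proof.
move=> mD Lf Lg; have fg := L2_mul_integrable mD Lf Lg.
move: Lf Lg => [mf f2] [mg g2]; split.
  by apply: measurable_funD => //; apply: measurable_funM.
have i1 : mu.-integrable D (EFin \o (fun x => a ^+ 2 * f x ^+ 2 + (2 * a * (f x * g x) + g x ^+ 2))).
  apply: (@integrableD _ _ _ mu D mD (EFin \o (fun x => a ^+ 2 * f x ^+ 2))
    (EFin \o (fun x => 2 * a * (f x * g x) + g x ^+ 2))).
    exact: (@integrableZl _ _ _ mu D mD (a ^+ 2) (EFin \o (fun x => f x ^+ 2))).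
  apply: (@integrableD _ _ _ mu D mD (EFin \o (fun x => 2 * a * (f x * g x)))
    (EFin \o (fun x => g x ^+ 2))) => //.
  exact: (@integrableZl _ _ _ mu D mD (2 * a) (EFin \o (fun x => f x * g x))).
by apply: eq_integrable i1 => // x _ /=; congr (_%:E); ring.
Qed.

Lemma area_int_lin (a : R) (D : set pt) (f g : pt -> R) : measurable (D : set mpt) ->
  mu.-integrable D (EFin \o f) -> mu.-integrable D (EFin \o g) ->
  area_int D (fun x => a * f x + g x) = a * area_int D f + area_int D g.
Proof.
move=> mD fi gi; rewrite /area_int (@RintegralD _ _ _ mu D (fun x => a * f x) g) //; last first.
  exact: (@integrableZl _ _ _ mu D mD a (EFin \o f)).
by rewrite (@RintegralZl _ _ _ mu D f a).
Qed.

Lemma area_int_ae (D : set pt) (f g : pt -> R) : measurable (D : set mpt) ->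
  measurable_fun (D : set mpt) (f : mpt -> measurableTypeR R) ->
  measurable_fun (D : set mpt) (g : mpt -> measurableTypeR R) ->
  {ae mu, forall x, D x -> f x = g x} -> area_int D f = area_int D g.
Proof.
move=> mD mf mg H; rewrite /area_int /Rintegral; congr fine.
apply: ae_eq_integral => //; try exact/measurable_EFinP.
by apply: ae_planeS H => x Hx Dx /=; rewrite Hx.
Qed.

Lemma L2_subset (D E : set pt) (f : pt -> R) : measurable (D : set mpt) ->
  measurable (E : set mpt) -> E `<=` D -> L2 D f -> L2 E f.
Proof.
move=> mD mE ED [mf f2]; split; first exact: measurable_funS mf.
exact: integrableS f2.
Qed.

Lemma continuous_sqr (f : pt -> R) : continuous f -> continuous (fun x => f x ^+ 2).
Proof.
move=> cf; rewrite (_ : (fun x => _) = fun x => f x * f x).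
  by move=> x; apply: continuousM; exact: cf.
by apply/funext => x; rewrite expr2.
Qed.

Lemma L2_continuous (D : set pt) (f : pt -> R) M : measurable (D : set mpt) ->
  D `<=` square M -> continuous f -> L2 D f.
Proof.
move=> mD DM cf; split; first exact: continuous_measurable_plane.
apply: (@integrable_continuous _ _ _ M) => //.
exact: continuous_sqr.
Qed.

Lemma L2_test_function (D : set pt) (eta : pt -> R) : measurable (D : set mpt) ->
  test_function D eta -> L2 D eta.
Proof.
move=> mD te; have ce := test_function_continuous te.
have [M [_ _ e0]] := test_function_supp te.
split; first exact: continuous_measurable_plane.
apply: (@integrable_compact_supp _ _ _ M) => //.
  exact: continuous_sqr.
by move=> x nx; rewrite e0 // expr0n.
Qed.

Section OpenSet.
Variable (K : set pt).
Hypothesis oK : open K.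
Let mK : measurable (K : set mpt) := open_measurable_plane oK.

Lemma is_weak_grad_lin (a : R) f f' G G' : L2 K f -> L2 K f' ->
  is_weak_grad K f G -> is_weak_grad K f' G' ->
  is_weak_grad K (fun x => a * f x + f' x) (fun b x => a * G b x + G' b x).
Proof.
move=> Lf Lf' wf wf' b; split.
  by apply: L2_lin => //; [case: (wf b)|case: (wf' b)].
move=> eta te.
have Le := L2_test_function mK te.
have Lpe := L2_test_function mK (test_function_pd b te).
have -> : (fun x => (a * f x + f' x) * pd b eta x) =
  fun x => a * (f x * pd b eta x) + f' x * pd b eta x by apply/funext => x; ring.
have -> : (fun x => (a * G b x + G' b x) * eta x) =
  fun x => a * (G b x * eta x) + G' b x * eta x by apply/funext => x; ring.
have [LG HG] := wf b; have [LG' HG'] := wf' b.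
rewrite !area_int_lin //; try exact: L2_mul_integrable.
by rewrite HG // HG' // mulrN opprD.
Qed.

Lemma weak_gradP f : H1 K f -> is_weak_grad K f (weak_grad K f).
Proof. by move=> [_ [G HG]]; apply: (@xgetPex _ _ [set G | is_weak_grad K f G]); exists G. Qed.

Lemma is_weak_grad_unique f G G' b : is_weak_grad K f G -> is_weak_grad K f G' ->
  {ae mu, forall x, K x -> G b x = G' b x}.
Proof.
move=> wG wG'; have [LG HG] := wG b; have [LG' HG'] := wG' b.
have : {ae mu, forall x, K x -> (-1) * G' b x + G b x = 0}.
  apply: fundamental_lemma_L2 => //; first exact: L2_lin.
  move=> eta te; have Le := L2_test_function mK te.
  have -> : (fun x => (-1 * G' b x + G b x) * eta x) =
    fun x => (-1) * (G' b x * eta x) + G b x * eta x by apply/funext => x; ring.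
  rewrite area_int_lin //; try exact: L2_mul_integrable.
  by rewrite -[area_int K (fun x => G b x * _)]opprK -HG // HG' //; ring.
move=> H; apply: ae_planeS H => x Hx Kx; have := Hx Kx; lra.
Qed.

(** Frees the form from the representatives chosen by [weak_grad]: it may be computed with linear
    combinations, restrictions or classical gradients. *)
Lemma dirichletE f g G H : is_weak_grad K f G -> is_weak_grad K g H ->
  dirichlet K f g = area_int K (fun x => G false x * H false x + G true x * H true x).
Proof.
move=> wG wH.
have wf : is_weak_grad K f (weak_grad K f).
  by apply: (@xgetPex _ _ [set G | is_weak_grad K f G]); exists G.
have wg : is_weak_grad K g (weak_grad K g).
  by apply: (@xgetPex _ _ [set G | is_weak_grad K g G]); exists H.
have m b F f0 : is_weak_grad K f0 F -> measurable_fun (K : set mpt) (F b : mpt -> measurableTypeR R).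
  by move=> w; have [[? _] _] := w b.
apply: area_int_ae => //.
- apply: measurable_funD; apply: measurable_funM; [exact: (m false _ _ wf)|exact: (m false _ _ wg)|exact: (m true _ _ wf)|exact: (m true _ _ wg)].
- apply: measurable_funD; apply: measurable_funM; [exact: (m false _ _ wG)|exact: (m false _ _ wH)|exact: (m true _ _ wG)|exact: (m true _ _ wH)].
have h1 : {ae mu, forall x, K x -> weak_grad K f false x * weak_grad K g false x = G false x * H false x}.
  by apply: ae_planeS2 (is_weak_grad_unique false wf wG) (is_weak_grad_unique false wg wH) => x e1 e2 Kx; rewrite e1 // e2.
have h2 : {ae mu, forall x, K x -> weak_grad K f true x * weak_grad K g true x = G true x * H true x}.
  by apply: ae_planeS2 (is_weak_grad_unique true wf wG) (is_weak_grad_unique true wg wH) => x e1 e2 Kx; rewrite e1 // e2.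
by apply: ae_planeS2 h1 h2 => x e1 e2 Kx; rewrite e1 // e2.
Qed.

Lemma H1_lin a f f' : H1 K f -> H1 K f' -> H1 K (fun x => a * f x + f' x).
Proof.
move=> Hf Hf'; have wf := weak_gradP Hf; have wf' := weak_gradP Hf'.
case: Hf Hf' => Lf _ [Lf' _]; split; first exact: L2_lin.
by eexists; exact: is_weak_grad_lin wf wf'.
Qed.

Lemma dirichletC f g : dirichlet K f g = dirichlet K g f.
Proof.
by congr (Rintegral _ _ _); apply/funext => x; congr (_ + _); rewrite mulrC.
Qed.

Lemma integrable_dirichlet f g G H : is_weak_grad K f G -> is_weak_grad K g H ->
  mu.-integrable K (EFin \o (fun x => G false x * H false x + G true x * H true x)).
Proof.
move=> wG wH.
apply: (@integrableD _ _ _ mu K mK (EFin \o (fun x => G false x * H false x))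
   (EFin \o (fun x => G true x * H true x))); apply: L2_mul_integrable => //.
- by case: (wG false).
- by case: (wH false).
- by case: (wG true).
- by case: (wH true).
Qed.

Lemma dirichlet_lin a f f' g : H1 K f -> H1 K f' -> H1 K g ->
  dirichlet K (fun x => a * f x + f' x) g = a * dirichlet K f g + dirichlet K f' g.
Proof.
move=> Hf Hf' Hg; have wf := weak_gradP Hf; have wf' := weak_gradP Hf'.
have wg := weak_gradP Hg; case: Hf Hf' => Lf _ [Lf' _].
rewrite (dirichletE (is_weak_grad_lin a Lf Lf' wf wf') wg) -area_int_lin //.
- by congr (Rintegral _ _ _); apply/funext => x; ring.
- exact: integrable_dirichlet wf wg.
- exact: integrable_dirichlet wf' wg.
Qed.

Lemma dirichlet_ge0 f : 0 <= dirichlet K f f.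
Proof. by apply: Rintegral_ge0 => x _; rewrite addr_ge0 // -expr2 sqr_ge0. Qed.

Lemma dirichlet_cauchy_schwarz f g : H1 K f -> H1 K g ->
  `|dirichlet K f g| <= Num.sqrt (dirichlet K f f) * Num.sqrt (dirichlet K g g).
Proof.
move=> Hf Hg; apply: sqrt_mul_bound => t.
pose w := fun x => t * g x + f x; have Hw : H1 K w by exact: H1_lin.
have e1 : dirichlet K w w = t * dirichlet K g w + dirichlet K f w by exact: dirichlet_lin.
have e2 : dirichlet K w g = t * dirichlet K g g + dirichlet K f g by exact: dirichlet_lin.
have e3 : dirichlet K w f = t * dirichlet K g f + dirichlet K f f by exact: dirichlet_lin.
have := dirichlet_ge0 w; rewrite e1 (dirichletC g w) (dirichletC f w) e2 e3 (dirichletC g f).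
have E (A B C : R) : t * (t * C + B) + (t * B + A) = A + 2 * t * B + t ^+ 2 * C by ring.
by rewrite E.
Qed.

Lemma is_weak_grad_Cinfty f M : K `<=` square M -> Cinfty f ->
  is_weak_grad K f (fun b => pd b f).
Proof.
move=> KM Cf b; split.
  by apply: L2_continuous KM _ => //; apply: Cinfty_continuous; exact: Cinfty_pd.
by move=> eta te; apply: integration_by_parts_test.
Qed.

Lemma H1_Cinfty f M : K `<=` square M -> Cinfty f -> H1 K f.
Proof.
move=> KM Cf; split; first by apply: L2_continuous KM _ => //; exact: Cinfty_continuous.
by eexists; exact: is_weak_grad_Cinfty KM Cf.
Qed.

End OpenSet.

Lemma test_function_subset (K K' : set pt) eta : K' `<=` K ->
  test_function K' eta -> test_function K eta.
Proof.
move=> KK [Ce [A [cA AK e0]]]; split => //; exists A; split => //.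
exact: subset_trans KK.
Qed.

(** A test function on the smaller set is one on the larger set, and both defining integrals see
    only its support. *)
Lemma is_weak_grad_subset (K K' : set pt) f G : open K -> open K' -> K' `<=` K ->
  is_weak_grad K f G -> is_weak_grad K' f G.
Proof.
move=> oK oK' KK w b; have [LG HG] := w b; split.
  by apply: L2_subset LG => //; exact: open_measurable_plane.
move=> eta te; have te' := test_function_subset KK te.
have H := HG _ te'; rewrite !area_int_supp in H *; first exact: H.
- by move=> x nK; rewrite (test_function_out te nK) mulr0.
- by move=> x nK; rewrite (test_function_out (test_function_pd b te) nK) mulr0.
- by move=> x nK; rewrite (test_function_out te' nK) mulr0.
- by move=> x nK; rewrite (test_function_out (test_function_pd b te') nK) mulr0.
Qed.

Lemma H1_subset (K K' : set pt) f : open K -> open K' -> K' `<=` K -> H1 K f -> H1 K' f.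
Proof.
move=> oK oK' KK [Lf [G HG]]; split.
  by apply: L2_subset Lf => //; exact: open_measurable_plane.
by exists G; exact: is_weak_grad_subset HG.
Qed.

End Sobolev.

(** * Inverse estimates for polynomials *)

Section DualFunctions.
Context {R : realType}.
Local Notation mu := (@plane_measure R).
Local Notation leb := (@lebesgue_measure R).

Implicit Types (u v : R -> R).

Definition int1 (u : R -> R) : R := Rintegral leb setT u.

Definition csupp (u : R -> R) := continuous u /\ exists M, forall t, M < `|t| -> u t = 0.

Lemma csupp_integrable u : csupp u -> leb.-integrable setT (EFin \o u).
Proof.
move=> [cu [M u0]].
have -> : EFin \o u = (EFin \o u) \_ `[- M, M].
  apply/funext => x; rewrite patchE; case: ifPn => // /negP xM.
  rewrite /= u0 // ltNge; apply/negP => h; apply: xM; apply: mem_set.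
  by rewrite /= in_itv /= -ler_norml.
have mI : measurable (`[- M, M]%classic : set (measurableTypeR R)) by exact: measurable_itv.
apply: (iffLR (@integrable_mkcond _ _ _ leb _ (EFin \o u) mI)).
apply: (@continuous_compact_integrable R u); first exact: segment_compact.
exact: continuous_subspaceT.
Qed.

Lemma int1_lin a u v : csupp u -> csupp v ->
  int1 (fun t => a * u t + v t) = a * int1 u + int1 v.
Proof.
move=> cu cv; have iu := csupp_integrable cu; have iv := csupp_integrable cv.
rewrite /int1 (@RintegralD _ _ _ leb setT (fun x => a * u x) v) //; last first.
  exact: (@integrableZl _ _ _ leb setT measurableT a (EFin \o u)).
by rewrite (@RintegralZl _ _ _ leb setT u a).
Qed.

Lemma csupp0 : csupp (fun=> 0).
Proof. by split; [move=> x; exact: cvg_cst|exists 0]. Qed.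

Lemma csuppM u v : continuous u -> csupp v -> csupp (fun t => u t * v t).
Proof.
move=> cu [cv [M v0]]; split; first by move=> x; apply: continuousM; [exact: cu|exact: cv].
by exists M => t /v0 ->; rewrite mulr0.
Qed.

Lemma csuppD u v : csupp u -> csupp v -> csupp (fun t => u t + v t).
Proof.
move=> [cu [M u0]] [cv [M' v0]]; split.
  by move=> x; exact: (@cvgD _ _ _ _ _ _ _ _ _ (cu x) (cv x)).
by exists (Num.max M M') => t; rewrite gt_max => /andP[/u0 -> /v0 ->]; rewrite addr0.
Qed.

Lemma csuppZ a u : csupp u -> csupp (fun t => a * u t).
Proof. by apply: csuppM => x; exact: cvg_cst. Qed.

Lemma csupp_sum (I : Type) (s : seq I) (u : I -> R -> R) : (forall i, csupp (u i)) ->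
  csupp (fun t => \sum_(i <- s) u i t).
Proof.
move=> cu; elim: s => [|i s IH].
  rewrite (_ : (fun t => _) = fun=> 0); first exact: csupp0.
  by apply/funext => t; rewrite big_nil.
rewrite (_ : (fun t => _) = fun t => u i t + \sum_(j <- s) u j t).
  exact: csuppD.
by apply/funext => t; rewrite big_cons.
Qed.

Lemma int1_sum (I : Type) (s : seq I) (c : I -> R) (u : I -> R -> R) : (forall i, csupp (u i)) ->
  int1 (fun t => \sum_(i <- s) c i * u i t) = \sum_(i <- s) c i * int1 (u i).
Proof.
move=> cu; elim: s => [|i s IH].
  rewrite big_nil (_ : (fun t => _) = fun=> 0); first by rewrite /int1 /Rintegral integral0.
  by apply/funext => t; rewrite big_nil.
rewrite (_ : (fun t => _) = fun t => c i * u i t + \sum_(j <- s) c j * u j t).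
  by rewrite int1_lin ?IH ?big_cons //; apply: csupp_sum => j; exact: csuppZ.
by apply/funext => t; rewrite big_cons.
Qed.

Lemma int1_tensor u v : csupp u -> csupp v ->
  mu.-integrable setT (EFin \o tensor u v) /\
  Rintegral mu setT (tensor u v) = int1 u * int1 v.
Proof.
move=> cu cv; have iu := csupp_integrable cu; have iv := csupp_integrable cv.
have [[ku [M u0]] [kv [M' v0]]] := (cu, cv).
have i : mu.-integrable setT (EFin \o tensor u v).
  apply: (@integrable_compact_supp _ _ _ (Num.max M M')) => //.
    move=> x; apply: continuousM.
      by apply: continuous_comp; [exact: cvg_fst|exact: ku].
    by apply: continuous_comp; [exact: cvg_snd|exact: kv].
  move=> x /squareE; rewrite !le_max => h; rewrite /tensor.
  have [h1|h1] := leP `|x.1| M; last by rewrite u0 // mul0r.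
  have [h2|h2] := leP `|x.2| M'; last by rewrite v0 // mulr0.
  by case: h; rewrite h1 h2 orbT.
split => //; rewrite /int1 /Rintegral /plane_measure.
rewrite -(integral12_prod_meas1 i) /fubini_F.
have fv : (\int[leb]_y (v y)%:E)%E \is a fin_num by exact: integrable_fin_num iv.
have fu : (\int[leb]_y (u y)%:E)%E \is a fin_num by exact: integrable_fin_num iu.
have E x : (\int[leb]_y (EFin \o tensor u v) (x, y) = (u x)%:E * \int[leb]_y (v y)%:E)%E.
  by rewrite -(integralZl _ iv).
transitivity (fine (\int[leb]_x ((u x)%:E * \int[leb]_y (v y)%:E)))%E.
  by congr fine; apply: eq_integral => x _; exact: E.
by rewrite -{1}(fineK fv) (integralZr _ iu) // fineM // fineK.
Qed.

Lemma int1_derive u : csupp u -> csupp (derive1 u) -> (forall t, derivable u t 1) ->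
  int1 (derive1 u) = 0.
Proof.
move=> [cu [M u0]] [cu' [M' u'0]] du; rewrite /int1 /Rintegral.
pose N := Num.max 1 (Num.max M M').
have N1 : 1 <= N by rewrite le_max lexx.
have NM : M <= N by rewrite !le_max lexx orbT.
have NM' : M' <= N by rewrite !le_max lexx !orbT.
have -> : (\int[leb]_t (derive1 u t)%:E = 0)%E; last by [].
apply: (@integral_derive_compact _ u (N + 1)).
- by rewrite ltr_wpDl // (le_trans _ N1).
- exact: du.
- exact: cu'.
- by move=> t h; apply: u0; apply: lt_le_trans h; rewrite (le_lt_trans NM) // ltrDl.
- by move=> t h; apply: u'0; apply: le_lt_trans h; rewrite (le_trans NM') // lerDl.
Qed.

Lemma int1_scale u (a l : R) : csupp u -> 0 < l ->
  csupp (fun t => u ((t - a) / l)) /\ int1 (fun t => u ((t - a) / l)) = l * int1 u.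
Proof.
move=> [cu [M0 u00]] l0.
pose M : R := `|M0| + 1; have M1 : 0 < M by rewrite ltr_wpDl.
have u0 t : M < `|t| -> u t = 0.
  by move=> h; apply: u00; apply: le_lt_trans h; rewrite (le_trans (ler_norm _)) // lerDl.
pose F (t : R) := (t - a) / l.
have dF (t : R) : is_derive t (1 : R) F l^-1.
  have H := @is_deriveZ _ _ _ (fun t : R => t - a) l^-1 t 1 1.
  have H2 : is_derive t (1 : R) (fun t : R => t - a) 1.
    have := is_deriveB (is_derive_id t 1) (is_derive_cst a t 1).
    by rewrite subr0.
  have := H H2; rewrite /GRing.scale /= mulr1.
  by apply: near_eq_is_derive; near=> y; rewrite /F mulrC.
have cF : continuous F.
  by move=> t; apply: differentiable_continuous; apply/derivable1_diffP; case: (dF t).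
have cuF : continuous (u \o F).
  by move=> t; apply: continuous_comp; [exact: cF|exact: cu].
have F'E : derive1 F = cst l^-1.
  by apply/funext => t; rewrite derive1E; case: (dF t).
split.
  split; first exact: cuF.
  exists (l * M + `|a|) => t h; apply: u0.
  rewrite normrM (gtr0_norm (_ : 0 < l^-1)) ?invr_gt0 // ltr_pdivlMr // mulrC.
  rewrite -ltrBrDr in h; apply: lt_le_trans h _; exact: lerB_dist.
(* [F] maps [A, B] onto [-M, M], outside of which u vanishes, so substitution is needed on a compact
   interval only. *)
pose A := a - l * M; pose B := a + l * M.
have AB : A < B by rewrite /A /B ltrD2l gtrN // mulr_gt0.
have FA : F A = - M by rewrite /F /A; field; rewrite gt_eqF.
have FB : F B = M by rewrite /F /B; field; rewrite gt_eqF.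
have E1 : int1 u = \int[leb]_(t in `[- M, M]) u t.
  rewrite /int1 [RHS]Rintegral_mkcond; congr (Rintegral _ _ _).
  apply/funext => t; rewrite patchE; case: ifPn => // /negP nt; rewrite u0 //.
  rewrite ltNge; apply/negP => h; apply: nt; apply: mem_set.
  by rewrite /= in_itv /= -ler_norml.
have E2 : int1 (u \o F) = \int[leb]_(t in `[A, B]) u (F t).
  rewrite /int1 [RHS]Rintegral_mkcond; congr (Rintegral _ _ _).
  apply/funext => t; rewrite patchE; case: ifPn => // /negP nt; rewrite /= u0 //.
  rewrite ltNge; apply/negP => h; apply: nt; apply: mem_set.
  rewrite /= in_itv /=; move: h; rewrite /F ler_norml ler_pdivrMr // ler_pdivlMr // /A /B.
  by move=> /andP[h1 h2]; apply/andP; split; lra.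
have S := @integration_by_substitution_increasing R F u A B (ltW AB).
have S' : (\int[leb]_(x in `[(- M)%R, M]) (u x)%:E = \int[leb]_(x in `[A, B]) (u (F x) * l^-1)%:E)%E.
  rewrite -FA -FB S.
  - by rewrite F'E.
  - move=> x y _ _ xy; rewrite /F ltr_pM2r ?invr_gt0 //; lra.
  - by rewrite F'E => x _; exact: cvg_cst.
  - by rewrite F'E; exact: is_cvg_cst.
  - by rewrite F'E; exact: is_cvg_cst.
  - split; first by move=> x _; case: (dF x).
      by apply: cvg_at_right_filter; exact: cF.
    by apply: cvg_at_left_filter; exact: cF.
  - exact: continuous_subspaceT.
rewrite -[LHS]/(int1 (u \o F)) E2 E1 [in RHS]/Rintegral S'.
rewrite -[fine _]/(Rintegral leb `[A, B] (fun x => u (F x) * l^-1)) RintegralZr //.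
  by rewrite mulrCA divff ?mulr1 // gt_eqF.
apply: (@continuous_compact_integrable R (u \o F)); first exact: segment_compact.
exact: continuous_subspaceT.
Unshelve. all: by end_near.
Qed.

Definition supp1 (u : R -> R) := smooth1 u /\ forall t, ~ (-1 <= t <= 1) -> u t = 0.

Lemma supp1_csupp u : supp1 u -> csupp u.
Proof.
move=> [su u0]; split.
  by move=> x; apply: differentiable_continuous; apply/derivable1_diffP; exact: smooth1_derivable.
by exists 1 => t t1; apply: u0; rewrite -ler_norml leNgt t1.
Qed.

Lemma supp1_derive u : supp1 u -> supp1 (derive1 u).
Proof.
move=> [su u0]; split; first exact: smooth1_derive.
move=> t; rewrite -ler_norml => /negP; rewrite -ltNge => t1.
rewrite derive1E.
have : \near t, (cst 0 : R -> R) t = u t.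
  have : \forall x \near t, 1 < `|x|.
    exact: (cvgr_gt _ (@norm_continuous _ _ t)).
  apply: filterS => y y1; rewrite u0 //= -ler_norml; apply/negP.
  by rewrite -ltNge.
by move/near_eq_derive => <-; rewrite derive_cst.
Qed.

Lemma supp1_lin (I : Type) (s : seq I) (c : I -> R) (u : I -> R -> R) :
  (forall i, supp1 (u i)) -> supp1 (fun t => \sum_(i <- s) c i * u i t).
Proof.
move=> su; split; last first.
  by move=> t t1; rewrite big1 // => i _; rewrite (su i).2 // mulr0.
elim: s => [|i s IH].
  rewrite (_ : (fun t => _) = fun=> 0); first exact: smooth1_cst.
  by apply/funext => t; rewrite big_nil.
rewrite (_ : (fun t => _) = fun t => c i * u i t + \sum_(j <- s) c j * u j t).
  by apply: smooth1D; [apply: smooth1Z; exact: (su i).1|exact: IH].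
by apply/funext => t; rewrite big_cons.
Qed.

Definition beta : R -> R := sbump 1 (-1) 1.

Lemma supp1_beta l : supp1 (derive1n l beta).
Proof.
elim: l => [|l IH]; last by rewrite derive1nS; exact: supp1_derive.
split; first exact: smooth1_sbump.
move=> t h; rewrite /= /beta sbump_out // => /andP[h1 h2]; apply: h.
by rewrite !ltW.
Qed.

Lemma int1_beta_gt0 : 0 < int1 beta.
Proof.
have cb := supp1_csupp (supp1_beta 0).
(* For t in [-1/2, 1/2] both t + 1 and 1 - t are at least 1/2, so monotonicity of [theta] on
   positive arguments makes this a lower bound of [beta] there. *)
pose e : R := theta (1 / 2) ^+ 2.
have e0 : 0 < e by rewrite exprn_gt0 // theta_gt0.
have mono (s t : R) : 0 < s -> s <= t -> theta s <= theta t.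
  move=> s0 st; rewrite !theta_gt0E ?(lt_le_trans s0) // ler_expR lerN2.
  by rewrite lef_pV2 // posrE // (lt_le_trans s0).
have mI : measurable (`[(-1 / 2)%R, 1 / 2]%classic : set (measurableTypeR R)) by exact: measurable_itv.
have H : Rintegral leb `[(-1 / 2)%R, 1 / 2] (fun _ : R => e) <= int1 beta.
  rewrite [X in X <= _]Rintegral_mkcond; apply: le_Rintegral => //.
  - have -> : EFin \o ((fun _ : R => e) \_ `[(-1 / 2)%R, 1 / 2]) = (EFin \o (fun _ : R => e)) \_ `[(-1 / 2)%R, 1 / 2].
      by apply/funext => t; rewrite /= !patchE; case: ifP.
    apply: (iffLR (@integrable_mkcond _ _ _ leb _ (EFin \o (fun _ : R => e)) mI)).
    apply: (@continuous_compact_integrable R (fun _ : R => e)); first exact: segment_compact.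
    by move=> x; exact: cvg_cst.
  - exact: csupp_integrable.
  - move=> t _; rewrite patchE; case: ifPn => [/set_mem|_]; last exact: sbump_ge0.
    rewrite /= in_itv /= => /andP[t1 t2].
    by rewrite /e expr2 ler_pM ?theta_ge0 //; apply: mono; rewrite ?divr_gt0 // mul1r; lra.
apply: lt_le_trans H; rewrite Rintegral_cst //= lebesgue_measure_itv /=.
rewrite lte_fin; case: ifPn => h; first by rewrite /= mulr_gt0 //; lra.
by move/negP: h; case; lra.
Qed.

Definition moment (k : nat) (u : R -> R) : R := int1 (fun t : R => t ^+ k * u t).

Lemma moment_derive k u : supp1 u ->
  moment k (derive1 u) = - (k%:R * moment k.-1 u).
Proof.
move=> su; have su' := supp1_derive su.
have ck j : continuous (fun t : R => t ^+ j) by exact: exprn_continuous.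
have cs j v : supp1 v -> csupp (fun t => t ^+ j * v t).
  by move=> sv; apply: csuppM => //; exact: supp1_csupp.
have dE : derive1 (fun t : R => t ^+ k * u t) =
    fun t : R => k%:R * (t ^+ k.-1 * u t) + t ^+ k * derive1 u t.
  apply/funext => t; rewrite !derive1E (@deriveM _ _ (fun t : R => t ^+ k) u).
  - by rewrite exp_derive /GRing.scale /= mulr1 -[X in _ + X = _]mulrC; ring.
  - exact: exprn_derivable.
  - exact: smooth1_derivable su.1.
have : int1 (derive1 (fun t : R => t ^+ k * u t)) = 0.
  apply: int1_derive.
  - exact: cs.
  - by rewrite dE; apply: csuppD; [apply: csuppZ; exact: cs|exact: cs].
  - by move=> t; apply: derivableM; [exact: exprn_derivable|exact: smooth1_derivable su.1].
rewrite dE int1_lin; [|exact: cs|exact: cs].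
by rewrite /moment => /eqP; rewrite addrC addr_eq0 => /eqP.
Qed.

(** Each integration by parts takes one derivative off [beta] and one power off the monomial; with
    more derivatives than powers the exponent 0 appears as a factor. *)
Lemma moment_beta_lt k l : (k < l)%N -> moment k (derive1n l beta) = 0.
Proof.
elim: l k => [//|l IH] [|k] kl; rewrite derive1nS moment_derive; try exact: supp1_beta.
  by rewrite mul0r oppr0.
by rewrite /= IH // mulr0 oppr0.
Qed.

Lemma moment_beta_diag l : moment l (derive1n l beta) != 0.
Proof.
elim: l => [|l IH].
  rewrite /moment (_ : (fun t => _) = beta) ?gt_eqF ?int1_beta_gt0 //.
  by apply/funext => t; rewrite expr0 mul1r.
rewrite derive1nS moment_derive; last exact: supp1_beta.
by rewrite oppr_eq0 mulf_neq0 // pnatr_eq0.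
Qed.

(** The matrix of moments of the derivatives of [beta] is triangular with nonzero diagonal, hence
    invertible; the columns of its inverse combine those derivatives into functions dual to the
    monomials. *)
Lemma dual_functions (N : nat) : exists eta : 'I_N -> R -> R,
  (forall i, supp1 (eta i)) /\
  forall i k : 'I_N, moment k (eta i) = (k == i)%:R.
Proof.
pose A : 'M[R]_N := \matrix_(k, l) moment k (derive1n l beta).
have uA : A \in unitmx.
  rewrite unitmxE det_trig; last first.
    by apply/is_trig_mxP => i j ij; rewrite mxE moment_beta_lt.
  rewrite unitfE; apply/prodf_neq0 => i _; rewrite mxE; exact: moment_beta_diag.
exists (fun i t => \sum_(l < N) invmx A l i * derive1n l beta t); split=> [i|i k].
  by apply: supp1_lin => l; exact: supp1_beta.
have -> : moment k (fun t => \sum_(l < N) invmx A l i * derive1n l beta t) =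
    \sum_(l < N) invmx A l i * moment k (derive1n l beta).
  rewrite -int1_sum; last first.
    move=> l; apply: csuppM; first exact: exprn_continuous.
    exact: supp1_csupp (supp1_beta l).
  congr int1; apply/funext => t; rewrite mulr_sumr; apply: eq_bigr => l _; ring.
have := congr1 (fun B : 'M[R]_N => B k i) (mulmxV uA).
rewrite !mxE => <-; apply: eq_bigr => l _; rewrite mxE mulrC //.
Qed.

End DualFunctions.

(** * Polynomials in scaled monomials *)

Section BoxPolynomials.
Context {R : realType}.
Local Notation pt := (plane R).
Local Notation mu := (@plane_measure R).
Implicit Types (a x n : pt) (l : R) (c : nat -> nat -> R).

(** Centred at a and scaled by l, these are bounded by 1 on [a - l, a + l], so that bounds on
    coefficients and on values differ by factors free of l. *)
Definition mono (a l : R) (i : nat) : R -> R := fun t => ((t - a) / l) ^+ i.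

Lemma monoE (a l : R) i : mono a l i = fun t => horner 'X^i (l^-1 * t + (- (a / l))).
Proof.
by apply/funext => t; rewrite /mono hornerXn mulrDl mulNr mulrC.
Qed.

Lemma smooth1_mono (a l : R) i : smooth1 (mono a l i).
Proof.
rewrite monoE.
exact: (@smooth1_affine R l^-1 (- (a / l)) (horner 'X^i) (@smooth1_horner R 'X^i)).
Qed.

Lemma derive1_mono (a l : R) i : derive1 (mono a l i) = fun t => i%:R / l * mono a l i.-1 t.
Proof.
apply/funext => t; rewrite monoE.
have H := @is_derive1_comp R (horner 'X^i) (fun t => l^-1 * t + - (a / l)) t _ _
  (is_derive_poly 'X^i _).
have dF : is_derive t (1 : R) (fun t : R => l^-1 * t + - (a / l)) l^-1.
  have := is_deriveD (@is_deriveZ _ _ _ (id : R -> R) l^-1 t 1 1 (is_derive_id t 1)) (is_derive_cst (- (a / l)) t 1).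
  by rewrite addr0 /GRing.scale /= mulr1.
have [_] := H _ dF; rewrite derive1E => ->.
by rewrite derivXn hornerMn hornerXn -mulr_natl /mono mulrDl mulNr [t / l]mulrC; ring.
Qed.

Definition bpoly (N : nat) a l c : pt -> R :=
  fun x => \sum_(i < N) \sum_(j < N) c i j * tensor (mono a.1 l i) (mono a.2 l j) x.

Lemma bpoly_lin N a l c c' (r : R) :
  (fun x => r * bpoly N a l c x + bpoly N a l c' x) =
  bpoly N a l (fun i j => r * c i j + c' i j).
Proof.
apply/funext => x; rewrite /bpoly mulr_sumr -big_split /=; apply: eq_bigr => i _.
by rewrite mulr_sumr -big_split /=; apply: eq_bigr => j _; ring.
Qed.

Lemma Cinfty_bpoly N a l c : Cinfty (bpoly N a l c).
Proof.
apply: Cinfty_sum => i _; apply: Cinfty_sum => j _; apply: CinftyZ.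
by apply: Cinfty_tensor; exact: smooth1_mono.
Qed.

Lemma pd_sum (I : Type) (s : seq I) (F : I -> pt -> R) b : (forall i, Cinfty (F i)) ->
  pd b (fun x => \sum_(i <- s) F i x) = fun x => \sum_(i <- s) pd b (F i) x.
Proof.
move=> CF; elim: s => [|i s IH].
  rewrite (_ : (fun x => \sum_(i <- [::]) F i x) = cst 0).
    by apply/funext => x; rewrite /pd derive_cst big_nil.
  by apply/funext => x; rewrite big_nil.
rewrite (_ : (fun x => \sum_(j <- i :: s) F j x) = fun x => F i x + \sum_(j <- s) F j x).
  rewrite pdD.
  - by apply/funext => x; rewrite IH big_cons.
  - by move=> x; apply: Cinfty_diff; exact: CF.
  - by move=> x; apply: Cinfty_diff; apply: Cinfty_sum => j _; exact: CF.
by apply/funext => x; rewrite big_cons.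
Qed.

(** The guard cuts off the index N: the last coefficient of a derivative has no successor in the
    truncated sum, while c itself is arbitrary beyond N. *)
Definition dcoef (N : nat) (b : bool) l c : nat -> nat -> R := fun i j =>
  if b then (if (j.+1 < N)%N then j.+1%:R / l * c i j.+1 else 0)
  else (if (i.+1 < N)%N then i.+1%:R / l * c i.+1 j else 0).

Lemma pd_bpoly N a l c b : pd b (bpoly N a l c) = bpoly N a l (dcoef N b l c).
Proof.
have CM i j : Cinfty (fun x => c i j * tensor (mono a.1 l i) (mono a.2 l j) x).
  by apply: CinftyZ; apply: Cinfty_tensor; exact: smooth1_mono.
rewrite /bpoly (@pd_sum _ (index_enum 'I_N) (fun (i : 'I_N) x =>
  \sum_(j < N) c i j * tensor (mono a.1 l i) (mono a.2 l j) x)); last first.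
  by move=> i; apply: Cinfty_sum => j _; exact: CM.
apply/funext => x.
have E (i : 'I_N) : pd b (fun x => \sum_(j < N) c i j * tensor (mono a.1 l i) (mono a.2 l j) x) x =
    \sum_(j < N) c i j * (if b then mono a.1 l i x.1 * (j%:R / l * mono a.2 l j.-1 x.2)
       else (i%:R / l * mono a.1 l i.-1 x.1) * mono a.2 l j x.2).
  rewrite pd_sum //; apply: eq_bigr => j _; rewrite pdZ; last first.
    by move=> y; apply: Cinfty_diff; apply: Cinfty_tensor; exact: smooth1_mono.
  rewrite pd_tensor; [|exact: smooth1_mono|exact: smooth1_mono].
  by case: b; rewrite /tensor derive1_mono.
rewrite (eq_bigr _ (fun i _ => E i)); case: b {E} => /=.
  apply: eq_bigr => i _; case: N CM i => [|n] CM i; first by rewrite !big_ord0.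
  rewrite big_ord_recl big_ord_recr /= mul0r !mul0r !mulr0 add0r ltnn mul0r addr0.
  apply: eq_bigr => j _; rewrite (_ : bump 0 j = j.+1) // add0n /tensor /= ltnS ltn_ord; ring.
case: N CM => [|n] CM; first by rewrite !big_ord0.
rewrite big_ord_recl [in RHS]big_ord_recr /= big1 ?add0r; last by move=> j _; rewrite !mul0r mulr0.
rewrite [X in _ = _ + X]big1 ?addr0; last by move=> j _; rewrite ltnn mul0r.
apply: eq_bigr => i _; apply: eq_bigr => j _; rewrite (_ : bump 0 i = i.+1) // add0n /tensor /= ltnS ltn_ord; ring.
Qed.

Lemma dcoef_bound N b l c (M : R) : 0 < l -> 0 <= M ->
  (forall i j : 'I_N, `|c i j| <= M) ->
  forall i j : 'I_N, `|dcoef N b l c i j| <= N%:R / l * M.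
Proof.
move=> l0 M0 H i j; have NlM : 0 <= N%:R / l * M by rewrite mulr_ge0 // divr_ge0 // ltW.
rewrite /dcoef; case: b; case: ifPn => h; rewrite ?normr0 // normrM.
- rewrite ler_pM //; last exact: (H i (Ordinal h)).
  rewrite ger0_norm ?divr_ge0 ?(ltW l0) //.
  by rewrite ler_pM2r ?invr_gt0 // ler_nat ltnW.
- rewrite ler_pM //; last exact: (H (Ordinal h) j).
  rewrite ger0_norm ?divr_ge0 ?(ltW l0) //.
  by rewrite ler_pM2r ?invr_gt0 // ler_nat ltnW.
Qed.

Lemma bpoly_bound N a l c (M Lam : R) x : 0 < l -> 0 <= M -> 1 <= Lam ->
  (forall i j : 'I_N, `|c i j| <= M) ->
  `|x.1 - a.1| <= Lam * l -> `|x.2 - a.2| <= Lam * l ->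
  `|bpoly N a l c x| <= N%:R ^+ 2 * Lam ^+ (2 * N) * M.
Proof.
move=> l0 M0 L1 H x1 x2.
have mb (y b : R) (i : 'I_N) : `|y - b| <= Lam * l -> `|mono b l i y| <= Lam ^+ N.
  move=> h; rewrite /mono normrX; apply: (@le_trans _ _ (Lam ^+ i)).
    have L0 : 0 <= Lam by rewrite (le_trans _ L1).
    apply: lerXn2r; rewrite ?nnegrE //.
    by rewrite normrM (gtr0_norm (_ : 0 < l^-1)) ?invr_gt0 // ler_pdivrMr.
  by rewrite ler_weXn2l // ltnW.
have T (i j : 'I_N) : `|c i j * tensor (mono a.1 l i) (mono a.2 l j) x| <= Lam ^+ (2 * N) * M.
  rewrite normrM mulrC ler_pM // /tensor normrM mul2n -addnn exprD ler_pM //; exact: mb.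
apply: le_trans (ler_norm_sum _ _ _) _.
apply: (@le_trans _ _ (\sum_(i < N) \sum_(j < N) Lam ^+ (2 * N) * M)).
  apply: ler_sum => i _; apply: le_trans (ler_norm_sum _ _ _) _.
  by apply: ler_sum => j _; exact: T.
rewrite !sumr_const !card_ord -[X in X <= _]mulr_natl -[X in _ * X]mulr_natl.
by rewrite le_eqVlt; apply/orP; left; apply/eqP; ring.
Qed.

Lemma pow_mono (b l : R) (N i : nat) : 0 < l -> (i < N)%N ->
  exists w : nat -> R, forall t, t ^+ i = \sum_(k < N) w k * mono b l k t.
Proof.
move=> l0 iN; exists (fun k => b ^+ (i - k) * l ^+ k *+ 'C(i, k)) => t.
have {1}-> : t = b + l * ((t - b) / l) by field; rewrite gt_eqF.
rewrite exprDn (big_ord_widen _ (fun k => b ^+ (i - k) * (l * ((t - b) / l)) ^+ k *+ 'C(i, k)) iN).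
rewrite big_mkcond; apply: eq_bigr => k _; case: ifPn => h.
  by rewrite exprMn mulrnAl mulrA.
by rewrite bin_small ?mulr0n ?mul0r // ltnNge.
Qed.

Lemma Pol_bpoly (d : int) (f : pt -> R) a l : 0 < l -> Pol d f ->
  exists c, f = bpoly `|d|.+1 a l c.
Proof.
move=> l0 [c fE]; set N := `|d|.+1 in fE *.
have add (g g' : pt -> R) : (exists c, g = bpoly N a l c) -> (exists c, g' = bpoly N a l c) ->
    exists c, (fun x => g x + g' x) = bpoly N a l c.
  move=> [c1 ->] [c2 ->]; exists (fun i j => 1 * c1 i j + c2 i j); rewrite -bpoly_lin.
  by apply/funext => x; rewrite mul1r.
have zero : exists c, (fun=> 0) = bpoly N a l c.
  exists (fun _ _ => 0); apply/funext => x; rewrite /bpoly big1 // => i _; rewrite big1 // => j _.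
  by rewrite mul0r.
have sum (I : Type) (s : seq I) (P : pred I) (F : I -> pt -> R) :
    (forall i, exists c, F i = bpoly N a l c) ->
    exists c, (fun x => \sum_(i <- s | P i) F i x) = bpoly N a l c.
  move=> HF; elim: s => [|i s IH].
    rewrite (_ : (fun x => _) = fun=> 0) //.
    by apply/funext => x; rewrite big_nil.
  case Pi : (P i).
    rewrite (_ : (fun x => _) = fun x => F i x + \sum_(j <- s | P j) F j x).
      exact: add.
    by apply/funext => x; rewrite big_cons Pi.
  rewrite (_ : (fun x => _) = fun x => \sum_(j <- s | P j) F j x) //.
  by apply/funext => x; rewrite big_cons Pi.
have -> : f = fun x => \sum_(i < N) \sum_(j < N | ((i + j)%N%:Z <= d)%R)
   c i j * x.1 ^+ i * x.2 ^+ j by apply/funext.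
apply: (sum _ (index_enum 'I_N) xpredT (fun (i : 'I_N) x =>
  \sum_(j < N | ((i + j)%N%:Z <= d)%R) c i j * x.1 ^+ i * x.2 ^+ j)) => i.
apply: (sum _ (index_enum 'I_N) (fun j : 'I_N => ((i + j)%N%:Z <= d)%R)
  (fun (j : 'I_N) x => c i j * x.1 ^+ i * x.2 ^+ j)) => j.
have [w1 H1] := @pow_mono a.1 l N i l0 (ltn_ord i).
have [w2 H2] := @pow_mono a.2 l N j l0 (ltn_ord j).
exists (fun k k' => c i j * (w1 k * w2 k')); apply/funext => x.
rewrite H1 H2 -mulrA big_distrlr /= mulr_sumr /bpoly; apply: eq_bigr => k _.
rewrite mulr_sumr; apply: eq_bigr => k' _; rewrite /tensor; ring.
Qed.

Lemma area_sum (I : Type) (s : seq I) (d : I -> R) (F : I -> pt -> R) :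
  (forall i, mu.-integrable setT (EFin \o F i)) ->
  mu.-integrable setT (EFin \o (fun x => \sum_(i <- s) d i * F i x)) /\
  Rintegral mu setT (fun x => \sum_(i <- s) d i * F i x) = \sum_(i <- s) d i * Rintegral mu setT (F i).
Proof.
move=> iF; elim: s => [|i s [IH1 IH2]].
  rewrite big_nil (_ : (fun x => _) = fun=> 0); last by apply/funext => x; rewrite big_nil.
  split; first exact: integrable0.
  by rewrite /Rintegral integral0.
rewrite (_ : (fun x => _) = fun x => d i * F i x + \sum_(j <- s) d j * F j x); last first.
  by apply/funext => x; rewrite big_cons.
split.
  apply: (@integrableD _ _ _ mu setT measurableT (EFin \o (fun x => d i * F i x))
    (EFin \o (fun x => \sum_(j <- s) d j * F j x))) => //.
  exact: (@integrableZl _ _ _ mu setT measurableT (d i) (EFin \o F i)).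
have := @area_int_lin R (d i) setT (F i) (fun x => \sum_(j <- s) d j * F j x) measurableT (iF i) IH1.
by rewrite /area_int => ->; rewrite IH2 big_cons.
Qed.

End BoxPolynomials.

(** * From the Dirichlet energy to pointwise bounds on derivatives *)

Section InverseEstimates.
Context {R : realType}.
Local Notation pt := (plane R).
Local Notation mpt := (measurableTypeR R * measurableTypeR R)%type.
Local Notation mu := (@plane_measure R).
Implicit Types (K : set pt) (a x n : pt) (l : R) (c : nat -> nat -> R).

Lemma L2_cauchy_schwarz (D : set pt) (f g : pt -> R) : measurable (D : set mpt) ->
  L2 D f -> L2 D g ->
  `|area_int D (fun x => f x * g x)| <=
    Num.sqrt (area_int D (fun x => f x ^+ 2)) * Num.sqrt (area_int D (fun x => g x ^+ 2)).
Proof.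
move=> mD Lf Lg; apply: sqrt_mul_bound => t.
have fg := L2_mul_integrable mD Lf Lg; have [_ f2] := Lf; have [_ g2] := Lg.
have i1 : mu.-integrable D (EFin \o (fun x => 2 * t * (f x * g x) + f x ^+ 2)).
  apply: (@integrableD _ _ _ mu D mD (EFin \o (fun x => 2 * t * (f x * g x)))
    (EFin \o (fun x => f x ^+ 2))) => //.
  exact: (@integrableZl _ _ _ mu D mD (2 * t) (EFin \o (fun x => f x * g x))).
have E1 := area_int_lin (t ^+ 2) mD g2 i1.
have E2 := area_int_lin (2 * t) mD fg f2.
have : 0 <= area_int D (fun x => t ^+ 2 * g x ^+ 2 + (2 * t * (f x * g x) + f x ^+ 2)).
  apply: Rintegral_ge0 => x _; have -> : t ^+ 2 * g x ^+ 2 + (2 * t * (f x * g x) + f x ^+ 2) =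
    (t * g x + f x) ^+ 2 by ring.
  exact: sqr_ge0.
rewrite E1 E2.
have E (A B C : R) : t ^+ 2 * A + (2 * t * B + C) = C + 2 * t * B + t ^+ 2 * A by ring.
by rewrite E.
Qed.

(* Testing the weak gradient against a bump that is dual to a monomial recovers
   the corresponding coefficient of the derivative of the polynomial. *)
Lemma coef_bound (N : nat) : exists2 C : R, 0 <= C &
  forall K a l f G b c, open K -> 0 < l ->
    (forall x, `|x.1 - a.1| <= l -> `|x.2 - a.2| <= l -> K x) ->
    Cinfty f -> is_weak_grad K f G -> pd b f = bpoly N a l c ->
    forall i j : 'I_N, `|c i j| <= C / l * Num.sqrt (area_int K (fun x => G b x ^+ 2)).
Proof.
have [eta [seta deta]] := @dual_functions R N.
pose e (i : 'I_N) : R := int1 (fun t => eta i t * eta i t).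
(* The test function dual to the monomial (i, j) has L2 norm l sqrt(e_i e_j) and its pairing is l^2
   c_ij, which leaves one factor 1/l; the sum over all indices dominates each of these norms. *)
exists (\sum_i \sum_j Num.sqrt (e i * e j)).
  by apply: sumr_ge0 => i _; apply: sumr_ge0 => j _; exact: sqrtr_ge0.
move=> K a l f G b c oK l0 sqK Cf wG dfE i j.
have mK := open_measurable_plane oK.
pose u t := eta i ((t - a.1) / l); pose v t := eta j ((t - a.2) / l).
have sm (w : R -> R) (y : R) : smooth1 w -> smooth1 (fun t => w ((t - y) / l)).
  move=> sw; rewrite (_ : (fun t => _) = fun t => w (l^-1 * t + - (y / l))).
    exact: smooth1_affine.
  by apply/funext => t; rewrite mulrDl mulNr [t / l]mulrC.
have out (w : R -> R) (y t : R) : supp1 w -> ~ (y - l <= t <= y + l) -> w ((t - y) / l) = 0.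
  move=> [_ w0] h; apply: w0 => /andP[h1 h2]; apply: h.
  by rewrite ler_pdivlMr // in h1; rewrite ler_pdivrMr // in h2; apply/andP; split; lra.
have te : test_function K (tensor u v).
  apply: (@test_function_tensor _ K (a.1 - l) (a.1 + l) (a.2 - l) (a.2 + l)).
  - by apply: sm; exact: (seta i).1.
  - by apply: sm; exact: (seta j).1.
  - by move=> t; apply: out; exact: seta.
  - by move=> t; apply: out; exact: seta.
  - move=> x [/=]; rewrite !in_itv /= => x1 x2; apply: sqK; rewrite ler_distlC; lra.
have [LG HG] := wG b.
(* Both sides are minus the integral of f against the derivative of the test function, one by
   definition of the weak gradient and one classically; an arbitrary G is thus replaced by the
   derivative of f. *)
have I1 : area_int K (fun x => G b x * tensor u v x) = area_int K (fun x => pd b f x * tensor u v x).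
  by apply: oppr_inj; rewrite -HG // (integration_by_parts_test b Cf te).
have cmon (k : nat) (q : 'I_N) : csupp (fun t => t ^+ k * eta q t).
  by apply: csuppM; [exact: exprn_continuous|apply: supp1_csupp; exact: seta].
have I2 : area_int K (fun x => pd b f x * tensor u v x) = l ^+ 2 * c i j.
  rewrite area_int_supp; last by move=> x nK; rewrite (test_function_out te nK) mulr0.
  pose Fpq (p : 'I_N * 'I_N) := tensor (fun t => ((t - a.1) / l) ^+ p.1 * eta i ((t - a.1) / l))
     (fun t => ((t - a.2) / l) ^+ p.2 * eta j ((t - a.2) / l)).
  have tF p : mu.-integrable setT (EFin \o Fpq p) /\
      Rintegral mu setT (Fpq p) = l ^+ 2 * ((p.1 == i)%:R * (p.2 == j)%:R).
    have [c1 e1] := int1_scale a.1 (cmon p.1 i) l0.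
    have [c2 e2] := int1_scale a.2 (cmon p.2 j) l0.
    have [iT eT] := int1_tensor c1 c2; split; first exact: iT.
    by rewrite eT e1 e2 -/(moment p.1 (eta i)) -/(moment p.2 (eta j)) !deta; ring.
  have [_ H] := area_sum (index_enum ('I_N * 'I_N)%type) (fun p => c p.1 p.2) (fun p => (tF p).1).
  transitivity (Rintegral mu setT (fun x => \sum_(p : 'I_N * 'I_N) c p.1 p.2 * Fpq p x)).
    congr (Rintegral _ _ _); apply/funext => x; rewrite dfE /bpoly pair_bigA mulr_suml /=.
    by apply: eq_bigr => p _; rewrite /Fpq /tensor /mono /u /v; ring.
  rewrite H (bigD1 (i, j)) //= big1 ?addr0.
    by rewrite (tF _).2 !eqxx /=; ring.
  move=> p pij; rewrite (tF _).2.
  have [p1|p1] := eqVneq p.1 i; have [p2|p2] := eqVneq p.2 j; rewrite ?mul0r ?mulr0 //.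
  by move: pij; rewrite -p1 -p2 -surjective_pairing eqxx.
have ce (q : 'I_N) : csupp (fun t => eta q t * eta q t).
  apply: csuppM; last by apply: supp1_csupp; exact: seta.
  by have [] := supp1_csupp (seta q).
have I3 : area_int K (fun x => tensor u v x ^+ 2) = l ^+ 2 * (e i * e j).
  rewrite area_int_supp; last by move=> x nK; rewrite (test_function_out te nK) expr0n.
  have [c1 e1] := int1_scale a.1 (ce i) l0.
  have [c2 e2] := int1_scale a.2 (ce j) l0.
  have [_ eT] := int1_tensor c1 c2.
  transitivity (Rintegral mu setT (tensor (fun t => eta i ((t - a.1) / l) * eta i ((t - a.1) / l))
    (fun t => eta j ((t - a.2) / l) * eta j ((t - a.2) / l)))).
    by congr (Rintegral _ _ _); apply/funext => x; rewrite /tensor /u /v; ring.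
  by rewrite eT e1 e2 /e; ring.
have := L2_cauchy_schwarz mK LG (L2_test_function mK te).
rewrite I1 I2 I3 sqrtrM ?sqr_ge0 // sqrtr_sqr (gtr0_norm l0) normrM (gtr0_norm (_ : 0 < l ^+ 2)) ?exprn_gt0 //.
set g := Num.sqrt _; set s := Num.sqrt _ => H.
have g0 : 0 <= g by exact: sqrtr_ge0.
have H2 : `|c i j| <= s / l * g.
  rewrite mulrAC ler_pdivlMr //; rewrite -(ler_pM2l l0).
  have -> : l * (`|c i j| * l) = l ^+ 2 * `|c i j| by ring.
  by apply: le_trans H _; rewrite le_eqVlt; apply/orP; left; apply/eqP; ring.
apply: le_trans H2 _; rewrite ler_wpM2r // ler_pM2r ?invr_gt0 //.
rewrite (bigD1 i) //= (bigD1 j) //= -addrA lerDl addr_ge0 //.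
  by apply: sumr_ge0 => j' _; exact: sqrtr_ge0.
by apply: sumr_ge0 => i' _; apply: sumr_ge0 => j' _; exact: sqrtr_ge0.
Qed.

Lemma derive_pd (f : pt -> R) x n : differentiable f x ->
  'D_n f x = n.1 * pd false f x + n.2 * pd true f x.
Proof.
move=> df; rewrite /pd !deriveE //.
have -> : n = n.1 *: (basis_vec false : pt) + n.2 *: (basis_vec true : pt).
  case: n => n1 n2; rewrite /basis_vec; apply: (@pair_equal_spec _ _ _ _ _ _).2.
  by rewrite /= /GRing.scale /= !mulr1 !mulr0 addr0 add0r.
by rewrite linearD !linearZ /= /basis_vec /= /GRing.scale /= !mulr1 !mulr0 addr0 add0r.
Qed.

(** On coefficients a partial derivative costs at most N / l, hence a directional derivative with
    components at most 1 costs 2 N / l. *)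
Lemma dnormal_bpoly N a l c n (M : R) j : 0 < l -> 0 <= M ->
  `|n.1| <= 1 -> `|n.2| <= 1 -> (forall i j : 'I_N, `|c i j| <= M) ->
  exists2 c', dnormal n j (bpoly N a l c) = bpoly N a l c' &
    forall i i' : 'I_N, `|c' i i'| <= (2 * N%:R / l) ^+ j * M.
Proof.
move=> l0 M0 n1 n2 H; elim: j => [|j [c' E Hc']].
  by exists c => // i i'; rewrite expr0 mul1r.
(* The trailing zero brings the combination into the form required by two uses of [bpoly_lin]. *)
exists (fun i i' => n.1 * dcoef N false l c' i i' + (n.2 * dcoef N true l c' i i' + 0)).
  rewrite /dnormal /= -/(dnormal n j _) E; apply/funext => x.
  rewrite derive_pd; last by apply: Cinfty_diff; exact: Cinfty_bpoly.
  rewrite !pd_bpoly -bpoly_lin -bpoly_lin; congr (_ + _).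
  rewrite [X in _ = _ + X](_ : _ = 0) ?addr0 //.
  by rewrite /bpoly big1 // => i _; rewrite big1 // => i' _; rewrite mul0r.
move=> i i'; have M'0 : 0 <= (2 * N%:R / l) ^+ j * M.
  by rewrite mulr_ge0 // exprn_ge0 // divr_ge0 ?mulr_ge0 // ltW.
have d1 := dcoef_bound false l0 M'0 Hc' i i'; have d2 := dcoef_bound true l0 M'0 Hc' i i'.
rewrite addr0; apply: le_trans (ler_normD _ _) _; rewrite !normrM exprS.
set A := N%:R / l * _ in d1 d2; have -> : 2 * N%:R / l * (2 * N%:R / l) ^+ j * M = A + A by rewrite /A; ring.
by apply: lerD; [apply: le_trans d1|apply: le_trans d2]; rewrite ler_piMl.
Qed.

Lemma weak_grad_le_dirichlet K f G b : open K -> is_weak_grad K f G ->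
  area_int K (fun x => G b x ^+ 2) <= dirichlet K f f.
Proof.
move=> oK wG; have mK := open_measurable_plane oK.
rewrite (dirichletE oK wG wG); apply: le_Rintegral => //.
- by case: (wG b) => [[]].
- exact: (integrable_dirichlet oK wG wG).
- by move=> x _; rewrite -!expr2; case: b; rewrite ?lerDl ?lerDr sqr_ge0.
Qed.

(** The energy controls only the gradient, so the first derivative is estimated by [coef_bound]; the
    other j - 1 act on coefficients at the cost 2 N / l each. Evaluation up to Lam l from the centre
    costs a power of Lam. *)
Lemma dnormal_bound (m : nat) (Lam : R) : 1 <= Lam -> exists2 C : R, 0 < C &
  forall K M a l p n j x, open K -> K `<=` square M -> 0 < l ->
    (forall x, `|x.1 - a.1| <= l -> `|x.2 - a.2| <= l -> K x) ->
    Pol m%:Z p -> `|n.1| <= 1 -> `|n.2| <= 1 -> (0 < j <= m)%N ->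
    `|x.1 - a.1| <= Lam * l -> `|x.2 - a.2| <= Lam * l ->
    `|dnormal n j p x| <= C / l ^+ j * Num.sqrt (dirichlet K p p).
Proof.
move=> L1; have [C0 C00 HC] := coef_bound m.+1.
set N := m.+1 in HC *.
(* The factors come from the first derivative, from evaluation on the larger square, and from the
   remaining derivatives; the summand 1 makes the constant positive even if [C0] is 0. *)
pose C1 : R := (2 * C0 + 1) * (N%:R ^+ 2 * Lam ^+ (2 * N)) * (2 * N%:R) ^+ m.
have N1 : 1 <= 2 * N%:R :> R by rewrite -natrM ler1n.
have C1p : 0 < C1.
  have L0 : 0 < Lam by rewrite (lt_le_trans ltr01).
  have C01 : 0 < 2 * C0 + 1 by rewrite ltr_wpDl // mulr_ge0.
  have N0 : 0 < N%:R :> R by rewrite ltr0n.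
  have N2 : 0 < 2 * N%:R :> R by rewrite mulr_gt0.
  by apply: mulr_gt0; [apply: mulr_gt0 => //; apply: mulr_gt0|]; exact: exprn_gt0.
exists C1 => // K M a l p n j x oK KM l0 sqK Pp n1 n2 jm x1 x2.
have [c pE] := Pol_bpoly a l0 Pp; rewrite absz_nat -/N in pE.
have Cp : Cinfty p by rewrite pE; exact: Cinfty_bpoly.
have wG := is_weak_grad_Cinfty oK KM Cp.
have co b (i i' : 'I_N) : `|dcoef N b l c i i'| <= C0 / l * Num.sqrt (dirichlet K p p).
  apply: le_trans (HC K a l p _ b _ oK l0 sqK Cp wG _ i i') _; first by rewrite pE pd_bpoly.
  rewrite ler_wpM2l ?divr_ge0 ?(ltW l0) //; apply: ler_wsqrtr.
  exact: weak_grad_le_dirichlet wG.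
set D := Num.sqrt _ in co *; have D0 : 0 <= D by exact: sqrtr_ge0.
case: j jm => [//|j] /andP[_ jm].
have -> : dnormal n j.+1 p = dnormal n j (fun x => 'D_n p x).
  by rewrite /dnormal -iterSr.
pose c1 i i' := n.1 * dcoef N false l c i i' + (n.2 * dcoef N true l c i i' + 0).
have dE : (fun x => 'D_n p x) = bpoly N a l c1.
  rewrite -bpoly_lin -bpoly_lin; apply/funext => y.
  rewrite derive_pd; last exact: Cinfty_diff.
  rewrite pE !pd_bpoly; congr (_ + _).
  rewrite [X in _ = _ + X](_ : _ = 0) ?addr0 //.
  by rewrite /bpoly big1 // => i _; rewrite big1 // => i' _; rewrite mul0r.
pose M1 := 2 * (C0 / l * D).
have M10 : 0 <= M1 by rewrite mulr_ge0 // mulr_ge0 // divr_ge0 // ltW.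
have Hc (i i' : 'I_N) : `|c1 i i'| <= M1.
  rewrite /c1 addr0; apply: le_trans (ler_normD _ _) _; rewrite !normrM /M1 mulr_natl mulr2n.
  by apply: lerD; [apply: le_trans (co false i i')|apply: le_trans (co true i i')]; rewrite ler_piMl.
have [c' E Hc'] := @dnormal_bpoly N a l c1 n M1 j l0 M10 n1 n2 Hc.
rewrite dE E.
have M'0 : 0 <= (2 * N%:R / l) ^+ j * M1.
  by rewrite mulr_ge0 // exprn_ge0 // divr_ge0 ?mulr_ge0 // ltW.
apply: le_trans (bpoly_bound l0 M'0 L1 Hc' x1 x2) _.
have -> : N%:R ^+ 2 * Lam ^+ (2 * N) * ((2 * N%:R / l) ^+ j * M1) =
   (2 * C0) * (N%:R ^+ 2 * Lam ^+ (2 * N)) * (2 * N%:R) ^+ j / l ^+ j.+1 * D.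
  have l0' : l != 0 by rewrite gt_eqF.
  rewrite /M1 [l ^+ j.+1]exprS expr_div_n; move: (Lam ^+ _) (N%:R ^+ 2) => A B.
  have lj : l ^+ j != 0 by exact: expf_neq0.
  by move: ((2 * N%:R) ^+ j) (l ^+ j) lj => X Y Y0; field; rewrite Y0 l0'.
rewrite ler_wpM2r // ler_pM2r ?invr_gt0 ?exprn_gt0 // /C1.
have L0 : 0 <= Lam by rewrite (le_trans _ L1).
rewrite ler_pM // ?mulr_ge0 ?exprn_ge0 //.
  by rewrite ler_wpM2r ?mulr_ge0 ?exprn_ge0 // lerDl.
by rewrite ler_weXn2l // ltnW.
Qed.

(** Zero energy kills every coefficient of both partial derivatives, so p is constant along
    horizontal and vertical lines in the whole plane. *)
Lemma dirichlet_eq0_cst K M (p : pt -> R) (d : int) a l : open K -> K `<=` square M -> 0 < l ->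
  (forall x, `|x.1 - a.1| <= l -> `|x.2 - a.2| <= l -> K x) ->
  Pol d p -> dirichlet K p p = 0 -> forall x y, p x = p y.
Proof.
move=> oK KM l0 sqK Pp d0; have [C0 C00 HC] := coef_bound `|d|.+1.
have [c pE] := Pol_bpoly a l0 Pp.
have Cp : Cinfty p by rewrite pE; exact: Cinfty_bpoly.
have wG := is_weak_grad_Cinfty oK KM Cp.
have pd0 b x : pd b p x = 0.
  rewrite pE pd_bpoly /bpoly big1 // => i _; rewrite big1 // => j _.
  suff -> : dcoef `|d|.+1 b l c i j = 0 by rewrite mul0r.
  apply/eqP; rewrite -normr_le0.
  apply: le_trans (HC K a l p _ b _ oK l0 sqK Cp wG _ i j) _; first by rewrite pE pd_bpoly.
  have := weak_grad_le_dirichlet b oK wG; rewrite d0 => h.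
  by rewrite ler0_sqrtr // mulr0.
have h1 y (s t : R) : p (s, y) = p (t, y).
  apply: (@is_derive_0_is_cst _ (fun s => p (s, y))) => s'.
  apply: DeriveDef; first exact: (@differentiable_slice R false p y s' (fun x => Cinfty_diff x Cp)).
  by rewrite -derive1E -(pd_false_slice p (s', y)) pd0.
have h2 y (s t : R) : p (y, s) = p (y, t).
  apply: (@is_derive_0_is_cst _ (fun s => p (y, s))) => s'.
  apply: DeriveDef; first exact: (@differentiable_slice R true p y s' (fun x => Cinfty_diff x Cp)).
  by rewrite -derive1E -(pd_true_slice p (y, s')) pd0.
by move=> [x1 x2] [y1 y2]; rewrite (h1 x2 x1 y1) (h2 y1 x2 y2).
Qed.

End InverseEstimates.

(** * The elliptic projector *)

Section Polynomials.
Context {R : realType}.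
Local Notation pt := (plane R).
Implicit Types (c : nat -> nat -> R).

Lemma bpoly_truncate N n a l c :
  (forall i j, (i < N)%N -> (j < N)%N -> c i j != 0 -> (i < n)%N && (j < n)%N) ->
  bpoly N a l c = bpoly n a l (fun i j => if (i < N)%N && (j < N)%N then c i j else 0).
Proof.
move=> H; pose c' i j := if (i < N)%N && (j < N)%N then c i j else 0.
have widen (k N' : nat) : (k <= N')%N -> (forall i j, ~~ ((i < k)%N && (j < k)%N) -> c' i j = 0) ->
    bpoly N' a l c' = bpoly k a l c'.
  move=> kN c0; apply/funext => x; rewrite /bpoly.
  rewrite (big_ord_widen _ (fun i => \sum_(j < k) c' i j * tensor (mono a.1 l i) (mono a.2 l j) x) kN).
  rewrite [RHS]big_mkcond /=; apply: eq_bigr => i _.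
  case: ifPn => ik.
    rewrite (big_ord_widen _ (fun j => c' i j * tensor (mono a.1 l i) (mono a.2 l j) x) kN).
    rewrite [RHS]big_mkcond /=; apply: eq_bigr => j _; case: ifPn => // jk.
    by rewrite c0 ?mul0r // ik.
  by rewrite big1 // => j _; rewrite c0 ?mul0r // (negbTE ik).
have -> : bpoly N a l c = bpoly N a l c'.
  apply/funext => x; apply: eq_bigr => i _; apply: eq_bigr => j _.
  by rewrite /c' !ltn_ord.
rewrite -(@widen N (maxn N n)) ?leq_maxl //; last first.
  by move=> i j h; rewrite /c' (negbTE h).
rewrite (@widen n (maxn N n)) ?leq_maxr //.
move=> i j h; rewrite /c'; case: ifPn => // /andP[iN jN].
by apply/eqP; apply: contraNT h => h; apply: H.
Qed.

(** In [Pol] the summation range is tied to d. Here the range N is free and the degree is a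
    condition on the coefficients, so differentiation can lower d and keep N. *)
Lemma PolE (d : int) (f : pt -> R) : Pol d f <->
  exists N c, (forall i j, ~~ ((i + j)%N%:Z <= d) -> c i j = 0) /\ f = bpoly N 0 1 c.
Proof.
have E N c x : bpoly N 0 1 c x = \sum_(i < N) \sum_(j < N) c i j * x.1 ^+ i * x.2 ^+ j.
  apply: eq_bigr => i _; apply: eq_bigr => j _.
  by rewrite /tensor /mono /= !subr0 !divr1 mulrA.
split.
  move=> [c fE]; exists `|d|.+1, (fun i j => if (i + j)%N%:Z <= d then c i j else 0).
  split; first by move=> i j /negbTE ->.
  apply/funext => x; rewrite E fE; apply: eq_bigr => i _; rewrite big_mkcond.
  by apply: eq_bigr => j _; case: ifP => // _; rewrite !mul0r.
move=> [N [c [c0 ->]]].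
rewrite (@bpoly_truncate N `|d|.+1); last first.
  move=> i j iN jN; apply: contraR => h; apply/eqP; apply: c0; apply: contraNN h => h.
  case: d h => d // h; rewrite lez_nat in h.
  by rewrite !ltnS /= (leq_trans (leq_addr _ _) h) (leq_trans (leq_addl _ _) h).
exists (fun i j => if (i < N)%N && (j < N)%N then c i j else 0) => x; rewrite E.
apply: eq_bigr => i _; rewrite [RHS]big_mkcond; apply: eq_bigr => j _.
have [h|h] := boolP ((i + j)%N%:Z <= d); first by [].
by rewrite c0 // if_same !mul0r.
Qed.

Lemma Cinfty_Pol (d : int) (f : pt -> R) : Pol d f -> Cinfty f.
Proof. by move=> /PolE [N [c [_ ->]]]; exact: Cinfty_bpoly. Qed.

Lemma Pol_lin (d : int) (r : R) (f g : pt -> R) : Pol d f -> Pol d g ->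
  Pol d (fun x => r * f x + g x).
Proof.
move=> [c fE] [c' gE]; exists (fun i j => r * c i j + c' i j) => x.
rewrite fE gE mulr_sumr -big_split /=; apply: eq_bigr => i _.
rewrite mulr_sumr -big_split /=; apply: eq_bigr => j _; ring.
Qed.

Lemma Pol_pd (d : int) b (f : pt -> R) : Pol d f -> Pol (d - 1) (pd b f).
Proof.
move=> /PolE [N [c [c0 ->]]]; apply/PolE; rewrite pd_bpoly.
exists N, (dcoef N b 1 c); split => // i j h.
have h' : ~~ ((i + j).+1%N%:Z <= d).
  by apply: contraNN h; rewrite lerBrDr -addn1 PoszD.
rewrite /dcoef; case: b; case: ifP => // _.
  by rewrite c0 ?mulr0 // addnS.
by rewrite c0 ?mulr0 // addSn.
Qed.

Lemma Pol0 (d : int) : Pol d (fun=> 0 : R).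
Proof.
exists (fun _ _ => 0) => x; rewrite big1 // => i _; rewrite big1 // => j _.
by rewrite !mul0r.
Qed.

Lemma Pol_laplacian (m : nat) (f : pt -> R) : Pol m%:Z f -> Pol (m%:Z - 2) (laplacian f).
Proof.
move=> Pf; have h b : Pol (m%:Z - 2) (pd b (pd b f)).
  by have := Pol_pd b (Pol_pd b Pf); rewrite -addrA.
have := Pol_lin 1 (h false) (h true); rewrite /laplacian.
by under eq_fun do rewrite mul1r.
Qed.

End Polynomials.

(** * Orthogonality of the projection and its residual *)

Section Projector.
Context {R : realType}.
Local Notation pt := (plane R).
Local Notation mpt := (measurableTypeR R * measurableTypeR R)%type.
Local Notation mu := (@plane_measure R).
Variables (K : set pt) (M : R) (a : pt) (l : R) (m : nat).
Hypotheses (oK : open K) (KM : K `<=` square M) (l0 : 0 < l).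
Hypothesis sqK : forall x, `|x.1 - a.1| <= l -> `|x.2 - a.2| <= l -> K x.
Implicit Types (f g p q : pt -> R).

Let mK : measurable (K : set mpt) := open_measurable_plane oK.

Let finK : (mu K < +oo)%E.
Proof.
apply: le_lt_trans (square_fin M); apply: le_measure; rewrite ?inE //.
exact: square_measurable.
Qed.

Lemma measure_gt0_square : 0 < fine (mu K).
Proof.
pose Q : set pt := `[a.1 - l, a.1 + l] `*` `[a.2 - l, a.2 + l].
have QK : Q `<=` K.
  move=> x [/=]; rewrite !in_itv /= => x1 x2; apply: sqK; rewrite ler_distlC; lra.
have mQ : measurable (Q : set mpt) by exact: box_measurable.
have le : (mu Q <= mu K)%E by apply: le_measure; rewrite ?inE.
have E : mu Q = (2 * l * (2 * l))%:E.
  rewrite /plane_measure /Q /= product_measure1E //= !lebesgue_measure_itv /= !lte_fin.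
  have lt (y : R) : y - l < y + l by rewrite ltrD2l gtrN.
  rewrite !lt.
  by rewrite -!EFinB -EFinM; congr (_%:E); ring.
apply: (@lt_le_trans _ _ (fine (mu Q))); first by rewrite E /= !mulr_gt0.
apply: fine_le => //; first by rewrite E.
by rewrite ge0_fin_numE.
Qed.

Lemma H1_Pol (d : int) p : Pol d p -> H1 K p.
Proof. by move=> /Cinfty_Pol Cp; exact: H1_Cinfty KM Cp. Qed.

Lemma subfE f g : (fun x => f x - g x) = fun x => -1 * g x + f x.
Proof. by apply/funext => x; ring. Qed.

Lemma H1_sub f g : H1 K f -> H1 K g -> H1 K (fun x => f x - g x).
Proof. by move=> Hf Hg; rewrite subfE; exact: H1_lin. Qed.

Lemma dirichlet_subl f g q : H1 K f -> H1 K g -> H1 K q ->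
  dirichlet K (fun x => f x - g x) q = dirichlet K f q - dirichlet K g q.
Proof. by move=> Hf Hg Hq; rewrite subfE dirichlet_lin // mulN1r addrC. Qed.

Lemma dirichlet0l g : H1 K g -> dirichlet K (fun=> 0) g = 0.
Proof.
move=> Hg; have -> : (fun=> 0) = (fun x => g x - g x) by apply/funext => x; rewrite subrr.
by rewrite (dirichlet_subl Hg Hg Hg) subrr.
Qed.

Definition Pi_spec f p := [/\ Pol m%:Z p,
    forall q, Pol m%:Z q -> dirichlet K p q = dirichlet K f q &
    area_int K p = area_int K f].

(* Existence of the projection is never needed: the default value 0 leaves the
   residual f, and the consequences below hold in both cases. *)
Lemma Pi_nablaP f : Pi_spec f (Pi_nabla K m f) \/ Pi_nabla K m f = (fun=> 0).
Proof.
rewrite /Pi_nabla; set S := [set p | _].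
have [[p Sp]|nS] := pselect (exists p, S p); last by right; rewrite xgetPN // => p Sp; apply: nS; exists p.
by left; apply: (@xgetPex _ _ S); exists p.
Qed.

Lemma Pol_Pi f : Pol m%:Z (Pi_nabla K m f).
Proof. by have [[]//|->] := Pi_nablaP f; exact: Pol0. Qed.

Lemma dirichlet_Pi f : H1 K f ->
  dirichlet K f (Pi_nabla K m f) = dirichlet K (Pi_nabla K m f) (Pi_nabla K m f).
Proof.
move=> Hf; have [[P1 P2 _]|->] := Pi_nablaP f; first by rewrite P2.
by rewrite dirichletC !dirichlet0l //; exact: H1_Pol (@Pol0 R 0).
Qed.

(** Pythagoras: the residual is orthogonal to the projection, trivially so if the latter is the
    default 0. It bounds the energies of both parts by that of f. *)
Lemma dirichlet_Pi_split f : H1 K f ->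
  dirichlet K f f = dirichlet K (Pi_nabla K m f) (Pi_nabla K m f) +
    dirichlet K (fun x => f x - Pi_nabla K m f x) (fun x => f x - Pi_nabla K m f x).
Proof.
move=> Hf; have Hp := H1_Pol (Pol_Pi f); have e0 := dirichlet_Pi Hf.
set p := Pi_nabla K m f in Hp e0 *; set r := fun x => f x - p x.
have Hr : H1 K r := H1_sub Hf Hp.
have e1 : dirichlet K r r = _ := dirichlet_subl Hf Hp Hr.
have e2 : dirichlet K r f = _ := dirichlet_subl Hf Hp Hf.
have e3 : dirichlet K r p = _ := dirichlet_subl Hf Hp Hp.
rewrite e1 (dirichletC K f r) (dirichletC K p r) e2 e3 (dirichletC K p f) e0.
have E (A B : R) : A = B + (A - B - (B - B)) by ring.
exact: E.
Qed.

Lemma area_int_cst (r : R) : area_int K (fun=> r) = r * fine (mu K).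
Proof. exact: Rintegral_cst. Qed.

(** The projection q of the residual has energy zero because the residual is orthogonal to
    polynomials; so q is a constant, its integral is zero, and K has positive area. This makes the
    residual eligible for the assumptions on the stabilization. *)
Lemma Pi_nabla_residual f x : H1 K f ->
  Pi_nabla K m (fun y => f y - Pi_nabla K m f y) x = 0.
Proof.
move=> Hf; set p := Pi_nabla K m f.
have Hp : H1 K p := H1_Pol (Pol_Pi f).
have [[P1 P2 P3]|p0] := Pi_nablaP f; last first.
  have -> : (fun y => f y - p y) = f by apply/funext => y; rewrite /p p0 subr0.
  by rewrite p0.
have [[Q1 Q2 Q3]|->//] := Pi_nablaP (fun y => f y - p y).
set q := Pi_nabla K m _ in Q1 Q2 Q3 *.
have Hq : H1 K q := H1_Pol Q1.
have q0 : dirichlet K q q = 0 by rewrite Q2 // dirichlet_subl // -P2 // subrr.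
have qc := dirichlet_eq0_cst oK KM l0 sqK Q1 q0.
have iq g : H1 K g -> mu.-integrable K (EFin \o g).
  by move=> [Lg _]; apply: L2_integrable Lg.
have q1 : area_int K q = 0.
  rewrite Q3 subfE area_int_lin //; [|exact: iq|exact: iq].
  by rewrite -P3 mulN1r addNr.
have qE : q = fun=> q x by apply/funext => y; exact: qc.
move: q1; rewrite {1}qE area_int_cst => /eqP; rewrite mulf_eq0.
by rewrite [fine _ == 0]gt_eqF ?measure_gt0_square // orbF => /eqP.
Qed.

Lemma continuous_on_edge (e : pt * pt) : continuous (on_edge e : R -> pt).
Proof.
move=> s; rewrite /on_edge.
have H : continuous_at s (fun s : R => (e.1.1 + s * (e.2 - e.1).1, e.1.2 + s * (e.2 - e.1).2)).
  have c (x y : R) : continuous_at s (fun s : R => x + s * y).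
    by apply: (@cvgD _ _ _ _ _ (fun=> x) (fun s : R => s * y)); [exact: cvg_cst|exact: mulrr_continuous].
  exact: (@cvg_pair _ _ _ (nbhs s) (nbhs _) (nbhs _) _ _ _ _ _ (c _ _) (c _ _)).
exact: H.
Qed.

Lemma L2_edge_continuous (e : pt * pt) f : continuous f -> L2_edge e f.
Proof.
move=> cf; have ce : continuous (f \o on_edge e).
  by move=> s; apply: continuous_comp; [exact: continuous_on_edge|exact: cf].
split.
  apply: (measurable_funS measurableT) => //.
  exact: continuous_measurable_fun.
apply: (@continuous_compact_integrable R (fun s => f (on_edge e s) ^+ 2)).
  exact: segment_compact.
apply: continuous_subspaceT.
rewrite (_ : (fun s => _) = fun s => (f \o on_edge e) s * (f \o on_edge e) s).
  by move=> s; apply: continuousM; exact: ce.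
by apply/funext => s; rewrite expr2.
Qed.

Lemma L2_edge_lin (e : pt * pt) (r : R) f g : L2_edge e f -> L2_edge e g ->
  L2_edge e (fun x => r * f x + g x).
Proof.
move=> [mf f2] [mg g2].
have mI : measurable (`[0%R, 1]%classic : set (measurableTypeR R)) by exact: measurable_itv.
split.
  by apply: measurable_funD => //; apply: measurable_funM.
pose F s := f (on_edge e s); pose G s := g (on_edge e s).
have i1 : lebesgue_measure.-integrable `[0, 1] (EFin \o (fun s => 2 * r ^+ 2 * F s ^+ 2 + 2 * G s ^+ 2)).
  apply: (@integrableD _ _ _ lebesgue_measure _ mI (EFin \o (fun s => 2 * r ^+ 2 * F s ^+ 2))
     (EFin \o (fun s => 2 * G s ^+ 2))).
    exact: (@integrableZl _ _ _ lebesgue_measure _ mI (2 * r ^+ 2) (EFin \o (fun s => F s ^+ 2))).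
  exact: (@integrableZl _ _ _ lebesgue_measure _ mI 2 (EFin \o (fun s => G s ^+ 2))).
apply: le_integrable i1 => //.
  apply/measurable_EFinP; apply: measurable_funX.
  by apply: measurable_funD => //; apply: measurable_funM.
move=> s _ /=; rewrite lee_fin -/(F s) -/(G s).
have h1 := sqr_ge0 (r * F s - G s); have h2 := sqr_ge0 (r * F s + G s).
have e1 : 2 * r ^+ 2 * F s ^+ 2 + 2 * G s ^+ 2 = (r * F s - G s) ^+ 2 + (r * F s + G s) ^+ 2 by ring.
by rewrite e1 !ger0_norm ?lerDr // addr_ge0.
Qed.

(** Subtracting p from f, from its trace and from each approximating function leaves all differences
    unchanged; two integrations by parts show that the weak Laplacian changes by that of p, of
    degree at most m - 2. *)
Lemma Vloc_sub_Pol vs f p : Vloc K vs m f -> Pol m%:Z p -> Vloc K vs m (fun x => f x - p x).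
Proof.
move=> [Hf [b [cb eb] [tb1 [u [Cu u1 u2]]]] [q Pq Hq]] Pp.
have Cp := Cinfty_Pol Pp; have Hp := H1_Pol Pp.
have cp := Cinfty_continuous Cp.
split.
- exact: H1_sub.
- exists (fun x => b x - p x); first split.
  + move=> x; apply: (@cvgB _ _ _ _ _ b p); first exact: cb.
    by apply: continuous_subspaceT; exact: cp.
  + move=> e ee; have [q' Pq' Hq'] := eb e ee.
    exists (fun x => -1 * p x + q' x); first exact: Pol_lin.
    by move=> x ex; rewrite Hq' //; ring.
  + split=> [e ee|].
      rewrite subfE; apply: L2_edge_lin; last exact: tb1.
      exact: L2_edge_continuous.
    exists (fun j x => u j x - p x); split.
    * by move=> j; rewrite subfE; apply: CinftyD; [apply: CinftyZ|exact: Cu].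
    * have E j : (fun x => u j x - p x - (f x - p x)) = (fun x => u j x - f x).
        by apply/funext => x; ring.
      have -> : (fun j => H1norm2 K (fun x => u j x - p x - (f x - p x))) =
          (fun j => H1norm2 K (fun x => u j x - f x)) by apply/funext => j; rewrite E.
      exact: u1.
    * move=> e ee; have E j : (fun x => (u j x - p x - (b x - p x)) ^+ 2) =
          (fun x => (u j x - b x) ^+ 2).
        by apply/funext => x; congr (_ ^+ 2); ring.
      have -> : (fun j => edge_int e (fun x => (u j x - p x - (b x - p x)) ^+ 2)) =
          (fun j => edge_int e (fun x => (u j x - b x) ^+ 2)) by apply/funext => j; rewrite E.
      exact: u2.
- exists (fun x => -1 * laplacian p x + q x); first by apply: Pol_lin => //; exact: Pol_laplacian.
  move=> eta te.
  have Lf := Hf.1; have Lp := Hp.1; have Le := L2_test_function mK te.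
  have tl b' := test_function_pd b' (test_function_pd b' te).
  have Ll : L2 K (laplacian eta).
    have := L2_lin 1 mK (L2_test_function mK (tl false)) (L2_test_function mK (tl true)).
    by under eq_fun do rewrite mul1r.
  have LP (d : int) g : Pol d g -> L2 K g by move=> /H1_Pol [].
  have Lap := Pol_laplacian Pp.
  have I1 : area_int K (fun x => p x * laplacian eta x) = area_int K (fun x => laplacian p x * eta x).
    have ibp2 b' : area_int K (fun x => p x * pd b' (pd b' eta) x) =
        area_int K (fun x => pd b' (pd b' p) x * eta x).
      rewrite (integration_by_parts_test b' Cp (test_function_pd b' te)).
      by rewrite (integration_by_parts_test b' (Cinfty_pd b' Cp) te) opprK.
    have -> : (fun x => p x * laplacian eta x) =
        fun x => 1 * (p x * pd false (pd false eta) x) + p x * pd true (pd true eta) x.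
      by apply/funext => x; rewrite /laplacian mul1r mulrDr.
    have -> : (fun x => laplacian p x * eta x) =
        fun x => 1 * (pd false (pd false p) x * eta x) + pd true (pd true p) x * eta x.
      by apply/funext => x; rewrite /laplacian mul1r mulrDl.
    have Lpd b' : L2 K (pd b' (pd b' p)) by apply: LP; exact: Pol_pd (Pol_pd b' Pp).
    have i1 b' := L2_mul_integrable mK Lp (L2_test_function mK (tl b')).
    have i2 b' := L2_mul_integrable mK (Lpd b') Le.
    have A1 := area_int_lin 1 mK (i1 false) (i1 true).
    have A2 := area_int_lin 1 mK (i2 false) (i2 true).
    exact (etrans A1 (etrans (congr2 (fun x y => 1 * x + y) (ibp2 false) (ibp2 true)) (esym A2))).
  have -> : (fun x => (f x - p x) * laplacian eta x) =
      fun x => -1 * (p x * laplacian eta x) + f x * laplacian eta x.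
    by apply/funext => x; rewrite mulrBl mulN1r addrC.
  have -> : (fun x => (-1 * laplacian p x + q x) * eta x) =
      fun x => -1 * (laplacian p x * eta x) + q x * eta x.
    by apply/funext => x; rewrite mulrDl mulrA.
  have A1 := area_int_lin (-1) mK (L2_mul_integrable mK Lp Ll) (L2_mul_integrable mK Lf Ll).
  have A2 := area_int_lin (-1) mK (L2_mul_integrable mK (LP _ _ Lap) Le) (L2_mul_integrable mK (LP _ _ Pq) Le).
  exact (etrans A1 (etrans (congr2 (fun x y => -1 * x + y) I1 (Hq eta te)) (esym A2))).
Qed.

End Projector.

(** * Polygonal domains *)

Section PolygonTopology.
Context {R : realType}.
Local Notation pt := (plane R).
Implicit Types (x y z u w : pt) (e : pt * pt) (A D E : set pt) (vs : seq pt).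

Lemma on_edgeE e s :
  on_edge e s = (e.1.1 + s * (e.2.1 - e.1.1), e.1.2 + s * (e.2.2 - e.1.2)).
Proof. by []. Qed.

Lemma segmentP e x : segment e x <-> exists2 s, 0 <= s <= 1 & on_edge e s = x.
Proof.
split=> [[s /= hs <-]|[s hs <-]].
  by exists s => //; move: hs; rewrite in_itv.
by exists s => //=; rewrite in_itv.
Qed.

Lemma segment_compact_plane e : compact (segment e).
Proof.
apply: continuous_compact; last exact: segment_compact.
by apply: continuous_subspaceT; exact: continuous_on_edge.
Qed.

Lemma segment_closed e : closed (segment e).
Proof. by apply: compact_closed; [exact: norm_hausdorff|exact: segment_compact_plane]. Qed.

Lemma segment_connected_plane e : connected (segment e).
Proof.
apply: connected_continuous_connected; first exact: segment_connected.
by apply: continuous_subspaceT; exact: continuous_on_edge.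
Qed.

Lemma segment_left e : segment e e.1.
Proof. by apply/segmentP; exists 0; rewrite ?lexx ?ler01 // /on_edge scale0r addr0. Qed.

Lemma segment_right e : segment e e.2.
Proof. by apply/segmentP; exists 1; rewrite ?lexx ?ler01 // /on_edge scale1r addrC subrK. Qed.

Lemma connected_dichotomy A D E : connected A -> open D -> open E ->
  D `&` E = set0 -> A `<=` D `|` E -> A `&` D !=set0 -> A `<=` D.
Proof.
move=> cA oD oE DE ADE AD.
have <- : A `&` D = A; last exact: subIsetr.
apply: cA => //; first by exists D.
exists (~` E); first exact: open_closedC.
apply/seteqP; split => x [Ax].
  by move=> Dx; split=> // Ex; have : (D `&` E) x by []; rewrite DE.
by move=> nEx; split=> //; have [] := ADE x Ax.
Qed.

Definition pconvex A := forall x y, A x -> A y -> segment (x, y) `<=` A.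

Lemma pconvex_dichotomy A D E : pconvex A -> open D -> open E ->
  D `&` E = set0 -> A `<=` D `|` E -> A `&` D !=set0 -> A `<=` D.
Proof.
move=> cA oD oE DE ADE [x [Ax Dx]] y Ay.
apply: (connected_dichotomy (@segment_connected_plane (x, y)) oD oE DE); last exact: segment_right.
  by move=> z /(cA _ _ Ax Ay); exact: ADE.
by exists x; split => //; exact: (segment_left (x, y)).
Qed.

Lemma pconvexI A B : pconvex A -> pconvex B -> pconvex (A `&` B).
Proof. by move=> cA cB x y [Ax Bx] [Ay By] z sz; split; [apply: cA sz|apply: cB sz]. Qed.

Lemma pconvex_halfplane y (p q : R) :
  pconvex [set x | 0 < p * (x.1 - y.1) + q * (x.2 - y.2)].
Proof.
move=> x x' /= h h' z /segmentP [s /andP[s0 s1] <-]; rewrite on_edgeE /=.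
have -> : p * (x.1 + s * (x'.1 - x.1) - y.1) + q * (x.2 + s * (x'.2 - x.2) - y.2) =
  (1 - s) * (p * (x.1 - y.1) + q * (x.2 - y.2)) + s * (p * (x'.1 - y.1) + q * (x'.2 - y.2)) by ring.
move: h h'; set a := _ + _; set b := _ + _ => a0 b0; nra.
Qed.

Lemma ballE y (r : R) z : ball y r z <-> `|y.1 - z.1| < r /\ `|y.2 - z.2| < r.
Proof. by []. Qed.

Lemma pconvex_ball y (r : R) : pconvex (ball y r).
Proof.
move=> x x' [h1 h2] [h1' h2'] z /segmentP [s /andP[s0 s1] <-].
have key (p q q' : R) : `|p - q| < r -> `|p - q'| < r -> `|p - (q + s * (q' - q))| < r.
  move=> k k'; have -> : p - (q + s * (q' - q)) = (1 - s) * (p - q) + s * (p - q') by ring.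
  apply: le_lt_trans (ler_normD _ _) _; rewrite !normrM (ger0_norm s0) ger0_norm ?subr_ge0 //.
  move: k k'; set A := `|p - q|; set B := `|p - q'| => k k'.
  have [s1'|s1'] := eqVneq s 1; first by rewrite s1'; lra.
  have : 0 < 1 - s by rewrite subr_gt0 lt_neqAle s1'.
  by nra.
by apply/ballE; rewrite on_edgeE /=; split; exact: key.
Qed.

Lemma near_push z (v : pt) (P : set pt) : nbhs z P ->
  exists2 t : R, 0 < t & P (z.1 + t * v.1, z.2 + t * v.2).
Proof.
move=> /nbhs_ballP [r /= r0 rP].
pose t := r / (2 * (`|v.1| + `|v.2| + 1)).
have d0 : 0 < 2 * (`|v.1| + `|v.2| + 1) by rewrite mulr_gt0 // ltr_wpDl // addr_ge0.
have t0 : 0 < t by rewrite divr_gt0.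
exists t => //; apply: rP; apply/ballE => /=.
have tr : t * (`|v.1| + `|v.2| + 1) = r / 2 by rewrite /t; field; rewrite gt_eqF // ltr_wpDl // addr_ge0.
have v1 : 0 <= t * `|v.1| by rewrite mulr_ge0 // ltW.
have v2 : 0 <= t * `|v.2| by rewrite mulr_ge0 // ltW.
rewrite !mulrDr mulr1 in tr.
split; rewrite opprD addrA subrr sub0r normrN normrM gtr0_norm //; lra.
Qed.

(** * The two sides of a curve near one of its points *)

Section Curve.
Variables (D C : set pt).
Hypotheses (oD : open D) (DC : boundary D = C).

Let E := ~` closure D.

Let oE : open E.
Proof. by apply: closed_openC; exact: closed_closure. Qed.

Let DE : D `&` E = set0.
Proof. by rewrite -subset0 => x [Dx]; apply; exact: subset_closure. Qed.

Let coverDE x : ~ C x -> D x \/ E x.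
Proof.
move=> nC; have [Dx|nDx] := pselect (D x); first by left.
right=> clx; apply: nC; rewrite -DC; split => // /interior_subset; exact: nDx.
Qed.

(** Adherence to the exterior of D, written as the complement of an interior so that it is visibly a
    closed condition. *)
Definition outer z := ~ (closure D)° z.

Lemma outer_adherent z : (forall P, nbhs z P -> exists2 x, P x & E x) -> outer z.
Proof. by move=> H /H [x clx Ex]; exact: Ex. Qed.

(* If, near a point, the complement of the curve consists of two pieces, each
   contained in D or in the exterior and each accumulating at the points of the
   curve, then a point of the curve adherent to the exterior has only such
   points of the curve as neighbours. *)
Lemma outer_near (y : pt) (B A1 A2 : set pt) :
  open_nbhs y B ->
  (A1 `&` E !=set0 -> A1 `<=` E) -> (A2 `&` E !=set0 -> A2 `<=` E) ->
  (forall z, B z -> [\/ A1 z, A2 z |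
     forall P, nbhs z P -> A1 `&` P !=set0 /\ A2 `&` P !=set0]) ->
  (forall z, C z -> A1 z \/ A2 z -> ~ B z) ->
  outer y -> \forall z \near y, C z -> outer z.
Proof.
move=> [oB By] h1 h2 hB hC oy.
have nB : nbhs y B by apply: open_nbhs_nbhs.
have [z Bz Ez] : exists2 z, B z & E z.
  apply: contrapT => nex; apply: oy; apply: filterS nB => z Bz.
  by apply: contrapT => nz; apply: nex; exists z.
have [i hi] : exists b : bool, (if b then A1 else A2) `<=` E.
  case: (hB z Bz) => [a1|a2|/(_ E)].
  - by exists true; apply: h1; exists z.
  - by exists false; apply: h2; exists z.
  - case; first by apply: open_nbhs_nbhs.
    by move=> a1 _; exists true; exact: h1.
apply: filterS nB => x Bx Cx; apply: outer_adherent => P nP.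
case: (hB x Bx) => [a|a|/(_ P nP)].
- by exfalso; apply: hC Bx => //; left.
- by exfalso; apply: hC Bx => //; right.
- by case: i hi => hi [[a [Aa Pa]] [b [Ab Pb]]]; [exists a|exists b] => //; exact: hi.
Qed.

Let convexE A : pconvex A -> (forall z, A z -> ~ C z) -> A `&` E !=set0 -> A `<=` E.
Proof.
move=> cA AC; apply: (pconvex_dichotomy cA oE oD); first by rewrite setIC.
by move=> x /AC /coverDE [Dx|Ex]; [right|left].
Qed.

(** The two pieces are the half-discs off the line: both are convex and avoid the curve, and both
    accumulate at every point of the line. *)
Lemma outer_near_line y (r p q : R) : 0 < r -> (p, q) != (0, 0) ->
  (forall z, ball y r z -> C z -> p * (z.1 - y.1) + q * (z.2 - y.2) = 0) ->
  outer y -> \forall z \near y, C z -> outer z.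
Proof.
move=> r0 pq HC.
pose H (p q : R) := [set x : pt | 0 < p * (x.1 - y.1) + q * (x.2 - y.2)].
have n0 : 0 < p * p + q * q.
  rewrite lt_neqAle eq_sym addr_ge0 -?expr2 ?sqr_ge0 // andbT.
  by apply: contraNneq pq => /eqP; rewrite paddr_eq0 ?sqr_ge0 // !sqrf_eq0 => /andP[/eqP-> /eqP->].
apply: (@outer_near y (ball y r) (ball y r `&` H p q) (ball y r `&` H (- p) (- q))).
- by split; [exact: ball_open|exact: ballxx].
- apply: convexE; first by apply: pconvexI; [exact: pconvex_ball|exact: pconvex_halfplane].
  by move=> z [Bz]; rewrite /H /= => h Cz; move: h; rewrite (HC z Bz Cz) ltxx.
- apply: convexE; first by apply: pconvexI; [exact: pconvex_ball|exact: pconvex_halfplane].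
  move=> z [Bz]; rewrite /H /= => h Cz; have := HC z Bz Cz => e0.
  by move: h; rewrite !mulNr -opprD e0 oppr0 ltxx.
- move=> z Bz; have [lt|gt|eq0] := ltgtP (p * (z.1 - y.1) + q * (z.2 - y.2)) 0.
  + by apply: Or32; split => //; rewrite /H /= !mulNr -opprD oppr_gt0.
  + by apply: Or31; split.
  + apply: Or33 => P nP.
    have nB : nbhs z (ball y r) by apply: open_nbhs_nbhs; split => //; exact: ball_open.
    have [t t0 [Bt Pt]] := near_push (p, q) (filterI nB nP).
    have [t' t'0 [Bt' Pt']] := near_push (- p, - q) (filterI nB nP).
    split; [exists (z.1 + t * p, z.2 + t * q)|exists (z.1 + t' * - p, z.2 + t' * - q)];
      split => //; split => //; rewrite /H /=.
      have -> : p * (z.1 + t * p - y.1) + q * (z.2 + t * q - y.2) =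
        (p * (z.1 - y.1) + q * (z.2 - y.2)) + t * (p * p + q * q) by ring.
      by rewrite eq0 add0r mulr_gt0.
    have -> : - p * (z.1 + t' * - p - y.1) + - q * (z.2 + t' * - q - y.2) =
      - (p * (z.1 - y.1) + q * (z.2 - y.2)) + t' * (p * p + q * q) by ring.
    by rewrite eq0 oppr0 add0r mulr_gt0.
- move=> z Cz [[Bz h]|[Bz h]] _; move: h; rewrite /H /=; have := HC z Bz Cz => e0.
    by rewrite e0 ltxx.
  by rewrite !mulNr -opprD e0 oppr0 ltxx.
Qed.

(** One piece is the convex sector between the rays. The other is reflex, hence not convex, but it
    is the union of two half-discs with a common point, so the exterior passes from one half-disc to
    the other. *)
Lemma outer_near_angle y (r : R) u w : 0 < r -> u.1 * w.2 - u.2 * w.1 != 0 ->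
  (forall z, ball y r z -> C z -> exists2 t : R, 0 <= t &
     z = (y.1 + t * u.1, y.2 + t * u.2) \/ z = (y.1 + t * w.1, y.2 + t * w.2)) ->
  outer y -> \forall z \near y, C z -> outer z.
Proof.
move=> r0; set k := _ - _ => k0 HC.
(* [S] and [T] are the coordinates of z - y in the basis (u, w), so near y the curve lies on the
   nonnegative half-axes. *)
pose S z := w.2 / k * (z.1 - y.1) + (- w.1 / k) * (z.2 - y.2).
pose T z := - u.2 / k * (z.1 - y.1) + u.1 / k * (z.2 - y.2).
have kE : u.1 * w.2 - u.2 * w.1 = k by [].
have Sl z (t s : R) : S (z.1 + (t * u.1 + s * w.1), z.2 + (t * u.2 + s * w.2)) = S z + t.
  rewrite /S /=; transitivity (w.2 / k * (z.1 - y.1) + - w.1 / k * (z.2 - y.2) + t * (u.1 * w.2 - u.2 * w.1) / k).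
    by field.
  by rewrite kE mulfK.
have Tl z (t s : R) : T (z.1 + (t * u.1 + s * w.1), z.2 + (t * u.2 + s * w.2)) = T z + s.
  rewrite /T /=; transitivity (- u.2 / k * (z.1 - y.1) + u.1 / k * (z.2 - y.2) + s * (u.1 * w.2 - u.2 * w.1) / k).
    by field.
  by rewrite kE mulfK.
have Sy : S y = 0 by rewrite /S !subrr !mulr0 addr0.
have Ty : T y = 0 by rewrite /T !subrr !mulr0 addr0.
have CST z : ball y r z -> C z -> [/\ 0 <= S z, 0 <= T z & S z = 0 \/ T z = 0].
  move=> Bz Cz; have [t t0 [->|->]] := HC z Bz Cz.
    have := Sl y t 0; have := Tl y t 0; rewrite !mul0r !addr0 Sy Ty add0r => -> ->.
    by split => //; right.
  have := Sl y 0 t; have := Tl y 0 t; rewrite !mul0r !add0r Sy Ty !add0r => -> ->.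
  by split => //; left.
pose H (F : pt -> R) := [set z : pt | 0 < F z].
have cS : pconvex (H S) by exact: pconvex_halfplane.
have cT : pconvex (H T) by exact: pconvex_halfplane.
have cS' : pconvex (H (fun z => - S z)).
  have -> : H (fun z => - S z) = [set z : pt | 0 < - (w.2 / k) * (z.1 - y.1) + - (- w.1 / k) * (z.2 - y.2)].
    by apply/seteqP; split => z; rewrite /H /S /= opprD !mulNr.
  exact: pconvex_halfplane.
have cT' : pconvex (H (fun z => - T z)).
  have -> : H (fun z => - T z) = [set z : pt | 0 < - (- u.2 / k) * (z.1 - y.1) + - (u.1 / k) * (z.2 - y.2)].
    by apply/seteqP; split => z; rewrite /H /T /= opprD !mulNr.
  exact: pconvex_halfplane.
have pb := pconvex_ball (y := y) (r := r).
have push z a b : ball y r z -> forall P, nbhs z P -> exists2 t : R, 0 < t &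
    exists x, [/\ P x, ball y r x, S x = S z + t * a & T x = T z + t * b].
  move=> Bz P nP.
  have nB : nbhs z (ball y r) by apply: open_nbhs_nbhs; split => //; exact: ball_open.
  have [t t0 [Bt Pt]] := near_push (a * u.1 + b * w.1, a * u.2 + b * w.2) (filterI nB nP).
  exists t => //; exists (z.1 + (t * a * u.1 + t * b * w.1), z.2 + (t * a * u.2 + t * b * w.2)).
  by rewrite Sl Tl; split => //; [move: Pt|move: Bt]; rewrite /= !mulrDr !mulrA.
have B1 : ball y r `&` H (fun z => - S z) `&` E !=set0 -> ball y r `&` H (fun z => - S z) `<=` E.
  apply: convexE; first exact: pconvexI.
  by move=> z [Bz]; rewrite /H /= => h /(CST z Bz) [s0 _ _]; rewrite ltNge oppr_le0 s0 in h.
have B2 : ball y r `&` H (fun z => - T z) `&` E !=set0 -> ball y r `&` H (fun z => - T z) `<=` E.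
  apply: convexE; first exact: pconvexI.
  by move=> z [Bz]; rewrite /H /= => h /(CST z Bz) [_ s0 _]; rewrite ltNge oppr_le0 s0 in h.
(* A common point of the half-discs S < 0 and T < 0, which carries membership in the exterior
   across. *)
have [t t0 [x0 [_ Bx0 Sx0 Tx0]]] := push y (-1) (-1) (ballxx y r0) setT filterT.
have [x0S x0T] : H (fun z => - S z) x0 /\ H (fun z => - T z) x0.
  by rewrite /H /= Sx0 Tx0 Sy Ty add0r mulrN1 opprK.
apply: (@outer_near y (ball y r) (ball y r `&` (H S `&` H T))
   (ball y r `&` (H (fun z => - S z) `|` H (fun z => - T z)))).
- by split; [exact: ball_open|exact: ballxx].
- apply: convexE; first by do 2 apply: pconvexI => //.
  move=> z [Bz [h1 h2]] Cz; have [_ _ [s0|s0]] := CST z Bz Cz.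
    by move: h1; rewrite /H /= s0 ltxx.
  by move: h2; rewrite /H /= s0 ltxx.
- move=> [z [[Bz [h|h]] Ez]].
    have s1 : ball y r `&` H (fun z => - S z) `<=` E by apply: B1; exists z.
    have s2 : ball y r `&` H (fun z => - T z) `<=` E by apply: B2; exists x0; split => //; apply: s1.
    by move=> x [Bx [?|?]]; [apply: s1|apply: s2].
  have s2 : ball y r `&` H (fun z => - T z) `<=` E by apply: B2; exists z.
  have s1 : ball y r `&` H (fun z => - S z) `<=` E by apply: B1; exists x0; split => //; apply: s2.
  by move=> x [Bx [?|?]]; [apply: s1|apply: s2].
- move=> z Bz.
  have [Sneg|S0] := ltP (S z) 0.
    by apply: Or32; split => //; left; rewrite /H /= oppr_gt0.
  have [Tneg|T0] := ltP (T z) 0.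
    by apply: Or32; split => //; right; rewrite /H /= oppr_gt0.
  have [/andP[Sp Tp]|nST] := boolP ((0 < S z) && (0 < T z)); first by apply: Or31.
  apply: Or33 => P nP.
  have [t1 t10 [x1 [Px1 Bx1 Sx1 Tx1]]] := push z 1 1 Bz P nP.
  split.
    by exists x1; split => //; split => //; split; rewrite /H /= ?Sx1 ?Tx1 mulr1 ltr_wpDl.
  have [Se|Se] := eqVneq (S z) 0.
    have [t2 t20 [x2 [Px2 Bx2 Sx2 Tx2]]] := push z (-1) 0 Bz P nP.
    by exists x2; split => //; split => //; left; rewrite /H /= Sx2 Se add0r mulrN1 opprK.
  have [t2 t20 [x2 [Px2 Bx2 Sx2 Tx2]]] := push z 0 (-1) Bz P nP.
  have Te : T z = 0.
    apply/eqP; move: nST; rewrite !lt_neqAle S0 T0 !andbT negb_and !negbK => /orP[/eqP h|/eqP <- //].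
    by rewrite -h eqxx in Se.
  by exists x2; split => //; split => //; right; rewrite /H /= Tx2 Te add0r mulrN1 opprK.
- move=> z Cz [[Bz [h1 h2]]|[Bz [h|h]]] _; have [s0 t0' st] := CST z Bz Cz.
  + by move: h1 h2; rewrite /H /=; case: st => ->; rewrite ltxx.
  + by move: h; rewrite /H /= oppr_gt0 ltNge s0.
  + by move: h; rewrite /H /= oppr_gt0 ltNge t0'.
Qed.

(** Proportional directions, zero ones included, put both rays on one line; otherwise they form an
    angle. *)
Lemma outer_near_rays y (r : R) u w : 0 < r ->
  (forall z, ball y r z -> C z -> exists2 t : R, 0 <= t &
     z = (y.1 + t * u.1, y.2 + t * u.2) \/ z = (y.1 + t * w.1, y.2 + t * w.2)) ->
  outer y -> \forall z \near y, C z -> outer z.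
Proof.
move=> r0 HC; have [k0|k0] := eqVneq (u.1 * w.2 - u.2 * w.1) 0; last exact: outer_near_angle HC.
have [u0|u0] := eqVneq u (0, 0).
  have [w0|w0] := eqVneq w (0, 0).
    apply: (@outer_near_line y r 1 0) => //.
      by apply/eqP => -[] /eqP; rewrite oner_eq0.
    by move=> z Bz Cz; have [t t0 [->|->]] := HC z Bz Cz; rewrite ?u0 ?w0 /= !mulr0 !addr0 subrr mulr0 mul0r addr0.
  apply: (@outer_near_line y r (- w.2) w.1) => //.
    apply: contraNneq w0 => -[] /eqP; rewrite oppr_eq0 => /eqP w2 w1.
    by rewrite [w]surjective_pairing w1 w2.
  move=> z Bz Cz; have [t t0 [->|->]] := HC z Bz Cz; rewrite ?u0 /=; ring.
apply: (@outer_near_line y r (- u.2) u.1) => //.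
  apply: contraNneq u0 => -[] /eqP; rewrite oppr_eq0 => /eqP w2 w1.
  by rewrite [u]surjective_pairing w1 w2.
move=> z Bz Cz; have [t t0 [->|->]] := HC z Bz Cz; rewrite /=; first by ring.
have -> : - u.2 * (y.1 + t * w.1 - y.1) + u.1 * (y.2 + t * w.2 - y.2) = t * (u.1 * w.2 - u.2 * w.1) by ring.
by rewrite k0 mulr0.
Qed.

End Curve.
End PolygonTopology.

(** * Simple closed polygons *)

Section Polygons.
Context {R : realType}.
Local Notation pt := (plane R).
Local Notation mpt := (measurableTypeR R * measurableTypeR R)%type.
Local Notation mu := (@plane_measure R).
Implicit Types (x y z u w : pt) (e : pt * pt) (D : set pt) (vs : seq pt).

Lemma edges_nth vs e : e \in edges vs -> exists2 i, (i < size vs)%N &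
  e = (nth 0 vs i, nth 0 (rot 1 vs) i).
Proof.
move=> /(nthP (0 : pt, 0 : pt)) [i]; rewrite size_zip size_rot minnn => iv <-.
by exists i => //; rewrite nth_zip // size_rot.
Qed.

Lemma edges_vertices vs e : e \in edges vs -> e.1 \in vs /\ e.2 \in vs.
Proof.
move=> /edges_nth [i iv ->] /=; split; first exact: mem_nth.
by rewrite -(mem_rot 1) mem_nth // size_rot.
Qed.

Lemma edges_inj1 vs e e' : uniq vs -> e \in edges vs -> e' \in edges vs ->
  e.1 = e'.1 -> e = e'.
Proof.
move=> uv /edges_nth [i iv ->] /edges_nth [j jv ->] /= /eqP.
by rewrite nth_uniq // => /eqP ->.
Qed.

Lemma edges_inj2 vs e e' : uniq vs -> e \in edges vs -> e' \in edges vs ->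
  e.2 = e'.2 -> e = e'.
Proof.
move=> uv /edges_nth [i iv ->] /edges_nth [j jv ->] /= /eqP.
by rewrite nth_uniq ?rot_uniq ?size_rot // => /eqP ->.
Qed.

Lemma edges_neq vs e : (1 < size vs)%N -> uniq vs -> e \in edges vs -> e.1 != e.2.
Proof.
case: vs => [//|v s] s1 uv /edges_nth [i iv ->] /=; rewrite rot1_cons.
rewrite nth_rcons; case: ifP => [is_|/negbT]; last first.
  rewrite -leqNgt => si; have -> : i = size s by apply/eqP; rewrite eqn_leq si -ltnS iv.
  rewrite eqxx; apply/eqP => h; have : nth 0 (v :: s) (size s) == nth 0 (v :: s) 0 by rewrite h.
  by rewrite nth_uniq //; move: s1; case: (s).
have -> : nth 0 s i = nth 0 (v :: s) i.+1 by [].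
by rewrite nth_uniq // neq_ltn ltnSn.
Qed.

Lemma vertices_propagate vs (P : pt -> Prop) :
  (forall e, e \in edges vs -> (P e.1 <-> P e.2)) ->
  forall v v', v \in vs -> v' \in vs -> P v -> P v'.
Proof.
move=> H; case: vs H => [//|v0 s] H.
have key i : (i < size (v0 :: s))%N -> P (nth 0 (v0 :: s) i) <-> P v0.
  elim: i => [//|i IH] isv; rewrite -IH; last exact: ltnW.
  have ei : (nth 0 (v0 :: s) i, nth 0 (v0 :: s) i.+1) \in edges (v0 :: s).
    apply/(nthP (0 : pt, 0 : pt)); exists i; first by rewrite size_zip size_rot minnn ltnW.
    rewrite nth_zip ?size_rot // rot1_cons nth_rcons; move: isv; rewrite /= ltnS => ->.
    by [].
  by have := H _ ei => /= h; split => ?; apply/h.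
move=> v v' /(nthP 0) [i iv <-] /(nthP 0) [j jv <-] h.
by apply/key => //; apply/(key i).
Qed.

Lemma near_all_seq (T : eqType) (s : seq T) (P : T -> pt -> Prop) y :
  (forall c, c \in s -> \forall z \near y, P c z) ->
  \forall z \near y, forall c, c \in s -> P c z.
Proof.
elim: s => [|a s IH] H; first by apply: filterE.
have h1 := H a (mem_head _ _).
have h2 : \forall z \near y, forall c, c \in s -> P c z.
  by apply: IH => c cs; apply: H; rewrite inE cs orbT.
apply: filterS2 h1 h2 => z Pa Ps c; rewrite inE => /orP[/eqP ->//|]; exact: Ps.
Qed.

(** Finitely many closed edges: near y only those through y remain. If y is inside an edge,
    simplicity leaves that edge alone, with two opposite rays; otherwise at most one edge starts and
    at most one ends at y, the vertices being distinct. *)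
Lemma polygon_rays D vs y : polygon D vs -> boundary D y ->
  exists u w, exists2 r : R, 0 < r & forall z, ball y r z -> boundary D z ->
   exists2 t : R, 0 <= t &
     z = (y.1 + t * u.1, y.2 + t * u.2) \/ z = (y.1 + t * w.1, y.2 + t * w.2).
Proof.
move=> [_ _ _ [_ uv simple] ->] _.
have : \forall z \near y, forall e, e \in edges vs -> segment e z -> segment e y.
  apply: near_all_seq => e _.
  have [ey|ney] := pselect (segment e y); first by apply: filterE.
  have : open_nbhs y (~` segment e) by split=> //; apply: closed_openC; exact: segment_closed.
  by move/open_nbhs_nbhs; apply: filterS => z nz /nz.
move=> /nbhs_ballP [r /= r0 Hr].
have [[e0 [e0v e0y [y1 y2]]]|none] := pselect (exists e0, [/\ e0 \in edges vs, segment e0 y & y <> e0.1 /\ y <> e0.2]).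
  exists (e0.2 - y), (e0.1 - y); exists r => // z Bz [e ev ez].
  have ey := Hr z Bz e ev ez.
  have ee0 : e = e0.
    apply/eqP; apply: contrapT => /negP ne.
    by have [_ [|]] := simple e e0 ev e0v ne y ey e0y.
  subst e; move: e0y => /segmentP [s0 /andP[s00 s01] ys0].
  move: ez => /segmentP [s /andP[s0' s1'] zs].
  have s0p : 0 < s0.
    rewrite lt_neqAle s00 andbT; apply/eqP => h; apply: y1.
    by rewrite -ys0 -h /on_edge scale0r addr0.
  have s0l : s0 < 1.
    rewrite lt_neqAle s01 andbT; apply/eqP => h; apply: y2.
    by rewrite -ys0 h /on_edge scale1r addrC subrK.
  have [ss0|ss0] := leP s0 s.
    exists ((s - s0) / (1 - s0)); first by rewrite divr_ge0 // subr_ge0 // ltW.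
    left; rewrite -zs -ys0 !on_edgeE /=; apply: (@pair_equal_spec _ _ _ _ _ _).2.
    by split; field; rewrite gt_eqF // subr_gt0.
  exists ((s0 - s) / s0); first by rewrite divr_ge0 // subr_ge0 ltW.
  right; rewrite -zs -ys0 !on_edgeE /=; apply: (@pair_equal_spec _ _ _ _ _ _).2.
  by split; field; rewrite gt_eqF.
have endp e : e \in edges vs -> segment e y -> e.1 = y \/ e.2 = y.
  move=> ev ey; apply: contrapT => /not_orP [h1 h2]; apply: none; exists e; split => //.
  by split => h; [apply: h1|apply: h2].
have [u Hu] : exists u, forall e, e \in edges vs -> e.1 = y -> u = e.2 - y.
  have [[e1 [e1v e1y]]|nx] := pselect (exists e, e \in edges vs /\ e.1 = y).
    exists (e1.2 - y) => e ev ey; congr (_.2 - _).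
    by apply: (edges_inj1 uv) => //; rewrite ey.
  by exists 0 => e ev ey; exfalso; apply: nx; exists e.
have [w Hw] : exists w, forall e, e \in edges vs -> e.2 = y -> w = e.1 - y.
  have [[e1 [e1v e1y]]|nx] := pselect (exists e, e \in edges vs /\ e.2 = y).
    exists (e1.1 - y) => e ev ey; congr (_.1 - _).
    by apply: (edges_inj2 uv) => //; rewrite ey.
  by exists 0 => e ev ey; exfalso; apply: nx; exists e.
exists u, w; exists r => // z Bz [e ev ez].
have ey := Hr z Bz e ev ez.
move: ez => /segmentP [s /andP[s0 s1] <-].
case: (endp e ev ey) => h.
  exists s => //; left; rewrite (Hu e ev h) on_edgeE /= -h //.
exists (1 - s); first by rewrite subr_ge0.
right; rewrite (Hw e ev h) on_edgeE /= -h.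
by apply: (@pair_equal_spec _ _ _ _ _ _).2; split; ring.
Qed.

Lemma polygon_bounded D : bounded_set D -> exists2 M : R, 0 < M & D `<=` square M.
Proof.
move=> [B [_ HB]]; exists (`|B| + 1); first by rewrite ltr_wpDl.
move=> x Dx; have := HB (`|B| + 1) _ x Dx.
rewrite (le_lt_trans (ler_norm B)) ?ltrDl // => /(_ isT) /=.
by rewrite /Num.norm /= ge_max => /andP h; apply/squareE.
Qed.

Lemma square_closed M : closed (square M : set pt).
Proof. by apply: compact_closed; [exact: norm_hausdorff|exact: square_compact]. Qed.

(* By [outer_near_rays], being adherent to the exterior is an open and closed
   condition along the boundary curve; were it to fail somewhere it would fail
   everywhere, and the closure of D would be open. *)
Lemma polygon_interior_closure D vs : polygon D vs -> (closure D)° `<=` D.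
Proof.
move=> pD y0 iy0; apply: contrapT => nDy0.
have [oD [d0 Dd0] bD [sz uv simple] CE] := pD.
have Cy0 : boundary D y0.
  by split; [exact: interior_subset iy0|move/interior_subset].
have near_outer y : boundary D y -> outer D y -> \forall z \near y, boundary D z -> outer D z.
  move=> Cy; have [u [w [r r0 Hr]]] := polygon_rays pD Cy.
  exact: (outer_near_rays oD (erefl (boundary D)) r0 Hr).
have edge_outer e x x' : e \in edges vs -> segment e x -> segment e x' ->
    outer D x -> outer D x'.
  move=> ev ex ex' ox.
  have sC z : segment e z -> boundary D z by move=> ez; rewrite CE; exists e.
  (* This set is closed in the edge by the form of [outer] and open in it by [near_outer], so by
     connectedness it is the whole edge. *)
  pose B := segment e `&` outer D.
  have EB : B = segment e.
    apply: (@segment_connected_plane R e); first by exists x.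
    - exists ((fun z => boundary D z -> outer D z)°); first exact: open_interior.
      apply/seteqP; split => z [ez].
        move=> oz; split => //; exact: (near_outer z (sC z ez) oz).
      by move/interior_subset => h; split => //; apply: h; exact: sC.
    - exists (~` (closure D)°) => //.
      by apply: open_closedC; exact: open_interior.
  by have [] : B x' by rewrite EB.
have vert : forall v v', v \in vs -> v' \in vs -> outer D v -> outer D v'.
  apply: vertices_propagate => e ev; split; apply: edge_outer ev _ _;
    by [exact: segment_left|exact: segment_right].
have [e0 e0v e0y] : exists2 e, e \in edges vs & segment e y0 by move: Cy0; rewrite CE.
have [v01 _] := edges_vertices e0v.
have bad z : boundary D z -> (closure D)° z.
  rewrite CE => -[e ev ez]; apply: contrapT => oz.
  have ov : outer D e.1 by apply: edge_outer ev ez _ oz; exact: segment_left.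
  have ov0 : outer D e0.1 by apply: vert ov => //; exact: (edges_vertices ev).1.
  by have := edge_outer _ _ _ e0v (segment_left e0) e0y ov0; apply.
have oclD : open (closure D).
  rewrite openE => z clz; have [Dz|nDz] := pselect (D z).
    apply: (@interiorS _ D); first exact: subset_closure.
    by move: oD; rewrite openE; exact.
  apply: bad; split => // /interior_subset; exact: nDz.
have [M M0 DM] := polygon_bounded bD.
have clM : closure D `<=` square M by rewrite ((closure_id (square M)).1 (@square_closed M)); exact: closure_subset.
(* A nonempty set that is both open and closed is the whole plane, which contradicts boundedness. *)
have : [set: pt] `<=` closure D.
  apply: (@pconvex_dichotomy _ setT (closure D) (~` closure D)) => //.
  - by apply: closed_openC; exact: closed_closure.
  - by rewrite setICr.
  - by move=> z _; have [?|?] := pselect (closure D z); [left|right].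
  - by exists d0; split => //; exact: subset_closure.
move=> /(_ (M + 1, 0) I) /clM /squareE /= [+ _].
by rewrite gtr0_norm ?addr_gt0 // leNgt ltrDl ltr01.
Qed.

(** A vertical segment lies in a null line; any other has vertical sections of at most one point. *)
Lemma segment_null e : mu (segment e) = 0%E.
Proof.
have mS : measurable (segment e : set mpt).
  by rewrite -[segment e]setCK; apply: measurableC; apply: open_measurable_plane; apply: closed_openC; exact: segment_closed.
have [e1|e1] := eqVneq e.1.1 e.2.1.
  have sub : segment e `<=` [set e.1.1] `*` setT.
    by move=> x /segmentP [s _ <-]; rewrite on_edgeE e1 subrr mulr0 addr0; split.
  have m1 : measurable ([set e.1.1] `*` setT : set mpt) by apply: measurableX.
  have E0 : mu ([set e.1.1] `*` setT : set mpt) = 0%E.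
    rewrite /plane_measure /= product_measure1E //.
    by rewrite [X in (X * _)%E]lebesgue_measure_set1 mul0e.
  by apply/eqP; rewrite -measure_le0 -E0; apply: le_measure; rewrite ?inE.
have -> : mu (segment e) = (\int[@lebesgue_measure R]_x lebesgue_measure (xsection (segment e : set mpt) x))%E by [].
rewrite integral0_eq // => x _.
pose s := (x - e.1.1) / (e.2.1 - e.1.1).
have sub : xsection (segment e) x `<=` [set e.1.2 + s * (e.2.2 - e.1.2)].
  move=> y; rewrite /xsection /= inE => /segmentP [t _ h].
  have [h1 h2] : e.1.1 + t * (e.2.1 - e.1.1) = x /\ e.1.2 + t * (e.2.2 - e.1.2) = y.
    by move: h; rewrite on_edgeE => -[-> ->].
  have d0 : e.2.1 - e.1.1 != 0 by rewrite subr_eq0 eq_sym.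
  by rewrite -h2 /s -h1 /=; congr (_ + _ * _); field.
apply/eqP; rewrite -measure_le0; rewrite -(lebesgue_measure_set1 (e.1.2 + s * (e.2.2 - e.1.2))).
by apply: le_measure; rewrite ?inE //; exact: measurable_xsection.
Qed.

End Polygons.

(** * The gap between a polygon and a curved boundary *)

Section ConvexGeometry.
Context {R : realType}.
Local Notation pt := (plane R).
Implicit Types (x y z u v w a b n : pt) (D K Omega : set pt) (rho : pt -> R).

Lemma mvt_bound (f df : R -> R) (g ep s t : R) :
  (forall x : R, is_derive x 1 f (df x)) ->
  (forall x : R, Num.min s t <= x <= Num.max s t -> `|df x - g| <= ep) ->
  `|f t - f s - g * (t - s)| <= ep * `|t - s|.
Proof.
move=> dF Hg.
have key (p q : R) : p <= q -> (forall x : R, p <= x <= q -> `|df x - g| <= ep) ->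
    `|f q - f p - g * (q - p)| <= ep * `|q - p|.
  move=> pq H.
  have cf : {within `[p, q], continuous f}.
    apply: continuous_subspaceT => x; apply: differentiable_continuous.
    by apply/derivable1_diffP; case: (dF x).
  have [c cpq ->] := MVT_segment pq (fun (x : R) _ => dF x) cf.
  rewrite -mulrBl normrM ler_wpM2r // H //; move: cpq; by rewrite in_itv.
have [st|ts] := leP s t; first by apply: key => // x h; apply: Hg; rewrite min_l // max_r.
have -> : f t - f s - g * (t - s) = - (f s - f t - g * (s - t)) by ring.
rewrite normrN [X in _ <= _ * X]distrC; apply: key; first exact: ltW.
by move=> x h; apply: Hg; rewrite min_r ?max_l ?(ltW ts).
Qed.

(** The path from v to u runs parallel to the axes through (v.1, u.2), which stays in the ball of
    the maximum norm; on each leg the mean value theorem meets a nearly constant partial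
    derivative. *)
Lemma strict_differentiability rho z (ep : R) : Cinfty rho -> 0 < ep ->
  exists2 r : R, 0 < r & forall u v, ball z r u -> ball z r v ->
    `|rho u - rho v - (pd false rho z * (u.1 - v.1) + pd true rho z * (u.2 - v.2))| <=
      ep * (`|u.1 - v.1| + `|u.2 - v.2|).
Proof.
move=> Cr e0.
have nr (b : bool) : \forall x \near z, `|pd b rho x - pd b rho z| <= ep.
  have := Cinfty_continuous (Cinfty_pd b Cr) (x := z).
  by move=> /cvgr_dist_le /(_ ep e0); apply: filterS => x; rewrite distrC.
have : nbhs z [set x | `|pd false rho x - pd false rho z| <= ep /\ `|pd true rho x - pd true rho z| <= ep].
  by apply: filterS2 (nr false) (nr true) => x.
move=> /nbhs_ballP [r /= r0 Hr].
exists r => // u v [u1 u2] [v1 v2].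
have btw (c s t x : R) : `|c - s| < r -> `|c - t| < r -> Num.min s t <= x <= Num.max s t -> `|c - x| < r.
  rewrite !ltr_distlC => h1 h2; rewrite ge_min le_max => /andP[/orP h3 /orP h4].
  by case: h3 => h3; case: h4 => h4; lra.
have h1 : `|rho (u.1, u.2) - rho (v.1, u.2) - pd false rho z * (u.1 - v.1)| <= ep * `|u.1 - v.1|.
  apply: (@mvt_bound (fun t => rho (t, u.2)) (fun t => pd false rho (t, u.2))).
    move=> x; have := @differentiable_slice R false rho u.2 x (fun y => Cinfty_diff y Cr).
    by move=> /derivableP; rewrite -derive1E (pd_false_slice rho (x, u.2)).
  move=> x h; apply: (Hr (x, u.2) _).1; apply/ballE; split=> //=.
  exact: btw v1 u1 h.
have h2 : `|rho (v.1, u.2) - rho (v.1, v.2) - pd true rho z * (u.2 - v.2)| <= ep * `|u.2 - v.2|.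
  apply: (@mvt_bound (fun t => rho (v.1, t)) (fun t => pd true rho (v.1, t))).
    move=> x; have := @differentiable_slice R true rho v.1 x (fun y => Cinfty_diff y Cr).
    by move=> /derivableP; rewrite -derive1E (pd_true_slice rho (v.1, x)).
  move=> x h; apply: (Hr (v.1, x) _).2; apply/ballE; split=> //=.
  exact: btw v2 u2 h.
have E : rho u - rho v - (pd false rho z * (u.1 - v.1) + pd true rho z * (u.2 - v.2)) =
   (rho (u.1, u.2) - rho (v.1, u.2) - pd false rho z * (u.1 - v.1)) +
   (rho (v.1, u.2) - rho (v.1, v.2) - pd true rho z * (u.2 - v.2)).
  rewrite -!surjective_pairing.
  have R4 (A B C X Y : R) : A - B - (X + Y) = (A - C - X) + (C - B - Y) by ring.
  exact: R4.
rewrite E [X in _ <= X]mulrDr.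
exact: le_trans (ler_normD _ _) (lerD h1 h2).
Qed.

Lemma convex_closure D x y (t : R) : convex_set D -> closure D x -> closure D y ->
  0 <= t <= 1 -> closure D (x.1 + t * (y.1 - x.1), x.2 + t * (y.2 - x.2)).
Proof.
move=> cD cx cy /andP[t0 t1] B /nbhs_ballP [r /= r0 rB].
have [x' [Dx' bx']] := cx _ (nbhsx_ballx x r r0).
have [y' [Dy' by']] := cy _ (nbhsx_ballx y r r0).
exists (x'.1 + t * (y'.1 - x'.1), x'.2 + t * (y'.2 - x'.2)); split.
  have := cD y' x' (Itv01 t0 t1); rewrite !inE => /(_ Dy' Dx').
  have tr (w w' : pt) : w = w' -> D w -> D w' by move=> ->.
  move=> H; apply: (tr _ _ _ H).
  apply: (@pair_equal_spec _ _ _ _ _ _).2.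
  by rewrite /= /GRing.scale /=; split; rewrite ?/unstable.onem; ring.
apply: rB.
have key (p p' q q' : R) : `|p - p'| < r -> `|q - q'| < r ->
    `|p + t * (q - p) - (p' + t * (q' - p'))| < r.
  move=> k k'; have -> : p + t * (q - p) - (p' + t * (q' - p')) = (1 - t) * (p - p') + t * (q - q') by ring.
  apply: le_lt_trans (ler_normD _ _) _; rewrite !normrM (ger0_norm t0) ger0_norm ?subr_ge0 //.
  move: k k'; set A := `|p - p'|; set B' := `|q - q'| => k k'.
  have [s1'|s1'] := eqVneq t 1; first by rewrite s1'; lra.
  have : 0 < 1 - t by rewrite subr_gt0 lt_neqAle s1'.
  by nra.
by move: bx' by' => [x1 x2] [y1 y2]; apply/ballE; split; exact: key.
Qed.

(* For a chord ab of a convex domain whose boundary is differentiable at z, with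
   both end points near z, the tangent line nearly contains the chord; a
   neighbouring interior point on the side of -n fixes the sign of n, and the
   supporting half-plane then bounds the height of the domain over the chord. *)
Lemma local_height Omega z (q c0 ep : R) : smooth_convex_domain Omega ->
  boundary Omega z -> 0 < q -> 0 < c0 -> 0 < ep ->
  \forall a \near z & h \near 0^'+, boundary Omega a ->
    forall b y x0 n (s d : R), boundary Omega b -> closure Omega y -> Omega x0 ->
    b != a -> `|b.1 - a.1| <= q * h -> `|b.2 - a.2| <= q * h ->
    `|x0.1 - a.1| <= q * h -> `|x0.2 - a.2| <= q * h ->
    n.1 ^+ 2 + n.2 ^+ 2 = 1 -> n.1 * (b.1 - a.1) + n.2 * (b.2 - a.2) = 0 ->
    n.1 * (x0.1 - a.1) + n.2 * (x0.2 - a.2) <= - (c0 * h) ->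
    0 <= s <= 1 -> 0 <= d ->
    y = (a.1 + s * (b.1 - a.1) + d * n.1, a.2 + s * (b.2 - a.2) + d * n.2) ->
    d <= ep * h.
Proof.
move=> [oO O0 bO cO smooth] bz q0 c00 e0.
have [U [rho [[oU Uz] Cr gz DU bU]]] := smooth z bz.
set g1 := pd false rho z in gz; set g2 := pd true rho z in gz.
have gg0 : 0 < g1 ^+ 2 + g2 ^+ 2.
  rewrite lt_neqAle eq_sym addr_ge0 ?sqr_ge0 // andbT.
  move: (g1) (g2) gz => p p' gz.
  apply/eqP => /eqP; rewrite paddr_eq0 ?sqr_ge0 // !sqrf_eq0 => /andP[/eqP h1 /eqP h2].
  by apply: gz; rewrite h1 h2.
pose G := Num.sqrt (g1 ^+ 2 + g2 ^+ 2).
have G0 : 0 < G by rewrite sqrtr_gt0.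
have GE : G ^+ 2 = g1 ^+ 2 + g2 ^+ 2 by rewrite sqr_sqrtr // ltW.
(* [G] is the length of the gradient of rho at z. The first bound makes the gradient nearly parallel
   to n and absorbs the errors proportional to d, the second decides the sign of [gn], the third
   yields the final ep. *)
pose e1 := Num.min (G / 8) (Num.min (G * c0 / (16 * q)) (ep * G / 2 / (16 * q))).
have q16 : 0 < 16 * q by rewrite mulr_gt0.
have e10 : 0 < e1.
  by rewrite !lt_min !divr_gt0 ?mulr_gt0.
have e1a : e1 <= G / 8 by rewrite ge_min lexx.
have e1b : e1 * (16 * q) <= G * c0 by rewrite -ler_pdivlMr // !ge_min lexx orbT.
have e1c : e1 * (16 * q) <= ep * G / 2 by rewrite -ler_pdivlMr // !ge_min lexx !orbT.
have [r r0 Hr] := strict_differentiability z Cr e10; rewrite -/g1 -/g2 in Hr.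
have /nbhs_ballP [r' /= r'0 Hr'] : nbhs z U by apply: open_nbhs_nbhs.
pose r1 := Num.min r r'.
have r10 : 0 < r1 by rewrite lt_min r0 r'0.
have bU' x : ball z r1 x -> U x.
  by move=> [x1 x2]; apply: Hr'; split; [apply: lt_le_trans x1 _|apply: lt_le_trans x2 _]; rewrite ge_min lexx orbT.
have br x : ball z r1 x -> ball z r x.
  by move=> [x1 x2]; split; [apply: lt_le_trans x1 _|apply: lt_le_trans x2 _]; rewrite ge_min lexx.
have rho0 x : ball z r1 x -> boundary Omega x -> rho x = 0.
  move=> bx Ox; have : (boundary Omega `&` U) x by split => //; exact: bU'.
  by rewrite bU => -[].
have rhoneg x : ball z r1 x -> Omega x -> rho x < 0.
  move=> bx Ox; have : (Omega `&` U) x by split => //; exact: bU'.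
  by rewrite DU => -[].
have rhole x : ball z r1 x -> closure Omega x -> rho x <= 0.
  move=> bx clx; have [Ox|nOx] := pselect (Omega x); first exact: ltW (rhoneg x bx Ox).
  by rewrite rho0 //; split => // /interior_subset; exact: nOx.
exists (ball z (r1 / 2), [set h : R | 0 < h /\ q * h < r1 / 2]).
  split; first by apply: nbhsx_ballx; rewrite divr_gt0.
  apply: filterI; first exact: nbhs_right_gt.
  have : \forall h \near 0^'+, h < r1 / 2 / q by apply: nbhs_right_lt; rewrite !divr_gt0.
  by apply: filterS => h; rewrite ltr_pdivlMr // mulrC.
move=> [a h] [/= ba [h0 qh]] Oa b y x0 n s d Ob cly Ox0 ban b1 b2 x1 x2 n1 nab nx0 /andP[s0 s1] d0 yE.
have nearA x : `|x.1 - a.1| <= q * h -> `|x.2 - a.2| <= q * h -> ball z r1 x.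
  move=> k1 k2; move: ba => [k3 k4]; rewrite /ball /= in k3 k4.
  have key (p p' p'' : R) : `|p'' - p| < r1 / 2 -> `|p' - p| <= q * h -> `|p'' - p'| < r1.
    move=> k5 k6; have -> : p'' - p' = (p'' - p) - (p' - p) by ring.
    by apply: le_lt_trans (ler_normB _ _) _; rewrite [r1]splitr; apply: ltr_leD => //; rewrite (le_trans k6) ?ltW.
  by apply/ballE; split; [exact: key k3 k1|exact: key k4 k2].
have bA : ball z r1 a by apply: nearA; rewrite subrr normr0 mulr_ge0 // ltW.
have bB := nearA b b1 b2; have bX := nearA x0 x1 x2.
have ra := rho0 a bA Oa; have rb := rho0 b bB Ob; have rx := rhoneg x0 bX Ox0.
have n1le : `|n.1| <= 1.
  rewrite -(@ler_pXn2r _ 2) ?nnegrE // real_normK ?num_real // expr1n -n1.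
  by rewrite lerDl sqr_ge0.
have n2le : `|n.2| <= 1.
  rewrite -(@ler_pXn2r _ 2) ?nnegrE // real_normK ?num_real // expr1n -n1.
  by rewrite lerDr sqr_ge0.
(* The components of the gradient along n and along the unit vector (-n.2, n.1) parallel to the
   chord. *)
pose gn := g1 * n.1 + g2 * n.2; pose gp := g2 * n.1 - g1 * n.2.
have gngp : gn ^+ 2 + gp ^+ 2 = G ^+ 2.
  transitivity ((g1 ^+ 2 + g2 ^+ 2) * (n.1 ^+ 2 + n.2 ^+ 2)); first by rewrite /gn /gp; ring.
  by rewrite n1 mulr1 GE.
have decomp (v1 v2 : R) : g1 * v1 + g2 * v2 = gn * (n.1 * v1 + n.2 * v2) + gp * (n.1 * v2 - n.2 * v1).
  transitivity ((g1 * v1 + g2 * v2) * (n.1 ^+ 2 + n.2 ^+ 2)); first by rewrite n1 mulr1.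
  by rewrite /gn /gp; ring.
(* Both ends of the chord are zeros of rho, so strict differentiability makes the derivative along
   the chord small; dividing by its length uses that the ends differ. *)
have gp_small : `|gp| <= 2 * e1.
  have := Hr b a (br _ bB) (br _ bA); rewrite ra rb subrr sub0r normrN decomp nab mulr0 add0r.
  set d1 := b.1 - a.1; set d2 := b.2 - a.2; set lam := n.1 * d2 - n.2 * d1.
  have e_d1 : d1 = - n.2 * lam.
    transitivity (d1 * (n.1 ^+ 2 + n.2 ^+ 2) - n.1 * (n.1 * d1 + n.2 * d2)); last by rewrite /lam; ring.
    by rewrite n1 nab mulr0 subr0 mulr1.
  have e_d2 : d2 = n.1 * lam.
    transitivity (d2 * (n.1 ^+ 2 + n.2 ^+ 2) - n.2 * (n.1 * d1 + n.2 * d2)); last by rewrite /lam; ring.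
    by rewrite n1 nab mulr0 subr0 mulr1.
  have lam0 : 0 < `|lam|.
    rewrite normr_gt0; apply: contraNneq ban => l0.
    rewrite [b]surjective_pairing [a]surjective_pairing; apply/eqP.
    apply: (@pair_equal_spec _ _ _ _ _ _).2.
    by split; apply/eqP; rewrite -subr_eq0 -/d1 -/d2 ?e_d1 ?e_d2 l0 mulr0.
  have l1 : `|d1| <= `|lam| by rewrite e_d1 normrM normrN ler_piMl.
  have l2 : `|d2| <= `|lam| by rewrite e_d2 normrM ler_piMl.
  rewrite normrM => H; rewrite -(ler_pM2r lam0); apply: le_trans H _.
  have -> : 2 * e1 * `|lam| = e1 * (`|lam| + `|lam|) by ring.
  by rewrite ler_pM2l // lerD.
have gn_big : G / 2 <= `|gn|.
  rewrite -(@ler_pXn2r _ 2) ?nnegrE ?divr_ge0 ?(ltW G0) // real_normK ?num_real //.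
  have : gp ^+ 2 <= (G / 4) ^+ 2.
    rewrite -real_normK ?num_real // ler_pXn2r ?nnegrE ?divr_ge0 ?(ltW G0) //.
    apply: le_trans gp_small _; rewrite (_ : G / 4 = 2 * (G / 8)); first by rewrite ler_pM2l.
    by field.
  have -> : gn ^+ 2 = G ^+ 2 - gp ^+ 2 by rewrite -gngp; ring.
  have -> : (G / 4) ^+ 2 = G ^+ 2 / 16 by field.
  have -> : (G / 2) ^+ 2 = G ^+ 2 / 4 by field.
  have := sqr_ge0 G; move: (G ^+ 2) (gp ^+ 2); clear=> A B *; lra.
(* Were [gn] negative, rho would exceed its value 0 at a by about G c0 h / 2 at x0, up to smaller
   errors, although rho is negative in the domain. *)
have gn_pos : 0 < gn.
  rewrite ltNge; apply/negP => gn0; rewrite ler0_norm // in gn_big.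
  have := Hr x0 a (br _ bX) (br _ bA); rewrite ra subr0 decomp => H.
  have h1 : G / 2 * (c0 * h) <= gn * (n.1 * (x0.1 - a.1) + n.2 * (x0.2 - a.2)).
    by rewrite -[X in _ <= X]mulrNN ler_pM ?divr_ge0 ?mulr_ge0 ?(ltW G0) ?(ltW c00) ?(ltW h0) // lerNr.
  have h2 : `|gp * (n.1 * (x0.2 - a.2) - n.2 * (x0.1 - a.1))| <= 2 * e1 * (2 * (q * h)).
    rewrite normrM ler_pM // (le_trans (ler_normB _ _)) // !normrM mulr_natl mulr2n.
    by apply: lerD; [apply: le_trans x2|apply: le_trans x1]; rewrite ler_piMl.
  have h3 : e1 * (`|x0.1 - a.1| + `|x0.2 - a.2|) <= e1 * (2 * (q * h)).
    by rewrite ler_pM2l // mulr_natl mulr2n lerD.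
  have h4 : e1 * (16 * q) * h <= G * c0 * h by rewrite ler_pM2r.
  move: h2; rewrite ler_norml => /andP[h2 _].
  move: H; rewrite ler_distl => /andP[H _].
  have h8 : e1 * (2 * (q * h)) = e1 * (16 * q) * h / 8 by field.
  have h9 : 2 * e1 * (2 * (q * h)) = e1 * (16 * q) * h / 4 by field.
  have h10 : 0 < G * c0 * h by rewrite !mulr_gt0.
  have h11 : G / 2 * (c0 * h) = G * c0 * h / 2 by field.
  rewrite h8 in h3; rewrite h9 in h2; rewrite h11 in h1.
  have key (A B V W Z r3 : R) : Z / 2 <= A -> V <= W / 8 -> - (W / 4) <= B -> W <= Z ->
      0 < Z -> A + B - V <= r3 -> r3 < 0 -> False.
    by clear=> *; lra.
  exact: key h1 h3 h2 h4 h10 H rx.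
rewrite gtr0_norm // in gn_big.
(* The point y may be far from a. A point w of the segment from a to y close to a lies in the
   closure by convexity, so rho w <= 0; the resulting inequality is homogeneous in w - a and hence
   holds for y - a. *)
have support : g1 * (y.1 - a.1) + g2 * (y.2 - a.2) <= e1 * (`|y.1 - a.1| + `|y.2 - a.2|).
  have nb : nbhs a (ball z r1) by apply: open_nbhs_nbhs; split => //; exact: ball_open.
  have [t1 t10 bt1] := near_push (y - a) nb.
  pose t := Num.min t1 1.
  have t0 : 0 < t by rewrite lt_min t10 ltr01.
  have tl : t <= 1 by rewrite ge_min lexx orbT.
  pose w : pt := (a.1 + t * (y.1 - a.1), a.2 + t * (y.2 - a.2)).
  have bw : ball z r1 w.
    have sw : segment (a, (a.1 + t1 * (y - a).1, a.2 + t1 * (y - a).2)) w.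
      apply/segmentP; exists (t / t1).
        by rewrite divr_ge0 ?(ltW t0) ?(ltW t10) // ler_pdivrMr // mul1r ge_min lexx.
      rewrite on_edgeE /w /=; apply: (@pair_equal_spec _ _ _ _ _ _).2.
      by split; field; rewrite gt_eqF.
    exact: (@pconvex_ball _ z r1 _ _ bA bt1).
  have cw : closure Omega w.
    by apply: convex_closure cO Oa.1 cly _; rewrite ltW.
  have rw := rhole w bw cw.
  have := Hr w a (br _ bw) (br _ bA); rewrite ra subr0 /w /=.
  have E (p : R) : a.1 + t * p - a.1 = t * p by ring.
  have E2 (p : R) : a.2 + t * p - a.2 = t * p by ring.
  rewrite E E2 !normrM (gtr0_norm t0) ler_distl => /andP[H _].
  have H2 : t * (g1 * (y.1 - a.1) + g2 * (y.2 - a.2)) <= t * (e1 * (`|y.1 - a.1| + `|y.2 - a.2|)).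
    rewrite -/w in H; rewrite mulrDr mulrCA (mulrCA t g2).
    rewrite (_ : t * (e1 * _) = e1 * (t * `|y.1 - a.1| + t * `|y.2 - a.2|)); last by ring.
    have key (A B C r3 : R) : A - B <= r3 -> r3 <= 0 -> A <= B by clear=> *; lra.
    exact: key H rw.
  by rewrite ler_pM2l in H2.
have gy : g1 * (y.1 - a.1) + g2 * (y.2 - a.2) = s * (gp * (n.1 * (b.2 - a.2) - n.2 * (b.1 - a.1))) + d * gn.
  have E1 : y.1 - a.1 = s * (b.1 - a.1) + d * n.1 by rewrite yE /=; ring.
  have E2 : y.2 - a.2 = s * (b.2 - a.2) + d * n.2 by rewrite yE /=; ring.
  rewrite E1 E2; transitivity (s * (g1 * (b.1 - a.1) + g2 * (b.2 - a.2)) + d * gn); first by rewrite /gn; ring.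
  by rewrite decomp nab mulr0 add0r.
have yl : `|y.1 - a.1| + `|y.2 - a.2| <= 2 * (q * h) + 2 * d.
  have key (p m : R) : `|p| <= q * h -> `|m| <= 1 -> `|s * p + d * m| <= q * h + d.
    move=> k1 k2; apply: le_trans (ler_normD _ _) _; rewrite !normrM (ger0_norm s0) (ger0_norm d0).
    by apply: lerD; [apply: le_trans k1; rewrite ler_piMl|rewrite ler_piMr].
  have E1 : y.1 - a.1 = s * (b.1 - a.1) + d * n.1 by rewrite yE /=; ring.
  have E2 : y.2 - a.2 = s * (b.2 - a.2) + d * n.2 by rewrite yE /=; ring.
  have -> : 2 * (q * h) + 2 * d = (q * h + d) + (q * h + d) by ring.
  by apply: lerD; [rewrite E1; exact: key b1 n1le|rewrite E2; exact: key b2 n2le].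
have sb : - (2 * e1 * (2 * (q * h))) <= s * (gp * (n.1 * (b.2 - a.2) - n.2 * (b.1 - a.1))).
  have : `|s * (gp * (n.1 * (b.2 - a.2) - n.2 * (b.1 - a.1)))| <= 2 * e1 * (2 * (q * h)).
    rewrite normrM (ger0_norm s0) -[X in _ <= X]mul1r ler_pM // normrM ler_pM //.
    rewrite (le_trans (ler_normB _ _)) // !normrM mulr_natl mulr2n.
    by apply: lerD; [apply: le_trans b2|apply: le_trans b1]; rewrite ler_piMl.
  by rewrite ler_norml => /andP[].
have e1yl : e1 * (`|y.1 - a.1| + `|y.2 - a.2|) <= e1 * (2 * (q * h) + 2 * d) by rewrite ler_pM2l.
rewrite gy in support.
have dgn : d * (G / 2) <= d * gn by rewrite ler_wpM2l.
have e1d : e1 * d <= G / 8 * d by rewrite ler_wpM2r.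
have e1ch : e1 * (16 * q) * h <= ep * G / 2 * h by rewrite ler_pM2r.
move: support sb e1yl dgn; set S1 := s * _; set Y := e1 * (`|_| + _); set Dg := d * gn => support sb e1yl dgn.
have h8 : 2 * e1 * (2 * (q * h)) = e1 * (16 * q) * h / 4 by field.
have h9 : e1 * (2 * (q * h) + 2 * d) = e1 * (16 * q) * h / 8 + 2 * (e1 * d) by field.
rewrite h8 in sb; rewrite h9 in e1yl.
have fin : G * d <= G * (ep * h).
  have key (A B Y' W Z E D' : R) : A + B <= Y' -> - (W / 4) <= A -> Y' <= W / 8 + 2 * E -> D' / 2 <= B ->
      E <= D' / 8 -> W <= Z / 2 -> 0 < Z -> D' <= Z by clear=> *; lra.
  have z0 : 0 < G * (ep * h) by rewrite !mulr_gt0.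
  apply: key support sb e1yl _ _ _ z0.
  - by rewrite -mulrA mulrCA.
  - by rewrite mulrAC.
  - by rewrite (_ : G * (ep * h) / 2 = ep * G / 2 * h) //; ring.
by rewrite ler_pM2l in fin.
Qed.

End ConvexGeometry.

(** * Euclidean lengths, star-shaped sets and the uniform height estimate *)

Section MeshGeometry.
Context {R : realType}.
Local Notation pt := (plane R).
Implicit Types (x y z n a b : pt) (e : pt * pt) (D K Omega : set pt) (vs : seq pt).

Lemma enorm_sqr x : enorm x ^+ 2 = x.1 ^+ 2 + x.2 ^+ 2.
Proof. by rewrite sqr_sqrtr /dot -?expr2 // addr_ge0 // sqr_ge0. Qed.

Lemma scale_pairE (c : R) x : c *: x = (c * x.1, c * x.2). Proof. by []. Qed.

Lemma enorm_ge0 x : 0 <= enorm x. Proof. exact: sqrtr_ge0. Qed.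

Lemma enorm_ge x : `|x.1| <= enorm x /\ `|x.2| <= enorm x.
Proof.
have h := enorm_sqr x; have k := enorm_ge0 x.
split; rewrite -(ler_pXn2r (n := 2)) ?nnegrE //; rewrite h real_normK ?num_real //.
  by rewrite lerDl sqr_ge0.
by rewrite lerDr sqr_ge0.
Qed.

Lemma enorm_le x : enorm x <= `|x.1| + `|x.2|.
Proof.
rewrite -(ler_pXn2r (n := 2)) ?nnegrE ?enorm_ge0 ?addr_ge0 // enorm_sqr sqrrD !real_normK ?num_real //.
rewrite -addrA lerD2l lerDr mulrn_wge0 // mulr_ge0 //.
Qed.

Lemma enorm_ball_open x0 (r : R) : open [set x | enorm (x - x0) < r].
Proof.
have c : continuous (fun x => enorm (x - x0)).
  move=> x; rewrite /enorm /dot.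
  apply: (@continuous_comp _ _ _ (fun x => (x - x0).1 * (x - x0).1 + (x - x0).2 * (x - x0).2) (@Num.sqrt R)); last exact: sqrt_continuous.
  have c1 : {for x, continuous (fun x : pt => (x - x0).1)}.
    by apply: (@continuousB _ _ _ (fun x : pt => x.1) (fun=> x0.1)); [exact: cvg_fst|exact: cvg_cst].
  have c2 : {for x, continuous (fun x : pt => (x - x0).2)}.
    by apply: (@continuousB _ _ _ (fun x : pt => x.2) (fun=> x0.2)); [exact: cvg_snd|exact: cvg_cst].
  by apply: continuousD; apply: continuousM.
have /continuousP H := c; exact: (H _ (@open_lt R r)).
Qed.

Lemma le_diam D x y : bounded_set D -> D x -> D y -> enorm (x - y) <= diam D.
Proof.
move=> /polygon_bounded [M M0 DM] Dx Dy; apply: ub_le_sup; last by exists x, y.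
exists (4 * M) => _ [u [v [/DM /squareE [u1 u2] /DM /squareE [v1 v2] ->]]].
apply: (le_trans (enorm_le _)) => /=.
have := ler_normB u.1 v.1; have := ler_normB u.2 v.2; lra.
Qed.

Lemma le_diam_closure D x y : bounded_set D -> closure D x -> closure D y ->
  `|x.1 - y.1| <= diam D /\ `|x.2 - y.2| <= diam D.
Proof.
move=> bD clx cly.
have near_pt z (ep : R) : 0 < ep -> closure D z -> exists z', [/\ D z', `|z.1 - z'.1| < ep & `|z.2 - z'.2| < ep].
  by move=> ep0 /(_ _ (nbhsx_ballx z ep ep0)) [z' [Dz' /ballE [h1 h2]]]; exists z'.
have key (p p' q q' dd ep : R) : `|p - p'| < ep -> `|q - q'| < ep -> `|p' - q'| <= dd -> `|p - q| <= dd + 2 * ep.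
  by move=> h1 h2 h3; have := ler_distD p' p q; have := ler_distD q' p' q; rewrite (distrC q' q); lra.
split; apply/ler_addgt0Pr => ep ep0; have e2 : 0 < ep / 2 by rewrite divr_gt0.
all: have [x' [Dx' x1 x2]] := near_pt _ _ e2 clx; have [y' [Dy' y1 y2]] := near_pt _ _ e2 cly.
all: have [/= k1 k2] := enorm_ge (x' - y'); have k := le_diam bD Dx' Dy'.
all: have -> : ep = 2 * (ep / 2) by field.
  exact: key x1 y1 (le_trans k1 k).
exact: key x2 y2 (le_trans k2 k).
Qed.

(** Approximate y by a point y' of K and shift x to f y' so that the point at parameter t does not
    move; for y' close to y the shifted point is still in the open ball. The shift divides by 1 -
    t. *)
Lemma star_shaped_closure K (r : R) x0 x y (t : R) :
  (forall x y (t : R), enorm (x - x0) < r -> K y -> 0 <= t <= 1 -> K (x + t *: (y - x))) ->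
  enorm (x - x0) < r -> closure K y -> 0 <= t < 1 -> K (x + t *: (y - x)).
Proof.
move=> st xr cly /andP[t0 t1].
have t1' : 1 - t != 0 by rewrite gt_eqF // subr_gt0.
pose f y' := x + (t / (1 - t)) *: (y - y').
have cf : {for y, continuous f}.
  apply: (@continuousD _ _ _ (fun=> x) (fun y' => (t / (1 - t)) *: (y - y'))); first exact: cvg_cst.
  apply: (@continuousZl_tmp _ _ _ (fun y' => y - y') (t / (1 - t))).
  by apply: (@continuousB _ _ _ (fun=> y) id); [exact: cvg_cst|exact: cvg_id].
have /cf : nbhs (f y) [set x | enorm (x - x0) < r].
  by apply: open_nbhs_nbhs; split; [exact: enorm_ball_open|rewrite /f subrr scaler0 addr0].
move=> /cly [y' [Ky' /= fr]].
have := st (f y') y' t fr Ky'; rewrite t0 (ltW t1) => /(_ isT).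
rewrite (_ : f y' + t *: (y' - f y') = x + t *: (y - x)) //.
by apply: (@pair_equal_spec _ _ _ _ _ _).2; rewrite /f /=; split; rewrite /GRing.scale /=; field.
Qed.

Lemma normal_decomposition n (u w : pt) : enorm n = 1 -> dot n u = 0 -> u != 0 ->
  exists s : R, w = s *: u + dot n w *: n.
Proof.
move=> n1 nu u0.
have nn : n.1 ^+ 2 + n.2 ^+ 2 = 1 by rewrite -enorm_sqr n1 expr1n.
pose p := n.1 * u.2 - n.2 * u.1.
have u1 : u.1 = - p * n.2.
  rewrite -[LHS]mul1r -nn; move: nu; rewrite /dot /p => nu.
  by apply/eqP; rewrite -subr_eq0; apply/eqP; transitivity (n.1 * (n.1 * u.1 + n.2 * u.2)); [ring|rewrite nu mulr0].
have u2 : u.2 = p * n.1.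
  rewrite -[LHS]mul1r -nn; move: nu; rewrite /dot /p => nu.
  by apply/eqP; rewrite -subr_eq0; apply/eqP; transitivity (n.2 * (n.1 * u.1 + n.2 * u.2)); [ring|rewrite nu mulr0].
have p0 : p != 0.
  apply: contra_neq u0 => p0.
  by rewrite [LHS]surjective_pairing u1 u2 p0 oppr0 !mul0r.
clearbody p; pose s := (n.1 * w.2 - n.2 * w.1) / p.
have E1 : w.1 = s * u.1 + dot n w * n.1.
  by rewrite u1 -[LHS]mul1r -nn /s /dot; field; exact: p0.
have E2 : w.2 = s * u.2 + dot n w * n.2.
  by rewrite u2 -[LHS]mul1r -nn /s /dot; field; exact: p0.
exists s; rewrite [LHS]surjective_pairing.
by apply: (@pair_equal_spec _ _ _ _ _ _).2; split; [exact: E1|exact: E2].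
Qed.

(* A point of the ball beyond the line of e would, by star-shapedness, put
   points just outside of e into K. *)
Lemma star_ball_below D K (r : R) x0 e n : K `<=` D ->
  (forall x y (t : R), enorm (x - x0) < r -> K y -> 0 <= t <= 1 -> K (x + t *: (y - x))) ->
  segment e `<=` closure K -> e.1 != e.2 ->
  enorm n = 1 -> dot n (e.2 - e.1) = 0 ->
  (forall s : R, 0 < s < 1 -> \forall t \near 0^'+,
     ~ D (on_edge e s + t *: n) /\ D (on_edge e s - t *: n)) ->
  0 < r -> dot n (x0 - e.1) <= - r.
Proof.
move=> KD st eK e12 n1 ne Hn r0.
have below x : enorm (x - x0) < r -> dot n (x - e.1) <= 0.
  move=> xr; rewrite leNgt; apply/negP => tau0; set tau := dot n _ in tau0.
  have u0 : e.2 - e.1 != 0 by rewrite subr_eq0 eq_sym.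
  have [sg xE] := normal_decomposition (x - e.1) n1 ne u0.
  have h12 : 0 < (1 / 2 : R) < 1 by rewrite divr_gt0 //= ltr_pdivrMr // mul1r ltr1n.
  have [/= d d0 Hd] := Hn _ h12.
  (* The first bound keeps the height th tau within the range d where the normal points out of D;
     the second keeps th and |th sg| at most 1/4. *)
  pose th := Num.min (d / (2 * tau)) (1 / (4 * (1 + `|sg|))).
  have s0 : 0 < 1 + `|sg| by rewrite ltr_pwDl.
  have th0 : 0 < th by rewrite lt_min !divr_gt0 // mulr_gt0.
  have th1 : th * tau <= d / 2.
    by rewrite -ler_pdivlMr // ge_min; apply/orP; left; rewrite invfM mulrA.
  have th2 : th * (1 + `|sg|) <= 1 / 4.
    by rewrite -ler_pdivlMr // ge_min; apply/orP; right; rewrite !mul1r invfM.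
  have th4 : th <= 1 / 4 by have := normr_ge0 sg; nra.
  have thl : th < 1 by lra.
  have ths : `|th * sg| <= 1 / 4 by rewrite normrM (gtr0_norm th0); nra.
  have [] := Hd (th * tau).
  - by rewrite /= sub0r normrN gtr0_norm ?mulr_gt0 //; lra.
  - by rewrite mulr_gt0.
  move=> + _; apply; apply: KD.
  (* Chosen so that the segment from x to this point of the edge passes, at parameter 1 - th,
     exactly above the midpoint of the edge at height th tau. *)
  pose s' := (1 / 2 - th * sg) / (1 - th).
  have q0 : 0 < 1 - th by rewrite subr_gt0.
  have Hs' : 0 <= s' <= 1.
    move: ths; rewrite ler_norml => /andP[k1 k2].
    rewrite /s' divr_ge0 ?ler_pdivrMr // ?(ltW q0) //; first by lra.
    by lra.
  have ys : closure K (on_edge e s') by apply: eK; apply/segmentP; exists s'.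
  have tt : 0 <= 1 - th < 1 by rewrite ltW //= gtrBl.
  have := star_shaped_closure st xr ys tt.
  rewrite (_ : x + _ = on_edge e (1 / 2) + (th * tau) *: n) //.
  have -> : x = e.1 + (x - e.1) by rewrite addrC subrK.
  rewrite xE -/tau !on_edgeE /s' !scale_pairE.
  apply: (@pair_equal_spec _ _ _ _ _ _).2 => /=.
  by split; field; rewrite gt_eqF.
apply/ler_addgt0Pr => ep ep0.
(* The ball is open, so the radius r along n is only approached, with a loss of at most ep. *)
pose rp := r - Num.min ep (r / 2).
have rp0 : 0 < rp by rewrite subr_gt0 gt_min; apply/orP; right; rewrite ltr_pdivrMr // mulr2n mulrDr mulr1 ltrDl.
have rpr : rp < r by rewrite gtrBl lt_min ep0 divr_gt0.
have nn : n.1 ^+ 2 + n.2 ^+ 2 = 1 by rewrite -enorm_sqr n1 expr1n.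
have : enorm (x0 + rp *: n - x0) < r.
  rewrite addrAC subrr add0r -(ltr_pXn2r (n := 2)) ?nnegrE ?enorm_ge0 ?(ltW r0) //.
  rewrite enorm_sqr /GRing.scale /= !exprMn -mulrDr nn mulr1 ltr_pXn2r ?nnegrE //; exact: ltW.
move=> /below.
have -> : dot n (x0 + rp *: n - e.1) = dot n (x0 - e.1) + rp * (n.1 ^+ 2 + n.2 ^+ 2).
  by rewrite scale_pairE /dot /=; ring.
rewrite nn mulr1 => h; have : r - ep <= rp by rewrite lerD2l lerN2 ge_min lexx.
move: h; set A := dot _ _; clear; lra.
Qed.

Lemma uniform_height Omega (q c0 ep : R) : smooth_convex_domain Omega ->
  0 < q -> 0 < c0 -> 0 < ep -> exists2 h1 : R, 0 < h1 & forall (h : R) a b y x0 n (s d : R),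
  0 < h < h1 -> boundary Omega a -> boundary Omega b -> closure Omega y -> Omega x0 -> b != a ->
  `|b.1 - a.1| <= q * h -> `|b.2 - a.2| <= q * h ->
  `|x0.1 - a.1| <= q * h -> `|x0.2 - a.2| <= q * h ->
  n.1 ^+ 2 + n.2 ^+ 2 = 1 -> n.1 * (b.1 - a.1) + n.2 * (b.2 - a.2) = 0 ->
  n.1 * (x0.1 - a.1) + n.2 * (x0.2 - a.2) <= - (c0 * h) -> 0 <= s <= 1 -> 0 <= d ->
  y = (a.1 + s * (b.1 - a.1) + d * n.1, a.2 + s * (b.2 - a.2) + d * n.2) -> d <= ep * h.
Proof.
move=> sO q0 c00 ep0.
have cB : compact (boundary Omega).
  have [oO _ bO _ _] := sO; have [M M0 OM] := polygon_bounded bO.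
  apply: (@subclosed_compact _ _ (square M)) => //.
  - by apply: closedI; [exact: closed_closure|apply: open_closedC; exact: open_interior].
  - exact: square_compact.
  - by move=> z [clz _]; have := closure_subset OM clz; rewrite -((closure_id (square M)).1 (@square_closed R M)).
have := (compact_near_coveringP (boundary Omega)).1 cB R (0^'+) (fun h a => boundary Omega a -> forall b y x0 n (s d : R),
  boundary Omega b -> closure Omega y -> Omega x0 -> b != a ->
  `|b.1 - a.1| <= q * h -> `|b.2 - a.2| <= q * h ->
  `|x0.1 - a.1| <= q * h -> `|x0.2 - a.2| <= q * h ->
  n.1 ^+ 2 + n.2 ^+ 2 = 1 -> n.1 * (b.1 - a.1) + n.2 * (b.2 - a.2) = 0 ->
  n.1 * (x0.1 - a.1) + n.2 * (x0.2 - a.2) <= - (c0 * h) -> 0 <= s <= 1 -> 0 <= d ->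
  y = (a.1 + s * (b.1 - a.1) + d * n.1, a.2 + s * (b.2 - a.2) + d * n.2) -> d <= ep * h) (within_filter _ (nbhs_filter 0)).
move=> /(_ (fun z bz => local_height sO bz q0 c00 ep0)) [/= h1 h10 H].
exists h1 => // h a b y x0 n s d /andP[h0 hh] ba; apply: (H h) => //.
by rewrite /= sub0r normrN gtr0_norm.
Qed.

End MeshGeometry.

(** * Admissible meshes *)

Section AdmissibleMeshes.
Context {R : realType}.
Local Notation pt := (plane R).
Variables (Omega : set pt) (alpha0 alpha1 q0 q1 : R).
Hypotheses (a00 : 0 < alpha0) (a10 : 0 < alpha1) (q00 : 0 < q0) (q10 : 0 < q1).
Implicit Types (x y z n a b : pt) (e : pt * pt) (T : mesh R) (h : R).

(** An element is open and contained in the closure of the domain, hence in the interior of that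
    closure, which for a polygon is the domain. *)
Lemma adm_elt_dom h T (i : 'I_(nelt T)) : admissible Omega alpha0 alpha1 q0 q1 h T ->
  elt i `<=` dom T.
Proof.
move=> [[[vs pD] _] [pE _ cl] _ _ _] x xi; apply: (polygon_interior_closure pD).
have [oi _ _ _ _] := pE i.
have sub : elt i `<=` closure (dom T).
  by rewrite cl => y yi; exists i => //; exact: subset_closure.
by apply: (interiorS sub); move: oi; rewrite openE; exact.
Qed.

Lemma adm_segment_closure h T (i : 'I_(nelt T)) e : admissible Omega alpha0 alpha1 q0 q1 h T ->
  e \in edges (vtx i) -> segment e `<=` closure (elt i).
Proof.
move=> [_ [pE _ _] _ _ _] ev x ex; have [_ _ _ _ bE] := pE i.
have : boundary (elt i) x by rewrite bE; exists e.
by case.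
Qed.

Lemma adm_edge_neq h T (i : 'I_(nelt T)) e : admissible Omega alpha0 alpha1 q0 q1 h T ->
  e \in edges (vtx i) -> e.1 != e.2.
Proof.
move=> [_ [pE _ _] _ _ _]; have [_ _ _ [sz uv _] _] := pE i.
by apply: edges_neq => //; exact: ltnW.
Qed.

Lemma adm_star h T (i : 'I_(nelt T)) : 0 < h -> admissible Omega alpha0 alpha1 q0 q1 h T ->
  exists x0, exists2 r, alpha0 * q0 * h <= r &
   (forall x, enorm (x - x0) < r -> elt i x) /\
   forall x y t, enorm (x - x0) < r -> elt i y -> 0 <= t <= 1 -> elt i (x + t *: (y - x)).
Proof.
move=> h0 [_ _ hd _ /(_ i) [[r ar [x0 [b s]]] _]]; exists x0, r => //.
apply: le_trans ar; rewrite -mulrA ler_pM2l //; by have /andP[] := hd i.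
Qed.

Lemma adm_closure_dist h T (i : 'I_(nelt T)) x y : admissible Omega alpha0 alpha1 q0 q1 h T ->
  closure (elt i) x -> closure (elt i) y -> `|x.1 - y.1| <= q1 * h /\ `|x.2 - y.2| <= q1 * h.
Proof.
move=> [_ [pE _ _] hd _ _] cx cy; have [_ _ bi _ _] := pE i; have /andP[_ dq] := hd i.
have [h1 h2] := le_diam_closure bi cx cy.
by split; [exact: le_trans h1 dq|exact: le_trans h2 dq].
Qed.

Lemma adm_edge_length h T (i : 'I_(nelt T)) e : admissible Omega alpha0 alpha1 q0 q1 h T ->
  e \in edges (vtx i) -> enorm (e.2 - e.1) <= 2 * q1 * h.
Proof.
move=> ad ev; have sc := adm_segment_closure ad ev.
have [h1 h2] := adm_closure_dist ad (sc _ (segment_right e)) (sc _ (segment_left e)).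
apply: le_trans (enorm_le _) _; rewrite -mulrA (mulr_natl (q1 * h) 2) mulr2n.
exact: lerD.
Qed.

(** The Euclidean norm is at most the sum of the two coordinates; thirds of the radius add up to
    less than the radius. *)
Lemma adm_inner_square h T (i : 'I_(nelt T)) : 0 < h -> admissible Omega alpha0 alpha1 q0 q1 h T ->
  exists2 x0, elt i x0 & forall x, `|x.1 - x0.1| <= alpha0 * q0 / 3 * h ->
    `|x.2 - x0.2| <= alpha0 * q0 / 3 * h -> elt i x.
Proof.
move=> h0 ad; have [x0 [r ar [b s]]] := adm_star i h0 ad.
have p0 : 0 < alpha0 * q0 * h by rewrite !mulr_gt0.
exists x0 => [|x h1 h2]; apply: b.
  apply: le_lt_trans (enorm_le _) _; rewrite subrr !normr0 addr0.
  exact: lt_le_trans p0 ar.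
apply: le_lt_trans (enorm_le _) _; apply: le_lt_trans (lerD h1 h2) _; apply: lt_le_trans ar.
have -> : alpha0 * q0 / 3 * h = (alpha0 * q0 * h) / 3 by ring.
by move: p0; set A := _ * h; clearbody A; lra.
Qed.

Lemma boundary_edgesP T (i : 'I_(nelt T)) e : (i, e) \in boundary_edges T ->
  e \in edges (vtx i) /\ segment e `<=` boundary (dom T).
Proof.
rewrite mem_filter => /andP[/asboolP sb /allpairsPdep [j [e' [_ ev ije]]]].
have ij : i = j by case: ije.
have ee : e = e' by case: ije.
by subst j e'.
Qed.

(** [G] is chosen before ep, so that one rough bound serves all meshes: below a threshold it is the
    height estimate with tolerance 1, above it the gap is at most 4 M and h is bounded below. The
    first alternative is the default normal; the default gap 0 satisfies both bounds. *)
Lemma gap_bound : smooth_convex_domain Omega -> exists2 G : R, 0 < G &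
  forall ep : R, 0 < ep -> exists2 h1 : R, 0 < h1 & forall h T (i : 'I_(nelt T)) e x, 0 < h ->
  admissible Omega alpha0 alpha1 q0 q1 h T -> (i, e) \in boundary_edges T -> segment e x ->
  outer_normal (dom T) e = 0 \/
  [/\ enorm (outer_normal (dom T) e) = 1, 0 <= gap Omega (outer_normal (dom T) e) x <= G * h &
    h < h1 -> gap Omega (outer_normal (dom T) e) x <= ep * h].
Proof.
move=> sO; have [oO _ bO _ _] := sO; have [M M0 OM] := polygon_bounded bO.
have clM y : closure Omega y -> square M y.
  by move=> /(closure_subset OM); rewrite -((closure_id (square M)).1 (@square_closed R M)).
have c00 : 0 < alpha0 * q0 by rewrite mulr_gt0.
have [h1 h10 H1] := uniform_height sO q10 c00 ltr01.
exists (Num.max 1 (4 * M / h1)); first by rewrite lt_max ltr01.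
move=> ep ep0; have [h2 h20 H2] := uniform_height sO q10 c00 ep0; exists h2 => //.
move=> h T i e x h0 ad ie ex.
have [ev eb] := boundary_edgesP ie.
rewrite /outer_normal; case: xgetP => [n _ [n1 ne Hn]|_]; last by left.
right; rewrite n1.
have [[[vsv pD] DO] _ _ _ _] := ad.
have nn : n.1 ^+ 2 + n.2 ^+ 2 = 1 by rewrite -enorm_sqr n1 expr1n.
have bO' v : v \in vtx i -> segment e v -> boundary Omega v.
  by move=> vv /eb; case: ad => _ _ _ H _; exact: H vv.
have [v1 v2] := edges_vertices ev.
have ba := bO' _ v1 (segment_left e); have bb := bO' _ v2 (segment_right e).
have ec := adm_segment_closure ad ev.
have [x0 [r ar [bx st]]] := adm_star i h0 ad.
have r0 : 0 < r by apply: lt_le_trans ar; rewrite !mulr_gt0.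
have Kx0 : elt i x0.
  by apply: bx; apply: le_lt_trans (enorm_le _) _; rewrite subrr !normr0 addr0.
have nx0 := star_ball_below (@adm_elt_dom h T i ad) st ec (adm_edge_neq ad ev) n1 ne Hn r0.
have [ab1 ab2] := adm_closure_dist ad (ec _ (segment_right e)) (ec _ (segment_left e)).
have [x01 x02] := adm_closure_dist ad (@subset_closure _ _ _ Kx0) (ec _ (segment_left e)).
have Ox0 : Omega x0 by by apply: DO; move: Kx0; exact: (@adm_elt_dom h T i ad).
have clx : closure Omega x.
  by have [+ _] := eb x ex; exact: closure_subset.
have e21 : e.2 != e.1 by rewrite eq_sym; exact: adm_edge_neq ad ev.
have nx0' : n.1 * (x0.1 - e.1.1) + n.2 * (x0.2 - e.1.2) <= - (alpha0 * q0 * h).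
  by apply: le_trans nx0 _; rewrite lerN2.
rewrite /gap; case: xgetP => [d _ [d0 bd]|_]; last first.
  by split=> //; [rewrite lexx mulr_ge0 ?(ltW h0) // le_max ler01|move=> _; rewrite mulr_ge0 // ltW].
have [s s01 xs] := (segmentP _ _).1 ex.
have yE : x + d *: n = (e.1.1 + s * (e.2.1 - e.1.1) + d * n.1, e.1.2 + s * (e.2.2 - e.1.2) + d * n.2).
  by rewrite -xs on_edgeE scale_pairE.
have cly : closure Omega (x + d *: n) by case: bd.
split=> //; last first.
  move=> hh; apply: (H2 h e.1 e.2 _ x0 n s d _ ba bb cly Ox0 e21 ab1 ab2 x01 x02 nn ne nx0' s01 d0 yE).
  by rewrite h0.
rewrite d0 /=; have [hh|hh] := ltP h h1.
  apply: (@le_trans _ _ (1 * h)); last by rewrite ler_wpM2r ?(ltW h0) // le_max lexx.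
  apply: (H1 h e.1 e.2 _ x0 n s d _ ba bb cly Ox0 e21 ab1 ab2 x01 x02 nn ne nx0' s01 d0 yE).
  by rewrite h0.
apply: (@le_trans _ _ (4 * M)); last first.
  apply: (@le_trans _ _ (4 * M / h1 * h)); last by rewrite ler_wpM2r ?(ltW h0) // le_max lexx orbT.
  by rewrite -mulrA ler_peMr ?mulr_ge0 ?(ltW M0) // mulrC ler_pdivlMr // mul1r.
have -> : d = enorm (d *: n).
  apply/eqP; rewrite -(eqrXn2 (n := 2)) ?enorm_ge0 //.
  by rewrite enorm_sqr scale_pairE !exprMn -mulrDr nn mulr1.
have /squareE [y1 y2] := clM _ cly; have /squareE [z1 z2] := clM _ clx.
apply: le_trans (enorm_le _) _; have -> : d *: n = (x + d *: n) - x by rewrite addrAC subrr add0r.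
move: y1 y2; set y := x + d *: n => y1 y2 /=.
have := ler_normB y.1 x.1; have := ler_normB y.2 x.2; lra.
Qed.

(** Pigeonhole: the vertices lie in a square of side 2 d, d the diameter, which is cut into cells of
    side alpha1 d / 2; two vertices in one cell would be closer than alpha1 d. *)
Lemma vertex_count_bound : exists N : nat, forall h T (i : 'I_(nelt T)), 0 < h ->
  admissible Omega alpha0 alpha1 q0 q1 h T -> (size (edges (vtx i)) <= N)%N.
Proof.
pose k := (Num.truncn (4 / alpha1)).+1; exists (k * k)%N => h T i h0 ad.
rewrite size_zip size_rot minnn.
have [_ [pE _ _] hd _ /(_ i) [_ sep]] := ad; have [_ _ bi [_ uv _] bE] := pE i.
have d0 : 0 < diam (elt i) by have /andP[+ _] := hd i; apply: lt_le_trans; rewrite mulr_gt0.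
set d := diam (elt i) in sep d0.
have [x0 Kx0 _] := adm_inner_square i h0 ad.
have vcl v : v \in vtx i -> closure (elt i) v.
  move=> /(nthP 0) [j jv <-]; have ej : (nth 0 (vtx i) j, nth 0 (rot 1 (vtx i)) j) \in edges (vtx i).
    apply/(nthP (0 : pt, 0 : pt)); exists j; first by rewrite size_zip size_rot minnn.
    by rewrite nth_zip ?size_rot.
  exact: (adm_segment_closure ad ej (segment_left _)).
pose dl := alpha1 * d / 2.
have dl0 : 0 < dl by rewrite divr_gt0 // mulr_gt0.
pose cell v : nat * nat := (Num.truncn ((v.1 - x0.1 + d) / dl), Num.truncn ((v.2 - x0.2 + d) / dl)).
have rng (p p0 : R) : `|p - p0| <= d -> 0 <= (p - p0 + d) / dl /\ (p - p0 + d) / dl <= 4 / alpha1.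
  rewrite ler_norml => /andP[k1 k2]; split; first by rewrite divr_ge0 ?(ltW dl0) //; lra.
  rewrite ler_pdivrMr //; have -> : 4 / alpha1 * dl = 2 * d by rewrite /dl; field; rewrite gt_eqF.
  by lra.
have same (u v : R) : 0 <= u -> 0 <= v -> Num.truncn u = Num.truncn v -> `|u - v| < 1.
  move=> u0 v0 E; have /andP[p1 p2] := truncn_itv u0; have /andP[p3 p4] := truncn_itv v0.
  by rewrite E -natr1 in p1 p2; rewrite -natr1 in p4; rewrite ltr_norml; apply/andP; split; lra.
have inj : {in vtx i &, injective cell}.
  move=> u v uv' vv [E1 E2]; apply/eqP; apply: contrapT => /negP nuv.
  have [u1 u2] := le_diam_closure bi (vcl _ uv') (@subset_closure _ _ _ Kx0).
  have [v1 v2] := le_diam_closure bi (vcl _ vv) (@subset_closure _ _ _ Kx0).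
  have s1 := same _ _ (rng _ _ u1).1 (rng _ _ v1).1 E1.
  have s2 := same _ _ (rng _ _ u2).1 (rng _ _ v2).1 E2.
  have key (p q p0 : R) : `|(p - p0 + d) / dl - (q - p0 + d) / dl| < 1 -> `|p - q| < dl.
    have -> : (p - p0 + d) / dl - (q - p0 + d) / dl = (p - q) / dl by field; rewrite gt_eqF.
    by rewrite normrM normfV (gtr0_norm dl0) ltr_pdivrMr // mul1r.
  have := sep u v uv' vv nuv; apply/negP; rewrite -ltNge.
  apply: le_lt_trans (enorm_le _) _ => /=.
  have := ltrD (key _ _ _ s1) (key _ _ _ s2).
  by have -> : dl + dl = alpha1 * d by rewrite /dl; field.
rewrite -(size_map cell); apply: (@leq_trans (size [seq (p, q) | p <- iota 0 k, q <- iota 0 k])).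
  apply: uniq_leq_size; first by rewrite map_inj_in_uniq.
  move=> _ /mapP [v vv ->]; apply/allpairsP; exists (cell v) => /=.
  have [v1 v2] := le_diam_closure bi (vcl _ vv) (@subset_closure _ _ _ Kx0).
  have tr (p : R) : p <= 4 / alpha1 -> Num.truncn p \in iota 0 k.
    by move=> hp; rewrite mem_iota /= add0n ltnS le_truncn.
  by split=> //; apply: tr; [exact: (rng _ _ v1).2|exact: (rng _ _ v2).2].
by rewrite size_allpairs !size_iota.
Qed.

End AdmissibleMeshes.

(** * Edge integrals *)

Section EdgeIntegrals.
Context {R : realType}.
Local Notation pt := (plane R).
Local Notation leb := (@lebesgue_measure R).
Local Notation I01 := (`[0%R, 1%R]%classic : set (measurableTypeR R)).
Implicit Types (e : pt * pt) (f g t : pt -> R) (u v : R -> R).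

(* No measurability of u is needed, so that integrands containing the gap can
   be estimated. *)
Lemma Rintegral_dominated u v : leb.-integrable I01 (EFin \o v) ->
  (forall s, I01 s -> `|u s| <= v s) ->
  `|Rintegral leb I01 u| <= Rintegral leb I01 v.
Proof.
move=> iv uv.
have v0 s : I01 s -> (0 <= (EFin \o v) s)%E.
  by move=> hs; rewrite lee_fin; exact: le_trans (uv s hs).
have fv : (\int[leb]_(x in I01) (EFin \o v) x)%E \is a fin_num by exact: integrable_fin_num.
(* The integral of a nonnegative function is a supremum over the simple functions below it, and a
   simple function below w lies below v. *)
have mono (w : R -> \bar R) : (forall s, I01 s -> (0 <= w s <= (EFin \o v) s)%E) ->
    (0 <= \int[leb]_(x in I01) w x <= \int[leb]_(x in I01) (EFin \o v) x)%E.
  move=> wv; apply/andP; split; first by apply: integral_ge0 => s hs; have /andP[] := wv s hs.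
  rewrite !ge0_integralE //; last by move=> s hs; have /andP[] := wv s hs.
  apply: le_ereal_sup => _ [hh /= hw <-]; exists hh => //= s.
  apply: le_trans (hw s) _; rewrite /patch; case: ifPn => // /[!inE] hs.
  by have /andP[] := wv s hs.
have /mono : forall s, I01 s -> (0 <= (EFin \o u)^\+ s <= (EFin \o v) s)%E.
  move=> s hs; rewrite funepos_ge0 funeposE /= ge_max !lee_fin (le_trans (ler_norm _) (uv s hs)) /=.
  exact: le_trans (uv s hs).
have /mono : forall s, I01 s -> (0 <= (EFin \o u)^\- s <= (EFin \o v) s)%E.
  move=> s hs; rewrite funeneg_ge0 funenegE /= ge_max !lee_fin (le_trans _ (uv s hs)) /=; last by rewrite -normrN ler_norm.
  exact: le_trans (uv s hs).
rewrite /Rintegral [in X in _ -> _ -> `|fine X| <= _]integralE.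
move: fv; set A := (\int[_]_(_ in _) (_ ^\- _))%E; set B := (\int[_]_(_ in _) (_ ^\+ _))%E.
rewrite (_ : (\int[leb]_(x in I01) (v x)%:E)%E = (\int[leb]_(x in I01) (EFin \o v) x)%E) //.
set V := (\int[_]_(_ in _) _)%E; clearbody A B V.
case: V => [V| |] // _; case: A => [A| |] //; case: B => [B| |] //; rewrite ?leye_eq ?andbF //.
by rewrite !lee_fin /= => /andP[A0 AV] /andP[B0 BV]; rewrite ler_norml; lra.
Qed.

Definition L2I u := measurable_fun I01 u /\ leb.-integrable I01 (EFin \o (fun s => u s ^+ 2)).

Lemma L2I_mul u v : L2I u -> L2I v -> leb.-integrable I01 (EFin \o (fun s => u s * v s)).
Proof.
move=> [mu u2] [mv v2].
have i1 : leb.-integrable I01 (EFin \o (fun s => u s ^+ 2 + v s ^+ 2)).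
  exact: (@integrableD _ _ _ leb I01 _ (EFin \o (fun x => u x ^+ 2)) (EFin \o (fun x => v x ^+ 2))).
apply: (le_integrable _ _ _ i1) => //.
  by apply/measurable_EFinP; apply: measurable_funM.
move=> s _ /=; rewrite lee_fin [X in _ <= X]ger0_norm; last by rewrite addr_ge0 ?sqr_ge0.
rewrite ler_norml; apply/andP; split; nra.
Qed.

Lemma L2I_cst (c : R) : L2I (fun=> c).
Proof.
split=> //; apply: (@continuous_compact_integrable R (fun=> c ^+ 2)); first exact: segment_compact.
by apply: continuous_subspaceT => x; exact: cvg_cst.
Qed.

Lemma L2I_abs u : L2I u -> L2I (fun s => `|u s|).
Proof.
move=> [mu u2]; split; first exact: measurableT_comp.
by rewrite (_ : (fun s => _) = (fun s => u s ^+ 2)) //; apply/funext => s; rewrite real_normK ?num_real.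
Qed.

Lemma Rintegral_cauchy_schwarz u v : L2I u -> L2I v ->
  `|Rintegral leb I01 (fun s => u s * v s)| <=
   Num.sqrt (Rintegral leb I01 (fun s => u s ^+ 2)) * Num.sqrt (Rintegral leb I01 (fun s => v s ^+ 2)).
Proof.
move=> Lu Lv; have uv := L2I_mul Lu Lv; have [_ u2] := Lu; have [_ v2] := Lv.
apply: sqrt_mul_bound => r.
have mI : measurable I01 by [].
have i1 : leb.-integrable I01 (EFin \o (fun s => 2 * r * (u s * v s))).
  exact: (@integrableZl _ _ _ leb I01 mI (2 * r) (EFin \o (fun s => u s * v s))).
have i2 : leb.-integrable I01 (EFin \o (fun s => r ^+ 2 * (v s ^+ 2))).
  exact: (@integrableZl _ _ _ leb I01 mI (r ^+ 2) (EFin \o (fun s => v s ^+ 2))).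
have i3 : leb.-integrable I01 (EFin \o (fun s => u s ^+ 2 + 2 * r * (u s * v s))).
  exact: (@integrableD _ _ _ leb I01 mI (EFin \o (fun x => u x ^+ 2)) (EFin \o (fun s => 2 * r * (u s * v s)))).
rewrite -(RintegralZl (2 * r) mI uv) -(RintegralZl (r ^+ 2) mI v2).
rewrite -(RintegralD mI u2 i1) -(RintegralD mI i3 i2).
apply: Rintegral_ge0 => s _.
rewrite (_ : u s ^+ 2 + 2 * r * (u s * v s) + r ^+ 2 * v s ^+ 2 = (u s + r * v s) ^+ 2); first exact: sqr_ge0.
by ring.
Qed.

Lemma edge_int_sqr_ge0 e t : 0 <= edge_int e (fun x => t x ^+ 2).
Proof. by rewrite mulr_ge0 ?enorm_ge0 //; apply: Rintegral_ge0 => s _; exact: sqr_ge0. Qed.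

Lemma edge_int_cauchy_schwarz e t t' : L2_edge e t -> L2_edge e t' ->
  `|edge_int e (fun x => t x * t' x)| <=
  Num.sqrt (edge_int e (fun x => t x ^+ 2)) * Num.sqrt (edge_int e (fun x => t' x ^+ 2)).
Proof.
move=> Lt Lt'; have := @Rintegral_cauchy_schwarz (t \o on_edge e) (t' \o on_edge e) Lt Lt'.
rewrite /edge_int !sqrtrM ?enorm_ge0 // normrM (ger0_norm (enorm_ge0 _)) mulrACA -expr2 sqr_sqrtr ?enorm_ge0 //.
by move=> H; apply: ler_wpM2l; first exact: enorm_ge0.
Qed.

(** Cauchy-Schwarz against the constant 1 turns the integral of |t| into an L2 norm; of the length
    of e, one square root is absorbed in that norm and one remains. *)
Lemma edge_int_bound e t f (A B : R) : L2_edge e t -> 0 <= A -> 0 <= B ->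
  (forall x, segment e x -> `|f x| <= A * `|t x| + B) ->
  `|edge_int e f| <= A * (Num.sqrt (enorm (e.2 - e.1)) * Num.sqrt (edge_int e (fun x => t x ^+ 2)))
     + enorm (e.2 - e.1) * B.
Proof.
move=> Lt A0 B0 ft.
have Lu : L2I (fun s => `|t (on_edge e s)|) by exact: (@L2I_abs (t \o on_edge e)).
have L1 := L2I_cst 1.
have mI : measurable I01 by [].
have it : leb.-integrable I01 (EFin \o (fun s => `|t (on_edge e s)|)).
  rewrite (_ : (fun s => _) = (fun s => `|t (on_edge e s)| * 1)); first exact: L2I_mul Lu L1.
  by apply/funext => s; rewrite mulr1.
have i1 : leb.-integrable I01 (EFin \o (fun s => A * `|t (on_edge e s)|)).
  exact: (@integrableZl _ _ _ leb I01 mI A (EFin \o (fun s => `|t (on_edge e s)|))).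
have iB : leb.-integrable I01 (EFin \o (fun=> B)).
  rewrite (_ : (fun=> B) = (fun=> B * 1)); first exact: L2I_mul (L2I_cst B) L1.
  by apply/funext => s; rewrite mulr1.
have i2 : leb.-integrable I01 (EFin \o (fun s => A * `|t (on_edge e s)| + B)).
  exact: (@integrableD _ _ _ leb I01 mI (EFin \o (fun s => A * `|t (on_edge e s)|)) (EFin \o (fun=> B))).
have H := @Rintegral_dominated (f \o on_edge e) _ i2 _.
have {}H : `|Rintegral leb I01 (f \o on_edge e)| <= Rintegral leb I01 (fun s => A * `|t (on_edge e s)| + B).
  by apply: H => s hs; apply: ft; exists s.
rewrite (RintegralD mI i1 iB) (RintegralZl A mI it) in H.
have I1 : leb I01 = 1%E by rewrite lebesgue_measure_itv /= lte_fin ltr01 oppr0 adde0.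
have Ic (c : R) : Rintegral leb I01 (fun=> c) = c by rewrite Rintegral_cst // [X in fine X]I1 mulr1.
rewrite Ic in H.
have C := Rintegral_cauchy_schwarz Lu L1.
have E1 : Rintegral leb I01 (fun=> 1 ^+ 2) = 1 by rewrite Ic expr1n.
rewrite E1 sqrtr1 mulr1 in C.
have E2 : (fun s => `|t (on_edge e s)| * 1) = (fun s => `|t (on_edge e s)|).
  by apply/funext => s; rewrite mulr1.
have E3 : (fun s => `|t (on_edge e s)| ^+ 2) = (fun s => t (on_edge e s) ^+ 2).
  by apply/funext => s; rewrite real_normK ?num_real.
rewrite E2 E3 in C.
rewrite /edge_int normrM (ger0_norm (enorm_ge0 _)).
rewrite sqrtrM ?enorm_ge0 // mulrA -expr2 sqr_sqrtr ?enorm_ge0 //.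
rewrite mulrCA -mulrDr; apply: ler_wpM2l; first exact: enorm_ge0.
apply: le_trans H _; rewrite lerD2r; apply: ler_wpM2l => //.
exact: le_trans (ler_norm _) C.
Qed.

Lemma sum_cauchy_schwarz (J : Type) (s : seq J) (a b : J -> R) :
  `|\sum_(j <- s) a j * b j| <=
  Num.sqrt (\sum_(j <- s) a j ^+ 2) * Num.sqrt (\sum_(j <- s) b j ^+ 2).
Proof.
apply: sqrt_mul_bound => t; rewrite !mulr_sumr -!big_split /=.
apply: sumr_ge0 => j _.
have -> : a j ^+ 2 + 2 * t * (a j * b j) + t ^+ 2 * b j ^+ 2 = (a j + t * b j) ^+ 2 by ring.
exact: sqr_ge0.
Qed.

End EdgeIntegrals.

(** * The discrete bilinear form *)

Section BrokenSeminorm.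
Context {R : realType}.
Local Notation pt := (plane R).
Local Notation mpt := (measurableTypeR R * measurableTypeR R)%type.
Local Notation mu := (@plane_measure R).
Implicit Types (x : pt) (e : pt * pt) (T : mesh R) (h : R) (phi : pt -> R).

Lemma segments_null (s : seq (pt * pt)) :
  measurable ([set x | exists2 e, e \in s & segment e x] : set mpt) /\
  mu [set x | exists2 e, e \in s & segment e x] = 0%E.
Proof.
elim: s => [|e s [IHm IH0]].
  have -> : [set x : pt | exists2 e, e \in [::] & segment e x] = set0.
    by apply/seteqP; split => // x [].
  by split; [exact: measurable0|exact: measure0].
have -> : [set x : pt | exists2 e', e' \in e :: s & segment e' x] =
    segment e `|` [set x : pt | exists2 e', e' \in s & segment e' x].
  apply/seteqP; split => x.
    by move=> [e']; rewrite inE => /orP[/eqP ->|es ex]; [left|right; exists e'].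
  by move=> [ex|[e' es ex]]; [exists e; rewrite ?mem_head|exists e' => //; rewrite inE es orbT].
have me : measurable (segment e : set mpt).
  rewrite -[segment e]setCK; apply: measurableC; apply: open_measurable_plane.
  by apply: closed_openC; exact: segment_closed.
split; first exact: measurableU.
apply/eqP; rewrite -measure_le0; apply: le_trans (measureU2 _ me IHm) _.
by rewrite [X in (X + _)%E](segment_null e) [X in (_ + X)%E]IH0 adde0.
Qed.

Variables (Omega : set pt) (alpha0 alpha1 q0 q1 : R).

Lemma H1_elt h T (i : 'I_(nelt T)) phi : admissible Omega alpha0 alpha1 q0 q1 h T ->
  H1 (dom T) phi -> H1 (elt i) phi.
Proof.
move=> ad; have [[[vs [oD _ _ _ _]] _] [pE _ _] _ _ _] := ad; have [oi _ _ _ _] := pE i.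
exact: (H1_subset oD oi (@adm_elt_dom _ _ _ _ _ _ _ _ i ad)).
Qed.

(** The weak gradient on the domain restricts to every element, and the domain without the null set
    of all edges is the disjoint union of the elements. *)
Lemma H1semi2_dom h T phi : admissible Omega alpha0 alpha1 q0 q1 h T ->
  H1 (dom T) phi -> H1semi2 (dom T) phi = \sum_(i < nelt T) dirichlet (elt i) phi phi.
Proof.
move=> ad Hphi; have [[[vs [oD _ _ _ _]] _] [pE dE cE] _ _ _] := ad.
have oE (i : 'I_(nelt T)) : open (elt i : set pt) by have [] := pE i.
have ED (i : 'I_(nelt T)) : elt i `<=` dom T by exact: (@adm_elt_dom _ _ _ _ _ _ _ _ i ad).
have wG := weak_gradP Hphi; set G := weak_grad _ _ in wG.
pose w x := G false x * G false x + G true x * G true x.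
have iw : mu.-integrable (dom T) (EFin \o w) := integrable_dirichlet oD wG wG.
have mD := open_measurable_plane oD.
rewrite /H1semi2 (dirichletE oD wG wG) -/w.
have -> : \sum_(i < nelt T) dirichlet (elt i) phi phi = \sum_(i < nelt T) area_int (elt i) w.
  apply: eq_bigr => i _; have wi := is_weak_grad_subset oD (oE i) (ED i) wG.
  exact: (dirichletE (oE i) wi wi).
pose segs := flatten [seq edges (@vtx _ T i) | i <- enum 'I_(nelt T)].
have segsP e : e \in segs <-> exists i, e \in edges (@vtx _ T i).
  split=> [/flatten_mapP [i _ ?]|[i ei]]; first by exists i.
  by apply/flatten_mapP; exists i => //; rewrite mem_enum.
have [mN N0] := segments_null segs; set N := [set x | _] in mN N0.
have DN : dom T `\` N = \big[setU/set0]_(i <- enum 'I_(nelt T)) elt i.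
  rewrite -bigcup_seq; apply/seteqP; split => x.
    move=> [Dx Nx]; have := @subset_closure _ _ x Dx; rewrite cE => -[i _ ci].
    exists i; first by rewrite /= mem_enum.
    apply: contrapT => nx; apply: Nx; have [_ _ _ _ bE] := pE i.
    have : boundary (elt i) x by split => // /interior_subset.
    by rewrite bE => -[e ei ex]; exists e => //; apply/segsP; exists i.
  move=> [i _ xi]; split; first exact: ED xi.
  move=> [e /segsP [j ej] ex]; have [_ _ _ _ bE] := pE j.
  have [cj nj] : boundary (elt j) x by rewrite bE; exists e.
  have ni : nbhs x (elt i) by apply: open_nbhs_nbhs; split.
  have [ij|ij] := eqVneq i j; first by subst j; exact: nj.
  have [y [yj yi]] := cj _ ni.
  have : (elt i `&` elt j) y by split.
  by rewrite dE.
have triv : trivIset [set` enum 'I_(nelt T)] (@elt _ T).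
  by apply/trivIsetP => i j _ _ ij; exact: dE.
have mDN : measurable (dom T `\` N : set mpt) by exact: measurableD.
have iw' : mu.-integrable (dom T `\` N) (EFin \o w).
  by apply: (integrableS mD mDN) iw; exact: subDsetl.
rewrite /area_int /Rintegral (negligible_integral mN mD iw N0) DN.
rewrite (integral_bigsetU_EFin mu (fun i => open_measurable_plane (oE i)) (enum_uniq _) triv); last first.
  by rewrite -DN; case/integrableP: iw'.
rewrite -big_enum /=; rewrite -sum_fine //.
move=> i _; apply: integrable_fin_num; first exact: open_measurable_plane.
by apply: (integrableS mD _ (ED i)) iw; exact: open_measurable_plane.
Qed.

(** An element is counted once for each of its edges on the boundary, hence at most N times. *)
Lemma bsum_elt_le (N : nat) T (F : 'I_(nelt T) -> R) : (forall i, 0 <= F i) ->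
  (forall i, (size (edges (@vtx _ T i)) <= N)%N) ->
  \sum_(ie <- boundary_edges T) F ie.1 <= N%:R * \sum_(i < nelt T) F i.
Proof.
move=> F0 sN; rewrite /boundary_edges big_filter.
apply: (@le_trans _ _ (\sum_(ie <- [seq (i, e) | i <- enum 'I_(nelt T), e <- edges (vtx i)]) F ie.1)).
  rewrite big_mkcond /=; apply: ler_sum => ie _; by case: ifP.
rewrite big_allpairs_dep /= big_enum /= mulr_sumr; apply: ler_sum => i _.
rewrite big_const_seq count_predT iter_addr_0 -[X in X <= _]mulr_natl.
apply: ler_wpM2r; first exact: F0.
by rewrite ler_nat.
Qed.

End BrokenSeminorm.

(** * Estimates on a single boundary edge *)

Section EdgeTerms.
Context {R : realType}.
Local Notation pt := (plane R).
Variables (m : nat) (Omega : set pt) (alpha0 alpha1 q0 q1 : R).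
Hypotheses (sO : smooth_convex_domain Omega).
Hypotheses (a00 : 0 < alpha0) (a10 : 0 < alpha1) (q00 : 0 < q0) (q10 : 0 < q1).
Implicit Types (x n : pt) (e : pt * pt) (T : mesh R) (h : R) (phi psi t : pt -> R).

Local Notation P i f := (Pi_nabla (elt i) m f).
Local Notation dnorm i f := (Num.sqrt (dirichlet (elt i) f f)).

Definition edge_norm h e t := Num.sqrt (h^-1 * edge_int e (fun x => t x ^+ 2)).

Lemma edge_norm_sqr h e t : 0 < h ->
  edge_norm h e t ^+ 2 = h^-1 * edge_int e (fun x => t x ^+ 2).
Proof. by move=> h0; rewrite sqr_sqrtr // mulr_ge0 ?edge_int_sqr_ge0 // invr_ge0 ltW. Qed.

Lemma edge_norm_ge0 h e t : 0 <= edge_norm h e t. Proof. exact: sqrtr_ge0. Qed.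

Lemma edge_norm_unscale h e t : 0 < h ->
  Num.sqrt (edge_int e (fun x => t x ^+ 2)) = Num.sqrt h * edge_norm h e t.
Proof.
move=> h0; rewrite /edge_norm -sqrtrM ?(ltW h0) //.
by congr Num.sqrt; rewrite mulrA mulfV ?mul1r // gt_eqF.
Qed.

Lemma adm_elt_square : exists M, forall h T (i : 'I_(nelt T)),
  admissible Omega alpha0 alpha1 q0 q1 h T -> elt i `<=` square M.
Proof.
have [_ _ bO _ _] := sO; have [M M0 OM] := polygon_bounded bO; exists M => h T i ad.
have [[_ DO] _ _ _ _] := ad.
by apply: subset_trans OM; apply: subset_trans DO; exact: (@adm_elt_dom _ _ _ _ _ _ _ _ i ad).
Qed.

(** The inverse estimate is applied on the inscribed square of half-side c h; [Lam] is so large that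
    the enlarged square contains the closure of the element. Pythagoras replaces the energy of the
    projection by that of phi. *)
Lemma dnormal_Pi_bound : exists2 C : R, 0 < C & forall h T (i : 'I_(nelt T)) phi n j x,
  0 < h -> admissible Omega alpha0 alpha1 q0 q1 h T -> H1 (elt i) phi ->
  `|n.1| <= 1 -> `|n.2| <= 1 -> (0 < j <= m)%N -> closure (elt i) x ->
  `|dnormal n j (P i phi) x| <= C / h ^+ j * dnorm i phi.
Proof.
have [c cE] : exists c, c = alpha0 * q0 / 3 by eexists.
have c0 : 0 < c by rewrite cE divr_gt0 ?mulr_gt0.
pose Lam := Num.max 1 (q1 / c).
have L1 : 1 <= Lam by rewrite le_max lexx.
have [C C0 HC] := @dnormal_bound R m Lam L1.
(* At least 1, so that its power m dominates the factor c^-j for every j up to m. *)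
pose c1 := Num.max 1 c^-1.
have c11 : 1 <= c1 by rewrite le_max lexx.
exists (C * c1 ^+ m); first by rewrite mulr_gt0 // exprn_gt0 // (lt_le_trans ltr01).
have [M HM] := adm_elt_square.
move=> h T i phi n j x h0 ad Hphi n1 n2 /andP[j0 jm] cx.
have KM := HM h T i ad.
have [a Ka sq] := adm_inner_square a00 q00 i h0 ad; rewrite -cE in sq.
have oi : open (elt i : set pt) by have [_ [pE _ _] _ _ _] := ad; have [] := pE i.
have [x1 x2] := adm_closure_dist ad cx (@subset_closure _ _ _ Ka).
have qL : q1 * h <= Lam * (c * h).
  rewrite mulrA ler_wpM2r ?(ltW h0) // -ler_pdivrMr // le_max lexx orbT //.
have := HC _ M a (c * h) _ n j x oi KM (mulr_gt0 c0 h0) sq (@Pol_Pi R (elt i) m phi) n1 n2.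
rewrite j0 jm => /(_ isT (le_trans x1 qL) (le_trans x2 qL)) H; apply: le_trans H _.
apply: ler_pM; [|exact: sqrtr_ge0| |].
- by rewrite divr_ge0 ?exprn_ge0 ?mulr_ge0 ?(ltW C0) ?(ltW c0) ?(ltW h0).
- rewrite exprMn invfM mulrA ler_wpM2r ?invr_ge0 ?exprn_ge0 ?(ltW h0) //.
  rewrite ler_wpM2l ?(ltW C0) // -exprVn.
  apply: (@le_trans _ _ (c1 ^+ j)); last exact: ler_weXn2l.
  by apply: lerXn2r; rewrite ?nnegrE ?invr_ge0 ?(ltW c0) ?(le_trans ler01 c11) // le_max lexx orbT.
- apply: ler_wsqrtr; rewrite (dirichlet_Pi_split m oi KM Hphi) lerDl; exact: dirichlet_ge0.
Qed.

Lemma outer_normal_le1 T e :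
  `|(outer_normal (dom T) e).1| <= 1 /\ `|(outer_normal (dom T) e).2| <= 1.
Proof.
rewrite /outer_normal; case: xgetP => [n _ [n1 _ _]|_] /=; last by rewrite normr0 ler01.
by rewrite -n1; exact: enorm_ge.
Qed.

(* Without a trace the default value is 0, so no trace theorem is needed. *)
Lemma btrace_L2_edge T phi (i : 'I_(nelt T)) e : (i, e) \in boundary_edges T ->
  L2_edge e (btrace T phi).
Proof.
move=> ie; rewrite /btrace /trace; case: xgetP => [t _ [+ _]|_].
  by apply; apply/mapP; exists (i, e).
by apply: L2_edge_continuous => x; exact: cvg_cst.
Qed.

(* Makes the default value 0 of [outer_normal] harmless. *)
Lemma dnormal0 j f x : (0 < j)%N -> dnormal 0 j f x = 0.
Proof. by case: j => // j _; rewrite /dnormal /= derive0. Qed.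

Lemma edge_scaling h T (i : 'I_(nelt T)) e t : 0 < h ->
  admissible Omega alpha0 alpha1 q0 q1 h T -> (i, e) \in boundary_edges T ->
  Num.sqrt (enorm (e.2 - e.1)) * Num.sqrt (edge_int e (fun x => t x ^+ 2)) <=
  Num.sqrt (2 * q1) * (h * edge_norm h e t).
Proof.
move=> h0 ad ie; have [ev _] := boundary_edgesP ie.
rewrite (edge_norm_unscale e t h0) !mulrA; apply: ler_wpM2r; first exact: sqrtr_ge0.
rewrite -[X in _ <= _ * X](@sqr_sqrtr _ h) ?(ltW h0) // expr2 mulrA.
apply: ler_wpM2r; first exact: sqrtr_ge0.
rewrite -sqrtrM ?mulr_ge0 ?(ltW q10) //; apply: ler_wsqrtr; exact: adm_edge_length ad ev.
Qed.

(** The factor 1/h of the derivative is compensated by two factors sqrt h, one from the length of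
    the edge and one from the scaling of [edge_norm]. *)
Lemma edge_consistency_bound : (0 < m)%N -> exists2 C : R, 0 < C &
  forall h T (i : 'I_(nelt T)) e phi t, 0 < h -> admissible Omega alpha0 alpha1 q0 q1 h T ->
  (i, e) \in boundary_edges T -> H1 (elt i) phi -> L2_edge e t ->
  `|edge_int e (fun x => dnormal (outer_normal (dom T) e) 1 (P i phi) x * t x)| <=
  C * (dnorm i phi * edge_norm h e t).
Proof.
move=> m0; have [C C0 HC] := dnormal_Pi_bound.
have s0 : 0 < Num.sqrt (2 * q1) by rewrite sqrtr_gt0 mulr_gt0.
exists (C * Num.sqrt (2 * q1)) => [|h T i e phi t h0 ad ie Hphi Lt]; first by rewrite mulr_gt0.
have [ev _] := boundary_edgesP ie; have [n1 n2] := outer_normal_le1 T e.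
have [D DE] : exists D, D = dnorm i phi := ex_intro _ _ (erefl _).
have D0 : 0 <= D by rewrite DE; exact: sqrtr_ge0.
rewrite -DE.
have A0 : 0 <= C / h * D by rewrite mulr_ge0 // divr_ge0 ?(ltW C0) ?(ltW h0).
apply: (@le_trans _ _ _ _ _ (edge_int_bound Lt A0 (lexx 0) _)).
  move=> x ex; rewrite normrM addr0; apply: ler_wpM2r; first exact: normr_ge0.
  have := HC h T i phi (outer_normal (dom T) e) 1%N x h0 ad Hphi n1 n2 m0.
  by rewrite expr1 -DE; apply; exact: adm_segment_closure ad ev _ ex.
rewrite mulr0 addr0; apply: le_trans (ler_wpM2l A0 (edge_scaling t h0 ad ie)) _.
set s := Num.sqrt (2 * q1); set tt := edge_norm h e t.
by rewrite le_eqVlt; apply/orP; left; apply/eqP; field; rewrite gt_eqF.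
Qed.

(** The powers of h cancel and leave eta^j. One factor eta is kept, to be made small later, and the
    others are bounded by G >= 1. The alternative for F is the default normal 0, along which all
    derivatives vanish. *)
Lemma gap_sum_bound (k : nat) (C D G eta h d : R) (F : nat -> R) :
  0 < h -> 0 <= C -> 0 <= D -> 1 <= G -> 0 <= eta <= G ->
  (forall j, (0 < j <= k)%N -> `|F j| <= C / h ^+ j * D) ->
  (forall j, (0 < j)%N -> F j = 0) \/ 0 <= d <= eta * h ->
  `|\sum_(1 <= j < k.+1) d ^+ j / (j`!)%:R * F j| <= k.+1%:R * G ^+ k * C * eta * D.
Proof.
move=> h0 C0 D0 G1 /andP[e0 eG] HF Hd.
have G0 : 0 <= G by exact: le_trans G1.
have R0 : 0 <= G ^+ k * C * eta * D by rewrite !mulr_ge0 ?exprn_ge0.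
apply: le_trans (ler_norm_sum _ _ _) _.
apply: (@le_trans _ _ (\sum_(1 <= j < k.+1) (G ^+ k * C * eta * D))); last first.
  rewrite sumr_const_nat subSS subn0 -[X in X <= _]mulr_natl -!mulrA ler_wpM2r ?ler_nat //.
  by rewrite !mulr_ge0 ?exprn_ge0.
apply: ler_sum_nat => j /andP[j1 jk]; rewrite ltnS in jk.
case: Hd => [F0|/andP[d0 dle]]; first by rewrite F0 ?mulr0 ?normr0.
have jm : (0 < j <= k)%N by rewrite j1.
rewrite normrM ger0_norm ?divr_ge0 ?exprn_ge0 //.
apply: (@le_trans _ _ ((eta * h) ^+ j * (C / h ^+ j * D))).
  apply: ler_pM; [by rewrite divr_ge0 ?exprn_ge0|exact: normr_ge0| |exact: HF].
  rewrite ler_pdivrMr ?ltr0n ?fact_gt0 //.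
  apply: (@le_trans _ _ ((eta * h) ^+ j)).
    by apply: lerXn2r; rewrite ?nnegrE // mulr_ge0 // ltW.
  by rewrite ler_peMr ?exprn_ge0 ?mulr_ge0 ?(ltW h0) // ler1n fact_gt0.
have -> : (eta * h) ^+ j * (C / h ^+ j * D) = eta ^+ j * C * D.
  by rewrite exprMn; field; rewrite expf_neq0 // gt_eqF.
rewrite ler_wpM2r // [X in _ <= X]mulrAC ler_wpM2r //.
case: j j1 jk {jm} => // j _ jk; rewrite exprSr ler_wpM2r //.
apply: (@le_trans _ _ (G ^+ j)); last by apply: ler_weXn2l => //; exact: ltnW.
by apply: lerXn2r; rewrite ?nnegrE.
Qed.

Lemma edge_product_bound h T (i : 'I_(nelt T)) e (u v t : pt -> R) (A B gamma : R) : 0 < h ->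
  admissible Omega alpha0 alpha1 q0 q1 h T -> (i, e) \in boundary_edges T -> L2_edge e t ->
  0 <= gamma -> 0 <= A -> 0 <= B ->
  (forall x, segment e x -> `|u x| <= A) -> (forall x, segment e x -> `|v x| <= B / h) ->
  `|edge_int e (fun x => u x * (v x - gamma * h^-1 * t x))| <=
  A * (Num.sqrt (2 * q1) * (gamma * edge_norm h e t) + 2 * q1 * B).
Proof.
move=> h0 ad ie Lt g0 A0 B0 Hu Hv; have [ev _] := boundary_edgesP ie.
have gh : 0 <= gamma / h by rewrite divr_ge0 // ltW.
have A1 : 0 <= A * (gamma / h) by rewrite mulr_ge0.
have B1 : 0 <= A * (B / h) by rewrite mulr_ge0 // divr_ge0 // ltW.
apply: (@le_trans _ _ _ _ _ (edge_int_bound Lt A1 B1 _)).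
  move=> x ex; rewrite normrM -(mulrA A (gamma / h)) -mulrDr.
  apply: ler_pM; [exact: normr_ge0|exact: normr_ge0|exact: Hu|].
  apply: le_trans (ler_normB _ _) _; rewrite addrC; apply: lerD; last exact: Hv.
  by rewrite normrM (ger0_norm gh).
have L1 := edge_scaling t h0 ad ie; have L2 := adm_edge_length ad ev.
apply: le_trans (lerD (ler_wpM2l A1 L1) (ler_wpM2r B1 L2)) _.
set s := Num.sqrt (2 * q1); set tt := edge_norm h e t.
have -> : A * (gamma / h) * (s * (h * tt)) + 2 * q1 * h * (A * (B / h)) =
   A * (s * (gamma * tt) + 2 * q1 * B) by field; rewrite gt_eqF.
exact: lexx.
Qed.

(** The constant depends on G but not on eta or gamma: continuity takes eta = G, and coercivity
    chooses eta after gamma. *)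
Lemma edge_gap_bound (G : R) (k : nat) : (k <= m)%N -> (0 < m)%N -> exists2 C : R, 0 < C &
  forall h T (i : 'I_(nelt T)) e phi psi t (gamma eta : R), 0 < h ->
  admissible Omega alpha0 alpha1 q0 q1 h T ->
  (i, e) \in boundary_edges T -> H1 (elt i) phi -> H1 (elt i) psi -> L2_edge e t ->
  0 <= gamma -> 0 <= eta <= G ->
  (forall x, segment e x -> outer_normal (dom T) e = 0 \/
     0 <= gap Omega (outer_normal (dom T) e) x <= eta * h) ->
  `|edge_int e (fun x =>
      (\sum_(1 <= j < k.+1) gap Omega (outer_normal (dom T) e) x ^+ j / (j`!)%:R
         * dnormal (outer_normal (dom T) e) j (P i phi) x)
      * (dnormal (outer_normal (dom T) e) 1 (P i psi) x - gamma * h^-1 * t x))| <=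
  C * eta * dnorm i phi * (dnorm i psi + gamma * edge_norm h e t).
Proof.
move=> km m0; have [C C0 HC] := dnormal_Pi_bound.
pose G1 := Num.max 1 G; have G11 : 1 <= G1 by rewrite le_max lexx.
pose C1 := k.+1%:R * G1 ^+ k * C.
have C10 : 0 < C1 by rewrite !mulr_gt0 ?ltr0n // exprn_gt0 // (lt_le_trans ltr01).
pose s := Num.sqrt (2 * q1); have s0 : 0 < s by rewrite sqrtr_gt0 mulr_gt0.
exists (C1 * (s + 2 * q1 * C)); first by rewrite mulr_gt0 // addr_gt0 // !mulr_gt0.
move=> h T i e phi psi t gamma eta h0 ad ie Hphi Hpsi Lt g0 /andP[e0 eG] Hgap.
have [ev _] := boundary_edgesP ie; have [n1 n2] := outer_normal_le1 T e.
have eG1 : 0 <= eta <= G1 by rewrite e0 le_max eG orbT.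
have real_part (D D' tt : R) : 0 <= D -> 0 <= D' -> 0 <= tt ->
    C1 * eta * D * (s * (gamma * tt) + 2 * q1 * (C * D')) <=
    C1 * (s + 2 * q1 * C) * eta * D * (D' + gamma * tt).
  move=> D0 D0' t0.
  have -> : C1 * (s + 2 * q1 * C) * eta * D * (D' + gamma * tt) =
     (C1 * eta * D) * ((s + 2 * q1 * C) * (D' + gamma * tt)) by ring.
  apply: ler_wpM2l; first exact: mulr_ge0 (mulr_ge0 (ltW C10) e0) D0.
  have k1 : 0 <= s * D' by rewrite mulr_ge0 // ltW.
  have k2 : 0 <= 2 * q1 * C * (gamma * tt) by rewrite !mulr_ge0 // ltW.
  have -> : (s + 2 * q1 * C) * (D' + gamma * tt) = s * (gamma * tt) + 2 * q1 * (C * D') + (s * D' + 2 * q1 * C * (gamma * tt)) by ring.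
  by rewrite lerDl addr_ge0.
apply: le_trans (real_part _ _ _ (sqrtr_ge0 _) (sqrtr_ge0 _) (edge_norm_ge0 h e t)).
apply: (edge_product_bound h0 ad ie Lt g0).
- by apply: mulr_ge0; [exact: mulr_ge0 (ltW C10) e0|exact: sqrtr_ge0].
- by apply: mulr_ge0; [exact: ltW|exact: sqrtr_ge0].
- move=> x ex; have cx := adm_segment_closure ad ev ex.
  apply: (gap_sum_bound h0 (ltW C0) (sqrtr_ge0 _) G11 eG1) => [j /andP[j1 jk]|].
    by apply: (HC h T i phi _ j x h0 ad Hphi n1 n2 _ cx); rewrite j1 (leq_trans jk km).
  case: (Hgap x ex) => [n0|]; last by right.
  by left => j j0; rewrite n0 dnormal0.
- move=> x ex; have cx := adm_segment_closure ad ev ex.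
  have := HC h T i psi _ 1%N x h0 ad Hpsi n1 n2 m0 cx.
  by rewrite expr1 (mulrAC C h^-1).
Qed.

End EdgeTerms.

(** * Summation over the boundary edges and the form a_h *)

Section Assembly.
Context {R : realType}.
Local Notation pt := (plane R).
Variables (m : nat) (Omega : set pt) (alpha0 alpha1 q0 q1 : R).
Hypotheses (sO : smooth_convex_domain Omega).
Hypotheses (a00 : 0 < alpha0) (a10 : 0 < alpha1) (q00 : 0 < q0) (q10 : 0 < q1).
Implicit Types (x n : pt) (e : pt * pt) (T : mesh R) (h : R) (phi psi t : pt -> R).

Local Notation P i f := (Pi_nabla (elt i) m f).
Local Notation dnorm i f := (Num.sqrt (dirichlet (elt i) f f)).
Local Notation tnorm h T f := (fun (i : 'I_(nelt T)) e => edge_norm h e (btrace T f)).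

Lemma bsum_le T (F G : 'I_(nelt T) -> pt * pt -> R) :
  (forall i e, (i, e) \in boundary_edges T -> `|F i e| <= G i e) -> `|bsum F| <= bsum G.
Proof.
move=> H; apply: le_trans (ler_norm_sum _ _ _) _.
rewrite /bsum big_seq [X in _ <= X]big_seq; apply: ler_sum => -[i e] ie; exact: H.
Qed.

Lemma bsum_lin T (a b : R) (F G : 'I_(nelt T) -> pt * pt -> R) :
  bsum (fun i e => a * F i e + b * G i e) = a * bsum F + b * bsum G.
Proof. by rewrite /bsum big_split /= !mulr_sumr. Qed.

Lemma bsum_ge0 T (F : 'I_(nelt T) -> pt * pt -> R) : (forall i e, 0 <= F i e) -> 0 <= bsum F.
Proof. by move=> H; apply: sumr_ge0 => -[i e] _; exact: H. Qed.

Lemma triple_norm_sqr h T phi : 0 < h -> admissible Omega alpha0 alpha1 q0 q1 h T ->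
  H1 (dom T) phi ->
  triple_norm T h phi ^+ 2 = \sum_(i < nelt T) dnorm i phi ^+ 2 + bsum (fun i e => tnorm h T phi i e ^+ 2).
Proof.
move=> h0 ad Hphi; rewrite /triple_norm.
have E1 : H1semi2 (dom T) phi = \sum_(i < nelt T) dnorm i phi ^+ 2.
  rewrite (H1semi2_dom ad Hphi); apply: eq_bigr => i _.
  exact: (esym (sqr_sqrtr (dirichlet_ge0 _ _))).
have E2 : h^-1 * bsum (fun (i : 'I_(nelt T)) e => edge_int e (fun x => btrace T phi x ^+ 2)) =
    bsum (fun i e => tnorm h T phi i e ^+ 2).
  rewrite /bsum mulr_sumr; apply: eq_bigr => -[i e] _; exact: (esym (edge_norm_sqr e _ h0)).
rewrite E1 E2 sqr_sqrtr //; apply: addr_ge0; last by apply: bsum_ge0 => i e; exact: sqr_ge0.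
by apply: sumr_ge0 => i _; exact: sqr_ge0.
Qed.

Lemma sum_le_product (J : Type) (s : seq J) (a b : J -> R) (A B : R) : 0 <= A -> 0 <= B ->
  \sum_(j <- s) a j ^+ 2 <= A ^+ 2 -> \sum_(j <- s) b j ^+ 2 <= B ^+ 2 ->
  \sum_(j <- s) a j * b j <= A * B.
Proof.
move=> A0 B0 aA bB; apply: le_trans (ler_norm _) _.
apply: le_trans (sum_cauchy_schwarz s a b) _.
apply: ler_pM; [exact: sqrtr_ge0|exact: sqrtr_ge0| |].
  by rewrite -[X in _ <= X](ger0_norm A0) -sqrtr_sqr; apply: ler_wsqrtr.
by rewrite -[X in _ <= X](ger0_norm B0) -sqrtr_sqr; apply: ler_wsqrtr.
Qed.

(** Cauchy-Schwarz over the boundary edges with (d + t)^2 <= 2 d^2 + 2 t^2; the element terms are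
    repeated at most N times, and N + 1 covers both sums. *)
Lemma bsum_product_bound (N : nat) T (d d' : 'I_(nelt T) -> R) (t t' : 'I_(nelt T) -> pt * pt -> R) (X X' : R) :
  (forall i, (size (edges (@vtx _ T i)) <= N)%N) -> 0 <= X -> 0 <= X' ->
  X ^+ 2 = \sum_i d i ^+ 2 + bsum (fun i e => t i e ^+ 2) ->
  X' ^+ 2 = \sum_i d' i ^+ 2 + bsum (fun i e => t' i e ^+ 2) ->
  bsum (fun i e => (d i + t i e) * (d' i + t' i e)) <= 2 * N.+1%:R * (X * X').
Proof.
move=> sN X0 X0' XE XE'.
pose c : R := Num.sqrt (2 * N.+1%:R).
have c2 : c ^+ 2 = 2 * N.+1%:R by rewrite sqr_sqrtr.
have one (f : 'I_(nelt T) -> R) (u : 'I_(nelt T) -> pt * pt -> R) (Y : R) :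
    Y ^+ 2 = \sum_i f i ^+ 2 + bsum (fun i e => u i e ^+ 2) ->
    \sum_(ie <- boundary_edges T) (f ie.1 + u ie.1 ie.2) ^+ 2 <= (c * Y) ^+ 2.
  move=> YE; rewrite exprMn c2 YE.
  apply: (@le_trans _ _ (2 * bsum (fun i e => f i ^+ 2) + 2 * bsum (fun i e => u i e ^+ 2))).
    rewrite -bsum_lin; apply: ler_sum => -[i e] _ /=.
    by have := sqr_ge0 (f i - u i e); nra.
  have s0 : 0 <= \sum_i f i ^+ 2 by apply: sumr_ge0 => i _; exact: sqr_ge0.
  have b0 : 0 <= bsum (fun i e => u i e ^+ 2) by apply: bsum_ge0 => i e; exact: sqr_ge0.
  have := @bsum_elt_le R N T (fun i => f i ^+ 2) (fun i => sqr_ge0 _) sN.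
  rewrite -/(bsum (fun i e => f i ^+ 2)).
  have NE : N.+1%:R = N%:R + 1 :> R by rewrite natr1.
  move: s0 b0; rewrite NE; have N0 : 0 <= N%:R :> R by [].
  move: N0; move: (N%:R) (\sum_i _) (bsum _) (bsum _) => n p q r n0 p0 r0 le_q; have := mulr_ge0 n0 r0; lra.
have -> : 2 * N.+1%:R * (X * X') = (c * X) * (c * X') by rewrite [RHS]mulrACA -expr2 c2.
by apply: sum_le_product; rewrite ?mulr_ge0 ?sqrtr_ge0 //; [exact: one|exact: one].
Qed.

Lemma elt_open h T (i : 'I_(nelt T)) : admissible Omega alpha0 alpha1 q0 q1 h T -> open (elt i).
Proof. by move=> [_ [pE _ _] _ _ _]; have [] := pE i. Qed.

(** The projected parts are bounded by Cauchy-Schwarz and the residuals, whose projections vanish,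
    by the continuity of the stabilization; Pythagoras bounds both by the full energies. *)
Lemma a_h_bound (s2 : R) h T (S : stab_form T) phi psi : 0 < h ->
  admissible Omega alpha0 alpha1 q0 q1 h T ->
  (forall i, stab_continuous (elt i) m s2 (S i)) -> 0 < s2 ->
  H1 (dom T) phi -> H1 (dom T) psi ->
  `|a_h m S phi psi| <= (1 + s2) * \sum_(i < nelt T) dnorm i phi * dnorm i psi.
Proof.
move=> h0 ad sc s20 Hphi Hpsi; have [M HM] := adm_elt_square alpha0 alpha1 q0 q1 sO.
rewrite /a_h mulr_sumr; apply: le_trans (ler_norm_sum _ _ _) _; apply: ler_sum => i _.
have oi : open (elt i) := elt_open ad; have KM : elt i `<=` square M := HM h T i ad.
have [a _ sq] := adm_inner_square a00 q00 i h0 ad.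
have l0 : 0 < alpha0 * q0 / 3 * h by rewrite mulr_gt0 // divr_gt0 // mulr_gt0.
have Hf : H1 (elt i) phi := H1_elt i ad Hphi; have Hg : H1 (elt i) psi := H1_elt i ad Hpsi.
have Pf := H1_Pol oi KM (@Pol_Pi R (elt i) m phi).
have Pg := H1_Pol oi KM (@Pol_Pi R (elt i) m psi).
have Rf := H1_sub oi Hf Pf; have Rg := H1_sub oi Hg Pg.
have c1 := dirichlet_cauchy_schwarz oi Pf Pg.
have c2 := sc i _ _ Rf Rg (fun x => Pi_nabla_residual m oi KM l0 sq x Hf) (fun x => Pi_nabla_residual m oi KM l0 sq x Hg).
have sf := dirichlet_Pi_split m oi KM Hf; have sg := dirichlet_Pi_split m oi KM Hg.
have key (x y p p' r r' d d' : R) : 0 <= p -> 0 <= p' -> 0 <= r -> 0 <= r' ->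
    d = p + r -> d' = p' + r' ->
    `|x| <= Num.sqrt p * Num.sqrt p' -> `|y| <= s2 * Num.sqrt r * Num.sqrt r' ->
    `|x + y| <= (1 + s2) * (Num.sqrt d * Num.sqrt d').
  move=> p0 p0' r0 r0' dE dE' xb yb; apply: le_trans (ler_normD _ _) _.
  rewrite mulrDl mul1r; apply: lerD.
    apply: le_trans xb _; apply: ler_pM; rewrite ?sqrtr_ge0 //; apply: ler_wsqrtr.
      by rewrite dE lerDl.
    by rewrite dE' lerDl.
  apply: le_trans yb _; rewrite -mulrA; apply: ler_wpM2l; first exact: ltW.
  apply: ler_pM; rewrite ?sqrtr_ge0 //; apply: ler_wsqrtr.
    by rewrite dE lerDr.
  by rewrite dE' lerDr.
exact: (key _ _ _ _ _ _ _ _ (dirichlet_ge0 _ _) (dirichlet_ge0 _ _) (dirichlet_ge0 _ _) (dirichlet_ge0 _ _) sf sg c1 c2).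
Qed.

(** The residual is in the local space and has zero projection, so the lower bound s0 applies to it;
    the projected part counts with weight 1. *)
Lemma a_h_coercive (s0 s1 : R) h T (S : stab_form T) phi : 0 < h ->
  admissible Omega alpha0 alpha1 q0 q1 h T ->
  (forall i, stabilizing (elt i) (@vtx _ T i) m s0 s1 (S i)) ->
  (forall i, Vloc (elt i) (@vtx _ T i) m phi) -> H1 (dom T) phi ->
  Num.min 1 s0 * \sum_(i < nelt T) dnorm i phi ^+ 2 <= a_h m S phi phi.
Proof.
move=> h0 ad st Vphi Hphi; have [M HM] := adm_elt_square alpha0 alpha1 q0 q1 sO.
rewrite /a_h mulr_sumr; apply: ler_sum => i _.
have oi : open (elt i) := elt_open ad; have KM : elt i `<=` square M := HM h T i ad.
have [a _ sq] := adm_inner_square a00 q00 i h0 ad.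
have l0 : 0 < alpha0 * q0 / 3 * h by rewrite mulr_gt0 // divr_gt0 // mulr_gt0.
have Hf : H1 (elt i) phi := H1_elt i ad Hphi.
have Vr := Vloc_sub_Pol oi KM (Vphi i) (@Pol_Pi R (elt i) m phi).
have [_ /(_ _ Vr (fun x => Pi_nabla_residual m oi KM l0 sq x Hf)) /andP[sl _]] := st i.
have sf := dirichlet_Pi_split m oi KM Hf.
have key (p r d y c : R) : 0 <= p -> 0 <= r -> d = p + r -> s0 * r <= y -> c <= 1 -> c <= s0 ->
    c * Num.sqrt d ^+ 2 <= p + y.
  move=> p0 r0 dE sy c1 c2; rewrite sqr_sqrtr dE ?addr_ge0 // mulrDr; apply: lerD; first exact: ler_piMl.
  by apply: le_trans sy; apply: ler_wpM2r.
apply: (key _ _ _ _ _ (dirichlet_ge0 _ _) (dirichlet_ge0 _ _) sf sl).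
  by rewrite ge_min lexx.
by rewrite ge_min lexx orbT.
Qed.

End Assembly.

(** * Continuity and coercivity of the full form *)

Section ContinuityAndCoercivity.
Context {R : realType}.
Local Notation pt := (plane R).
Variables (m k : nat) (Omega : set pt) (alpha0 alpha1 q0 q1 s0 s1 s2 : R).
Hypotheses (sO : smooth_convex_domain Omega).
Hypotheses (a00 : 0 < alpha0) (a10 : 0 < alpha1) (q00 : 0 < q0) (q10 : 0 < q1).
Hypotheses (s00 : 0 < s0) (s20 : 0 < s2) (m0 : (0 < m)%N) (km : (k <= m)%N).
Implicit Types (x n : pt) (e : pt * pt) (T : mesh R) (h : R) (phi psi t : pt -> R).

Local Notation P i f := (Pi_nabla (elt i) m f).
Local Notation dnorm i f := (Num.sqrt (dirichlet (elt i) f f)).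
Local Notation tnorm h T f := (fun (i : 'I_(nelt T)) e => edge_norm h e (btrace T f)).

Lemma trace_product_bound h T phi psi (i : 'I_(nelt T)) e : 0 < h ->
  (i, e) \in boundary_edges T ->
  `|h^-1 * edge_int e (fun x => btrace T phi x * btrace T psi x)| <=
  edge_norm h e (btrace T phi) * edge_norm h e (btrace T psi).
Proof.
move=> h0 ie.
have key (x sa sb a b : R) : sa = Num.sqrt h * a -> sb = Num.sqrt h * b ->
    `|x| <= sa * sb -> `|h^-1 * x| <= a * b.
  move=> -> ->; rewrite mulrACA -expr2 sqr_sqrtr ?(ltW h0) // => H.
  by rewrite normrM normfV (gtr0_norm h0) mulrC ler_pdivrMr // mulrC.
apply: (key _ _ _ _ _ (edge_norm_unscale e _ h0) (edge_norm_unscale e _ h0)).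
exact: edge_int_cauchy_schwarz (btrace_L2_edge phi ie) (btrace_L2_edge psi ie).
Qed.

Lemma A_form_continuous (gamma : R) : 0 < gamma -> exists2 C : R, 0 < C &
  forall h T (S : stab_form T), 0 < h -> admissible Omega alpha0 alpha1 q0 q1 h T ->
    (forall i, stab_continuous (elt i) m s2 (S i)) ->
    forall phi psi, H1 (dom T) phi -> H1 (dom T) psi ->
    `|A_form Omega m k S h gamma phi psi| <= C * (triple_norm T h phi * triple_norm T h psi).
Proof.
move=> g0; have [G G0 HG] := gap_bound alpha1 a00 q00 q10 sO.
(* Only the bound G h on the gap is used for continuity, so the tolerance 1 is arbitrary. *)
have [h1 _ Hgap] := HG 1 ltr01.
have [N HN] := vertex_count_bound Omega q1 a00 a10 q00.
have [K1 K10 HK1] := edge_consistency_bound alpha1 sO a00 q00 q10 m0.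
have [K2 K20 HK2] := edge_gap_bound alpha1 sO a00 q00 q10 G km m0.
pose K := K1 + K1 + gamma + K2 * G * (1 + gamma).
have K30 : 0 < K2 * G * (1 + gamma) by rewrite !mulr_gt0 // addr_gt0.
have K0 : 0 < K by rewrite !addr_gt0.
exists (1 + s2 + K * (2 * N.+1%:R)).
  by rewrite !addr_gt0 // mulr_gt0 // mulr_gt0 // ltr0n.
(* Here p, p' stand for element energies and q, q' for edge norms: each consistency or penalty term
   is bounded by one product in the expansion of (p + q)(p' + q'). *)
have pr (c p q p' q' x : R) : 0 < c -> 0 <= p -> 0 <= q -> 0 <= p' -> 0 <= q' ->
    (x <= c * (p * q') -> x <= c * ((p + q) * (p' + q'))) /\
    (x <= c * (p' * q) -> x <= c * ((p + q) * (p' + q'))) /\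
    (x <= c * (q * q') -> x <= c * ((p + q) * (p' + q'))).
  move=> c0 p0 q0' p0' q0''.
  have [z1 z2 z3 z4] : [/\ 0 <= p * p', 0 <= p * q', 0 <= q * p' & 0 <= q * q'] by rewrite !mulr_ge0.
  have -> : (p + q) * (p' + q') = p * p' + p * q' + q * p' + q * q' by ring.
  rewrite (mulrC p' q).
  by split; [|split] => hx; apply: le_trans hx _; apply: ler_wpM2l; rewrite ?(ltW c0) //; lra.
have gap_key (p q p' q' : R) : 0 <= p -> 0 <= q -> 0 <= p' -> 0 <= q' ->
    K2 * G * p * (p' + gamma * q') <= K2 * G * (1 + gamma) * ((p + q) * (p' + q')).
  move=> p0 q0' p0' q0''; rewrite -!(mulrA (K2 * G)); apply: ler_wpM2l; first by rewrite mulr_ge0 // ltW.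
  have [z1 z2 z3 z4] : [/\ 0 <= p * p', 0 <= p * q', 0 <= q * p' & 0 <= q * q'] by rewrite !mulr_ge0.
  have -> : (p + q) * (p' + q') = p * p' + p * q' + q * p' + q * q' by ring.
  have y1 := mulr_ge0 (ltW g0) z1; have y2 := mulr_ge0 (ltW g0) z3; have y3 := mulr_ge0 (ltW g0) z4.
  by rewrite mulrDr mulrDl mul1r (mulrCA p gamma) !mulrDr; lra.
have key (a c1 c2 c3 c4 X W : R) : `|a| <= (1 + s2) * X -> `|c1| <= K1 * W -> `|c2| <= K1 * W ->
    `|c3| <= gamma * W -> `|c4| <= K2 * G * (1 + gamma) * W -> W <= 2 * N.+1%:R * X ->
    `|a - c1 - c2 + c3 - c4| <= (1 + s2 + K * (2 * N.+1%:R)) * X.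
  move=> ha h1' h2 h3 h4 hW.
  apply: (@le_trans _ _ ((1 + s2) * X + K * W)).
    rewrite /K !mulrDl; move: ha h1' h2 h3 h4; rewrite !mulrDl !ler_norml.
    move=> /andP[? ?] /andP[? ?] /andP[? ?] /andP[? ?] /andP[? ?]; apply/andP; split; lra.
  rewrite [X in _ <= X]mulrDl lerD2l -mulrA; apply: ler_wpM2l hW; exact: ltW.
move=> h T S h0 ad sc phi psi Hphi Hpsi.
have X0 : 0 <= triple_norm T h phi := sqrtr_ge0 _.
have Y0 : 0 <= triple_norm T h psi := sqrtr_ge0 _.
have XE := triple_norm_sqr h0 ad Hphi.
have YE := triple_norm_sqr h0 ad Hpsi.
pose w (i : 'I_(nelt T)) e := (dnorm i phi + tnorm h T phi i e) * (dnorm i psi + tnorm h T psi i e).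
have wB : bsum w <= 2 * N.+1%:R * (triple_norm T h phi * triple_norm T h psi).
  exact: (bsum_product_bound (fun i => HN h T i h0 ad) X0 Y0 XE YE).
have ab : `|a_h m S phi psi| <= (1 + s2) * (triple_norm T h phi * triple_norm T h psi).
  apply: le_trans (a_h_bound sO a00 q00 h0 ad sc s20 Hphi Hpsi) _.
  apply: ler_wpM2l; first by rewrite addr_ge0 // ltW.
  apply: sum_le_product => //.
    by rewrite XE lerDl; apply: bsum_ge0 => i e; exact: sqr_ge0.
  by rewrite YE lerDl; apply: bsum_ge0 => i e; exact: sqr_ge0.
have bsumZ (c : R) : c * bsum w = bsum (fun i e => c * w i e) by rewrite /bsum mulr_sumr.
have D0 (i : 'I_(nelt T)) f : 0 <= dnorm i f := sqrtr_ge0 _.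
have t0 f e : 0 <= edge_norm h e (btrace T f) := edge_norm_ge0 _ _ _.
have b1 : `|bsum (fun (i : 'I_(nelt T)) e => edge_int e (fun x =>
      dnormal (outer_normal (dom T) e) 1 (P i phi) x * btrace T psi x))| <= K1 * bsum w.
  rewrite bsumZ; apply: bsum_le => i e ie.
  apply: (pr _ _ _ _ _ _ K10 (D0 i phi) (t0 phi e) (D0 i psi) (t0 psi e)).1.
  exact: HK1 h0 ad ie (H1_elt i ad Hphi) (btrace_L2_edge psi ie).
have b2 : `|bsum (fun (i : 'I_(nelt T)) e => edge_int e (fun x =>
      dnormal (outer_normal (dom T) e) 1 (P i psi) x * btrace T phi x))| <= K1 * bsum w.
  rewrite bsumZ; apply: bsum_le => i e ie.
  apply: (pr _ _ _ _ _ _ K10 (D0 i phi) (t0 phi e) (D0 i psi) (t0 psi e)).2.1.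
  exact: HK1 h0 ad ie (H1_elt i ad Hpsi) (btrace_L2_edge phi ie).
have b3 : `|gamma * h^-1 * bsum (fun (i : 'I_(nelt T)) e => edge_int e (fun x =>
      btrace T phi x * btrace T psi x))| <= gamma * bsum w.
  have -> : gamma * h^-1 * bsum (fun (i : 'I_(nelt T)) e => edge_int e (fun x => btrace T phi x * btrace T psi x)) =
      bsum (fun (i : 'I_(nelt T)) e => gamma * (h^-1 * edge_int e (fun x => btrace T phi x * btrace T psi x))).
    by rewrite /bsum mulr_sumr; apply: eq_bigr => -[i e] _; exact: (esym (mulrA _ _ _)).
  rewrite bsumZ.
  apply: bsum_le => i e ie.
  rewrite normrM (gtr0_norm g0).
  apply: (pr _ _ _ _ _ _ g0 (D0 i phi) (t0 phi e) (D0 i psi) (t0 psi e)).2.2.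
  by apply: ler_wpM2l; [exact: ltW|exact: (trace_product_bound phi psi h0 ie)].
have b4 : `|bsum (fun (i : 'I_(nelt T)) e => edge_int e (fun x =>
      (\sum_(1 <= j < k.+1) gap Omega (outer_normal (dom T) e) x ^+ j / (j`!)%:R
         * dnormal (outer_normal (dom T) e) j (P i phi) x)
      * (dnormal (outer_normal (dom T) e) 1 (P i psi) x - gamma * h^-1 * btrace T psi x)))| <=
      K2 * G * (1 + gamma) * bsum w.
  rewrite bsumZ; apply: bsum_le => i e ie.
  have GG : 0 <= G <= G by rewrite lexx (ltW G0).
  have Hg x : segment e x -> outer_normal (dom T) e = 0 \/
     0 <= gap Omega (outer_normal (dom T) e) x <= G * h.
    by move=> ex; case: (Hgap h T i e x h0 ad ie ex) => [|[_ gg _]]; [left|right].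
  apply: le_trans (HK2 h T i e phi psi _ gamma G h0 ad ie (H1_elt i ad Hphi) (H1_elt i ad Hpsi) (btrace_L2_edge psi ie) (ltW g0) GG Hg) _.
  exact: (gap_key _ _ _ _ (D0 i phi) (t0 phi e) (D0 i psi) (t0 psi e)).
exact: key ab b1 b2 b3 b4 wB.
Qed.

Lemma A_form_coercive : exists2 gamma0 : R, 0 < gamma0 & forall gamma : R, gamma0 < gamma ->
  exists2 h0 : R, 0 < h0 & exists2 c : R, 0 < c &
  forall h T (S : stab_form T), 0 < h -> h < h0 -> admissible Omega alpha0 alpha1 q0 q1 h T ->
    (forall i, stabilizing (elt i) (@vtx _ T i) m s0 s1 (S i)) ->
    forall phi, Vh T m phi ->
    c * triple_norm T h phi ^+ 2 <= A_form Omega m k S h gamma phi phi.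
Proof.
have [G G0 HG] := gap_bound alpha1 a00 q00 q10 sO.
have [N HN] := vertex_count_bound Omega q1 a00 a10 q00.
have [K1 K10 HK1] := edge_consistency_bound alpha1 sO a00 q00 q10 m0.
have [K2 K20 HK2] := edge_gap_bound alpha1 sO a00 q00 q10 1 km m0.
have [c1 c1E] : exists c1, c1 = Num.min 1 s0 by eexists.
have c10 : 0 < c1 by rewrite c1E lt_min ltr01.
have NN : 0 < N.+1%:R :> R by rewrite ltr0n.
(* An element energy occurs at most N times in a sum over boundary edges, so with this weight the
   two consistency terms cost at most a quarter of [c1], and the gap terms another quarter. *)
have [ep epE] : exists ep, ep = c1 / (4 * N.+1%:R) by eexists.
have ep0 : 0 < ep by rewrite epE divr_gt0 // mulr_gt0.
have epN : ep * N.+1%:R = c1 / 4 by rewrite epE; field; rewrite gt_eqF.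
have K0 : 0 < K1 ^+ 2 / ep by rewrite divr_gt0 // exprn_gt0.
(* Young's inequality puts K1^2 / (2 ep) on the edge norm for each of the two consistency terms; the
   summand 1 pays for the gap terms. *)
exists (K1 ^+ 2 / ep + 1) => [|gamma gg]; first by rewrite addr_gt0.
have g0 : 0 < gamma by apply: lt_trans gg; rewrite addr_gt0.
have q00' : 0 < K2 * (1 + gamma) by rewrite mulr_gt0 // addr_gt0.
(* The first entry meets the range required by [edge_gap_bound] with G = 1; the other two give ka <=
   1 and ka <= ep. *)
have [eta etaE] : exists eta, eta = Num.min 1 (Num.min ((K2 * (1 + gamma))^-1) (ep / (K2 * (1 + gamma)))) by eexists.
have eta0 : 0 < eta by rewrite etaE !lt_min ltr01 invr_gt0 q00' divr_gt0.
have eta1 : 0 <= eta <= 1 by rewrite ltW // etaE ge_min lexx.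
have [ka kaE] : exists ka, ka = K2 * eta * (1 + gamma) by eexists.
have ka1 : ka <= 1.
  have -> : ka = eta * (K2 * (1 + gamma)) by rewrite kaE; ring.
  by rewrite -ler_pdivlMr // mul1r etaE !ge_min lexx !orbT.
have ka2 : ka <= ep.
  have -> : ka = eta * (K2 * (1 + gamma)) by rewrite kaE; ring.
  by rewrite -ler_pdivlMr // etaE !ge_min lexx !orbT.
(* The threshold on h comes from the gap estimate with tolerance eta, and eta depends on gamma. *)
have [h1 h10 Hgap] := HG eta eta0; exists h1 => //.
(* What is left of the element energies and of the penalty after the consistency and gap terms are
   absorbed. *)
exists (Num.min (c1 / 2) (gamma - (K1 ^+ 2 / ep + 1))).
  by rewrite lt_min subr_gt0 gg andbT divr_gt0.
have young (p q x : R) : x <= K1 * (p * q) -> x <= ep / 2 * p ^+ 2 + K1 ^+ 2 / ep / 2 * q ^+ 2.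
  move=> hx; apply: le_trans hx _; rewrite -subr_ge0.
  have -> : ep / 2 * p ^+ 2 + K1 ^+ 2 / ep / 2 * q ^+ 2 - K1 * (p * q) =
    (ep * p - K1 * q) ^+ 2 / (2 * ep) by field; rewrite gt_eqF.
  by rewrite divr_ge0 ?sqr_ge0 // mulr_ge0 // ltW.
have gap_key (p q : R) : 0 <= p -> 0 <= q ->
    K2 * eta * p * (p + gamma * q) <= ka * p ^+ 2 + ka * q ^+ 2.
  move=> p0 q0'; rewrite kaE -mulrDr -!(mulrA (K2 * eta)); apply: ler_wpM2l; first by rewrite mulr_ge0 // ltW.
  have z : 0 <= gamma * (p ^+ 2 + q ^+ 2 - p * q).
    by rewrite mulr_ge0 ?(ltW g0) //; nra.
  by have := sqr_ge0 q; move: z; rewrite !mulrDr !mulrDl !mul1r -!expr2; nra.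
have NE : N%:R <= N.+1%:R :> R by rewrite ler_nat.
have key (h a b d f SD St B A : R) : 0 <= SD -> 0 <= St -> c1 * SD <= a -> B <= N%:R * SD ->
    `|b| <= ep / 2 * B + K1 ^+ 2 / ep / 2 * St -> h^-1 * d = St ->
    `|f| <= ka * B + ka * St -> A = a - b - b + gamma * h^-1 * d - f ->
    Num.min (c1 / 2) (gamma - (K1 ^+ 2 / ep + 1)) * (SD + St) <= A.
  move=> SD0' St0' ha hB; rewrite !ler_norml => /andP[_ hb] dE /andP[_ hf] ->.
  have BS : B <= N.+1%:R * SD by apply: le_trans hB _; apply: ler_wpM2r.
  have eB : ep * B <= c1 / 4 * SD by rewrite -epN -mulrA; apply: ler_wpM2l => //; exact: ltW.
  have kB : ka * B <= c1 / 4 * SD.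
    have [B0|B0] := leP 0 B; first by apply: le_trans eB; apply: ler_wpM2r.
    apply: (@le_trans _ _ 0); last by rewrite mulr_ge0 // divr_ge0 // ltW.
    by rewrite mulr_ge0_le0 ?(ltW B0) // kaE !mulr_ge0 ?(ltW K20) ?(ltW eta0) // addr_ge0 // ltW.
  have kS : ka * St <= St by apply: ler_piMl.
  rewrite -(mulrA gamma) dE mulrDr.
  apply: (@le_trans _ _ (c1 / 2 * SD + (gamma - (K1 ^+ 2 / ep + 1)) * St)).
    by apply: lerD; apply: ler_wpM2r => //; rewrite ge_min lexx ?orbT.
  move: hb; move: (K1 ^+ 2 / ep) => Q hb; rewrite mulrBl mulrDl; lra.
move=> h T S h0 hh ad st phi [Hphi Vphi].
rewrite (triple_norm_sqr h0 ad Hphi).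
have ac := a_h_coercive sO a00 q00 h0 ad st Vphi Hphi; rewrite -c1E in ac.
have BN := @bsum_elt_le R N T (fun i => dnorm i phi ^+ 2) (fun i => sqr_ge0 _) (fun i => HN h T i h0 ad).
have SD0 : 0 <= \sum_(i < nelt T) dnorm i phi ^+ 2 by apply: sumr_ge0 => i _; exact: sqr_ge0.
have St0 : 0 <= bsum (fun i e => tnorm h T phi i e ^+ 2) by apply: bsum_ge0 => i e; exact: sqr_ge0.
have t0 f e : 0 <= edge_norm h e (btrace T f) := edge_norm_ge0 _ _ _.
rewrite -/(bsum (fun (i : 'I_(nelt T)) e => dnorm i phi ^+ 2)) in BN.
have b1 : `|bsum (fun (i : 'I_(nelt T)) e => edge_int e (fun x =>
      dnormal (outer_normal (dom T) e) 1 (P i phi) x * btrace T phi x))| <=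
      ep / 2 * bsum (fun (i : 'I_(nelt T)) e => dnorm i phi ^+ 2) + K1 ^+ 2 / ep / 2 * bsum (fun i e => tnorm h T phi i e ^+ 2).
  rewrite -bsum_lin; apply: bsum_le => i e ie.
  apply: young; exact: HK1 h0 ad ie (H1_elt i ad Hphi) (btrace_L2_edge phi ie).
have b3 : h^-1 * bsum (fun (i : 'I_(nelt T)) e => edge_int e (fun x =>
      btrace T phi x * btrace T phi x)) = bsum (fun i e => tnorm h T phi i e ^+ 2).
  rewrite /bsum mulr_sumr; apply: eq_bigr => -[i e] _; exact: (esym (edge_norm_sqr e _ h0)).
have b4 : `|bsum (fun (i : 'I_(nelt T)) e => edge_int e (fun x =>
      (\sum_(1 <= j < k.+1) gap Omega (outer_normal (dom T) e) x ^+ j / (j`!)%:R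
         * dnormal (outer_normal (dom T) e) j (P i phi) x)
      * (dnormal (outer_normal (dom T) e) 1 (P i phi) x - gamma * h^-1 * btrace T phi x)))| <=
      ka * bsum (fun (i : 'I_(nelt T)) e => dnorm i phi ^+ 2) + ka * bsum (fun i e => tnorm h T phi i e ^+ 2).
  rewrite -bsum_lin; apply: bsum_le => i e ie.
  have Hg x : segment e x -> outer_normal (dom T) e = 0 \/
     0 <= gap Omega (outer_normal (dom T) e) x <= eta * h.
    move=> ex; case: (Hgap h T i e x h0 ad ie ex) => [|[_ /andP[gg0 _] /(_ hh) ge]]; [by left|right].
    by rewrite gg0.
  apply: le_trans (HK2 h T i e phi phi _ gamma eta h0 ad ie (H1_elt i ad Hphi) (H1_elt i ad Hphi) (btrace_L2_edge phi ie) (ltW g0) eta1 Hg) _.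
  exact: gap_key (sqrtr_ge0 _) (t0 _ _).
exact: (key _ _ _ _ _ _ _ _ _ SD0 St0 ac BN b1 b3 b4 (erefl _)).
Qed.

End ContinuityAndCoercivity.

Theorem lemma3p1 (R : realType) (m k : nat) (Omega : set (plane R))
    (alpha0 alpha1 q0 q1 s0 s1 s2 : R)
    (hm : (1 <= m)%N) (hk : k = (m %/ 2)%N)
    (hOmega : smooth_convex_domain Omega)
    (halpha0 : 0 < alpha0) (halpha1 : 0 < alpha1)
    (hq0 : 0 < q0) (hq1 : 0 < q1)
    (hs0 : 0 < s0) (hs1 : 0 < s1) (hs2 : 0 < s2) :
  (forall gamma : R, 0 < gamma ->
    exists2 C : R, 0 < C &
      forall (h : R) (T : mesh R) (S : stab_form T), 0 < h <= 1 ->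
        admissible Omega alpha0 alpha1 q0 q1 h T ->
        (forall i, stabilizing (elt i) (vtx i) m s0 s1 (S i)) ->
        (forall i, stab_continuous (elt i) m s2 (S i)) ->
        forall phi psi : plane R -> R, Hspace T h phi -> Hspace T h psi ->
          `|A_form Omega m k S h gamma phi psi|
            <= C * (triple_norm T h phi * triple_norm T h psi))
  /\
  (exists2 gamma0 : R, 0 < gamma0 &
    forall gamma : R, gamma0 < gamma ->
      exists2 h0 : R, 0 < h0 &
      exists2 c : R, 0 < c &
        forall (h : R) (T : mesh R) (S : stab_form T), 0 < h <= 1 -> h < h0 ->
          admissible Omega alpha0 alpha1 q0 q1 h T ->
          (forall i, stabilizing (elt i) (vtx i) m s0 s1 (S i)) ->
          forall phi : plane R -> R, Vh T m phi ->
            c * triple_norm T h phi ^+ 2 <= A_form Omega m k S h gamma phi phi).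
Proof.
have km : (k <= m)%N by rewrite hk leq_div.
split=> [gamma g0|].
  have [C C0 H] := A_form_continuous hOmega halpha0 halpha1 hq0 hq1 hs2 hm km g0.
  exists C => // h T S /andP[h0 _] ad _ sc phi psi [Hphi _] [Hpsi _].
  exact: H.
have [gamma0 g0 H] := A_form_coercive s1 hOmega halpha0 halpha1 hq0 hq1 hs0 hm km.
exists gamma0 => // gamma gg; have [h0 h00 [c c0 H']] := H gamma gg.
exists h0 => //; exists c => // h T S /andP[hp _]; exact: H'.
Qed.
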